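(* There is an algorithm which, given $n\in\mathbb{N}$ and a simply connected DGA $\mathcal{A}$ equipped with a strong homotopy equivalence between (the underlying cochain complex of) $\mathcal{A}$ and a cochain complex $C^*\otimes\mathbb{Q}$, where $C^*$ is an effective cochain complex of abelian groups with finite-dimensional homology (in each degree), constructs an $n$-minimal model for $\mathcal{A}$.
   Context: All vector spaces and algebras are over $\mathbb{Q}$. DGAs: A DGA (commutative cochain algebra) is a graded vector space $\mathcal{A}=\bigoplus_{p\ge 0}\mathcal{A}^p$ with a multiplication $\mathcal{A}^p\otimes\mathcal{A}^q\to\mathcal{A}^{p+q}$ satisfying $a\cdot b=(-1)^{pq}b\cdot a$ and a differential $d\colon\mathcal{A}^p\to\mathcal{A}^{p+1}$ with $d^2=0$ and $d(a\cdot b)=d(a)\cdot b+(-1)^p a\cdot d(b)$. It is simply connected if $H^0(\mathcal{A})=\mathbb{Q}$ and $H^1(\mathcal{A})=0$. A DGA is free as a graded-commutative algebra if it is the tensor product of a polynomial algebra on generators of even degrees and an exterior algebra on generators of odd degrees. A DGA $\mathcal M$ is minimal if it is free as a graded-commutative algebra on generators of degrees $\ge 2$ and $d(\mathcal{M}^+)\subset\mathcal{M}^+\cdot\mathcal{M}^+$, where $+$ denotes positive degree. It is $n$-minimal if it is minimal and all generators have degree at most $n$. A morphism of DGAs $f\colon\mathcal{B}\to\mathcal{A}$ is an $n$-quasi-isomorphism if $f^*\colon H^j(\mathcal{B})\to H^j(\mathcal{A})$ is an isomorphism for every $j\le n$ and a monomorphism for $j=n+1$. An $n$-minimal model of $\mathcal{A}$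 is an $n$-minimal DGA $\mathcal{M}$ together with an $n$-quasi-isomorphism $\mathcal{M}\to\mathcal{A}$. Effectiveness: All (co)chain complexes are non-negatively graded and consist of free $\mathbb{Z}$-modules or $\mathbb{Q}$-vector spaces. They are locally effective: elements of the graded module can be represented in a computer and the operations of zero, addition and differential are computable. All maps, homotopies, etc. are computable. An effective (co)chain complex is a (locally effective) free (co)chain complex with an algorithm that generates a list of the elements of the distinguished basis in any given dimension (in particular these bases are finite in each dimension). Reductions: A reduction $(f,g,h)\colon C\Rightarrow D$ of cochain complexes $(C,d_C),(D,d_D)$ consists of cochain maps $f\colon C\to D$, $g\colon D\to C$ of degree $0$ and a map $h\colon C\to C$ of degree $-1$ such that $fg=\mathrm{id}_D$, $\mathrm{id}_C-gf=d_Ch+hd_C$, $fh=0$, $hg=0$, $hh=0$. A strong homotopy equivalence between $C$ and $D$ is a complex $E$ together with a pair of reductions $C\Leftarrow E\Rightarrow D$. *)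

(* Defs.v *)
From HB Require Import structures.
From mathcomp Require Import all_boot all_order all_algebra.
From mathcomp Require Import finmap.
From mathcomp.multinomials Require Import monalg.

Set Implicit Arguments.
Unset Strict Implicit.
Unset Printing Implicit Defensive.

Import Order.TTheory GRing.Theory Num.Theory.

Local Open Scope ring_scope.

(* The model of computation is an untyped call-by-value lambda calculus with
   pairs and exact rational arithmetic.  A program is a term; closures are
   values, so an algorithm may receive and return algorithms.  Terms use
   de Bruijn indices, and the environment lists the values of the free
   variables.  Evaluation is partial: a term may diverge or get stuck. *)

Inductive arith := OAdd | OSub | OMul | ODiv | OLeq.

Inductive tm :=
| Var of nat
| Lam of tm
| App of tm & tm
| Num of rat
| Op of arith & tm & tm
| Pair of tm & tm
| Fst of tm
| Snd of tm
| IsNum of tm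
| Ifz of tm & tm & tm.

Inductive val :=
| VNum of rat
| VPair of val & val
| VClos of seq val & tm.

Definition arith_sem (o : arith) (a b : rat) : rat :=
  match o with
  | OAdd => a + b
  | OSub => a - b
  | OMul => a * b
  | ODiv => a / b
  | OLeq => (a <= b)%R%:R
  end.

Definition is_num (v : val) : bool := if v is VNum _ then true else false.

Inductive eval : seq val -> tm -> val -> Prop :=
| EVar e k v : onth e k = Some v -> eval e (Var k) v
| ELam e t : eval e (Lam t) (VClos e t)
| EApp e s t e' b u v :
    eval e s (VClos e' b) -> eval e t u -> eval (u :: e') b v ->
    eval e (App s t) v
| ENum e a : eval e (Num a) (VNum a)
| EOp e o s t a b :
    eval e s (VNum a) -> eval e t (VNum b) ->
    eval e (Op o s t) (VNum (arith_sem o a b))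
| EPair e s t u v : eval e s u -> eval e t v -> eval e (Pair s t) (VPair u v)
| EFst e s u v : eval e s (VPair u v) -> eval e (Fst s) u
| ESnd e s u v : eval e s (VPair u v) -> eval e (Snd s) v
| EIsNum e s v : eval e s v -> eval e (IsNum s) (VNum (is_num v)%:R)
| EIfz e c s t a v :
    eval e c (VNum a) -> eval e (if a == 0 then s else t) v ->
    eval e (Ifz c s t) v.

Lemma eval_det e t u v : eval e t u -> eval e t v -> u = v.
Proof.
move=> eu; elim: eu v => {e t u}.
all: intros; match goal with H : eval _ _ _ |- _ => inversion H; subst end.
all: repeat match goal with
  | IH : (forall w, eval ?e ?t w -> _ = w), H : eval ?e ?t _ |- _ =>
    let E := fresh in pose proof (IH _ H) as E; clear H;
    first [injection E; clear E; intros; subst | subst]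
  end.
all: congruence.
Qed.

Definition call (w v u : val) : Prop := eval [:: w; v] (App (Var 0) (Var 1)) u.

Definition vnat (n : nat) : val := VNum n%:R.

Definition vseq (s : seq val) : val := foldr VPair (VNum 0) s.

(* [homog p] is the subspace V^p of V = \bigoplus_(p >= 0) V^p; the last two
   fields say that the sum is all of V and that it is direct. *)
Record grading (V : lmodType rat) := Grading {
  homog : nat -> V -> Prop;
  homog0 : forall p, homog p 0;
  homogD : forall p x y, homog p x -> homog p y -> homog p (x + y);
  homogZ : forall p a x, homog p x -> homog p (a *: x);
  grading_span : forall x, exists (N : nat) (w : nat -> V),
    (forall p, homog p (w p)) /\ x = \sum_(p < N) w p;
  grading_direct : forall (N : nat) (w : nat -> V),
    (forall p, homog p (w p)) -> \sum_(p < N) w p = 0 ->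
    forall p, (p < N)%N -> w p = 0
}.

Record cochain := Cochain {
  cospace :> lmodType rat;
  cograding : grading cospace;
  codiff : {linear cospace -> cospace};
  codiff_deg : forall p x, homog cograding p x -> homog cograding p.+1 (codiff x);
  codiff_sq : forall x, codiff (codiff x) = 0
}.

Definition hom (X : cochain) (p : nat) (x : X) : Prop := homog (cograding X) p x.

Definition cocycle (X : cochain) (p : nat) (x : X) : Prop :=
  hom p x /\ codiff X x = 0.

Definition coboundary (X : cochain) (p : nat) (x : X) : Prop :=
  if p is q.+1 then exists2 y : X, hom q y & x = codiff X y else x = 0.

Definition fin_dim_cohomology (X : cochain) : Prop :=
  forall p, exists (k : nat) (z : 'I_k -> X),
    (forall i, cocycle p (z i)) /\
    forall x : X, cocycle p x ->
      exists c : 'I_k -> rat, coboundary p (x - \sum_i c i *: z i).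

(* Injectivity and surjectivity of the map induced on H^p by a cochain map. *)
Definition cohom_inj (X Y : cochain) (f : X -> Y) (p : nat) : Prop :=
  forall x : X, cocycle p x -> coboundary p (f x) -> coboundary p x.

Definition cohom_surj (X Y : cochain) (f : X -> Y) (p : nat) : Prop :=
  forall y : Y, cocycle p y -> exists2 x : X, cocycle p x & coboundary p (y - f x).

Definition n_quasi_iso (n : nat) (X Y : cochain) (f : X -> Y) : Prop :=
  (forall j, (j <= n)%N -> cohom_inj f j /\ cohom_surj f j) /\ cohom_inj f n.+1.

Record reduction (X Y : cochain) := Reduction {
  red_f : {linear X -> Y};
  red_g : {linear Y -> X};
  red_h : {linear X -> X};
  red_f_deg : forall p x, hom p x -> hom p (red_f x);
  red_g_deg : forall p y, hom p y -> hom p (red_g y);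
  red_h_deg : forall p x, hom p.+1 x -> hom p (red_h x);
  red_h_deg0 : forall x, hom 0 x -> red_h x = 0;
  red_f_d : forall x, red_f (codiff X x) = codiff Y (red_f x);
  red_g_d : forall y, red_g (codiff Y y) = codiff X (red_g y);
  red_fg : forall y, red_f (red_g y) = y;
  red_gf : forall x, x - red_g (red_f x) = codiff X (red_h x) + red_h (codiff X x);
  red_fh : forall x, red_f (red_h x) = 0;
  red_hg : forall y, red_h (red_g y) = 0;
  red_hh : forall x, red_h (red_h x) = 0
}.

Record dga := Dga {
  dga_alg : algType rat;
  dga_grading : grading dga_alg;
  dga_diff : {linear dga_alg -> dga_alg};
  dga_diff_deg : forall p x, homog dga_grading p x ->
    homog dga_grading p.+1 (dga_diff x);
  dga_diff_sq : forall x, dga_diff (dga_diff x) = 0;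
  dga_one_deg : homog dga_grading 0 1;
  dga_mul_deg : forall p q a b, homog dga_grading p a -> homog dga_grading q b ->
    homog dga_grading (p + q) (a * b);
  dga_comm : forall p q a b, homog dga_grading p a -> homog dga_grading q b ->
    a * b = (-1) ^+ (p * q) *: (b * a);
  dga_leibniz : forall p q a b, homog dga_grading p a -> homog dga_grading q b ->
    dga_diff (a * b) = dga_diff a * b + (-1) ^+ p *: (a * dga_diff b)
}.

Definition dga_cochain (A : dga) : cochain :=
  @Cochain (dga_alg A) (dga_grading A) (dga_diff A) (@dga_diff_deg A)
    (@dga_diff_sq A).

Coercion dga_cochain : dga >-> cochain.

(* The first two conditions say that the unit map Q -> H^0(A) is bijective. *)
Definition simply_connected (A : dga) : Prop :=
  [/\ ~ coboundary 0 ((1 : dga_alg A) : A),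
      forall a : A, cocycle 0 a ->
        exists c : rat, coboundary 0 ((a - c *: (1 : dga_alg A)) : A)
    & forall a : A, cocycle 1 a -> coboundary 1 a].

Record dga_mor (A B : dga) := DgaMor {
  dga_fun :> {lrmorphism dga_alg A -> dga_alg B};
  dga_fun_deg : forall p (a : A), hom p a -> hom p (dga_fun a : B);
  dga_fun_d : forall a : A, dga_fun (codiff A a) = codiff B (dga_fun a)
}.

Section Generators.

Context (A : dga) (disp : Order.disp_t) (I : orderType disp).
Implicit Types (deg : I -> nat) (x : I -> dga_alg A).

Definition monomial x (s : seq I) : dga_alg A := \prod_(i <- s) x i.

(* Index sequences of the standard monomials: nondecreasing, and without
   repetition of the generators of odd degree. *)
Definition standard deg (s : seq I) : bool :=
  sorted (fun i j => (i < j)%O || (i == j) && ~~ odd (deg i)) s.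

(* Polynomial expressions in the generators, as lists of pairs of a
   coefficient and a word. *)
Definition poly_eval x (P : seq (rat * seq I)) : dga_alg A :=
  \sum_(m <- P) m.1 *: monomial x m.2.

(* A = Q[even generators] \otimes \Lambda(odd generators): the products of a
   monomial in the even generators and a square-free monomial in the odd ones
   form a basis.  Taking the factors in increasing order of the generators,
   irrespective of parity, only affects the signs of these basis elements. *)
Definition free_on deg x : Prop :=
  [/\ forall i, hom (deg i) (x i : A),
      forall a : dga_alg A, exists P : seq (rat * seq I),
        all (fun m => standard deg m.2) P /\ a = poly_eval x P
    & forall (S : seq (seq I)) (c : seq I -> rat),
        uniq S -> all (standard deg) S ->
        \sum_(s <- S) c s *: monomial x s = 0 -> {in S, forall s, c s = 0}].

End Generators.

(* Elements of A^+ = \bigoplus_(p > 0) A^p. *)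
Definition positive (A : dga) (a : dga_alg A) : Prop :=
  exists s : seq (dga_alg A),
    (forall u, u \in s -> exists p, hom p.+1 (u : A)) /\ a = \sum_(u <- s) u.

(* Elements of A^+ . A^+. *)
Definition decomposable (A : dga) (a : dga_alg A) : Prop :=
  exists s : seq (dga_alg A * dga_alg A),
    (forall u, u \in s -> positive u.1 /\ positive u.2) /\
    a = \sum_(u <- s) u.1 * u.2.

Definition n_minimal (n : nat) (M : dga) : Prop :=
  (exists (disp : Order.disp_t) (I : orderType disp) (deg : I -> nat)
     (x : I -> dga_alg M),
     free_on deg x /\ forall i, (2 <= deg i <= n)%N) /\
  forall a : dga_alg M, positive a -> decomposable (dga_diff M a).

Definition n_minimal_model (n : nat) (M A : dga) (phi : dga_mor M A) : Prop :=
  n_minimal n M /\ n_quasi_iso n (phi : M -> A).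

(* [name p v x]: the value [v] represents the homogeneous element [x] of
   degree [p].  An element may have several names, and neither validity nor
   equality of names is assumed to be decidable. *)
Record naming (X : cochain) := Naming {
  name :> nat -> val -> X -> Prop;
  name_hom : forall p v x, name p v x -> hom p x;
  name_ex : forall p x, hom p x -> exists v, name p v x;
  name_inj : forall p v x y, name p v x -> name p v y -> x = y
}.

(* The program [w] computes the restriction of [F] to X^p -> Y^q; it gets the
   degree [p] along with the name of the argument. *)
Definition computes (X Y : cochain) (NX : naming X) (NY : naming Y)
    (w : val) (p q : nat) (F : X -> Y) : Prop :=
  forall v x, NX p v x ->
    exists2 u, call w (VPair (vnat p) v) u & NY q u (F x).

Record leff_ops (X : cochain) (N : naming X) := LeffOps {
  op_zero : val;
  op_add : val;
  op_scale : val;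
  op_diff : val;
  op_zeroP : forall p, exists2 u, call op_zero (vnat p) u & N p u 0;
  op_addP : forall p v x w y, N p v x -> N p w y ->
    exists2 u, call op_add (VPair (vnat p) (VPair v w)) u & N p u (x + y);
  op_scaleP : forall p a v x, N p v x ->
    exists2 u, call op_scale (VPair (vnat p) (VPair (VNum a) v)) u & N p u (a *: x);
  op_diffP : forall p, computes N N op_diff p p.+1 (codiff X)
}.

Record leff_cochain := LeffCochain {
  lc_cochain :> cochain;
  lc_name : naming lc_cochain;
  lc_ops : leff_ops lc_name
}.

Record leff_dga := LeffDga {
  ld_dga :> dga;
  ld_name : naming ld_dga;
  ld_ops : leff_ops ld_name;
  ld_one : val;
  ld_mul : val;
  ld_oneP : ld_name 0 ld_one (1 : dga_alg ld_dga);
  ld_mulP : forall p q v a w b, ld_name p v a -> ld_name q w b ->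
    exists2 u,
      call ld_mul (VPair (VPair (vnat p) (vnat q)) (VPair v w)) u
      & ld_name (p + q) u ((a : dga_alg ld_dga) * b)
}.

Record leff_reduction (X Y : cochain) (NX : naming X) (NY : naming Y) :=
  LeffReduction {
  lr_red : reduction X Y;
  lr_f : val;
  lr_g : val;
  lr_h : val;
  lr_fP : forall p, computes NX NY lr_f p p (red_f lr_red);
  lr_gP : forall p, computes NY NX lr_g p p (red_g lr_red);
  lr_hP : forall p, computes NX NX lr_h p.+1 p (red_h lr_red)
}.

(* A strong homotopy equivalence X <= E => Y. *)
Record leff_equiv (X Y : cochain) (NX : naming X) (NY : naming Y) := LeffEquiv {
  le_mid : leff_cochain;
  le_left : leff_reduction (lc_name le_mid) NX;
  le_right : leff_reduction (lc_name le_mid) NY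
}.

Definition vrow (n : nat) (c : 'I_n -> rat) : val :=
  vseq [seq VNum (c i) | i <- enum 'I_n].

Definition vmatrix (m n : nat) (D : 'M[int]_(m, n)) : val :=
  vseq [seq vrow (fun j => (D i j)%:~R) | i <- enum 'I_m].

(* C^p = Z^(rank p) with its distinguished basis; the differential sends the
   i-th basis element of C^p to the element of C^(p+1) whose coordinates are
   the i-th row of [ediff p]. *)
Record eff_cochain := EffCochain {
  rank : nat -> nat;
  ediff : forall p, 'M[int]_(rank p, rank p.+1);
  ediff_sq : forall p, ediff p *m ediff p.+1 = 0;
  ec_rank : val;
  ec_diff : val;
  ec_rankP : forall p, call ec_rank (vnat p) (vnat (rank p));
  ec_diffP : forall p, call ec_diff (vnat p) (vmatrix (ediff p))
}.

Section Rationalization.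

Variable C : eff_cochain.

Definition cell : choiceType := {p : nat & 'I_(rank C p)}.

Definition mkcell (p : nat) (i : 'I_(rank C p)) : cell :=
  Tagged (fun p => 'I_(rank C p)) i.

(* The vector space underlying [rationalization] C = C \otimes Q: finite formal combinations of the
   distinguished basis elements. *)
Definition ratspace : lmodType rat := {malg rat[cell]}.

Definition rat_homog (p : nat) (x : ratspace) : Prop :=
  forall k : cell, tag k != p -> x@_k = 0.

Fact rat_homog0 p : rat_homog p 0.
Proof. by move=> k _; rewrite mcoeff0. Qed.

Fact rat_homogD p x y : rat_homog p x -> rat_homog p y -> rat_homog p (x + y).
Proof. by move=> hx hy k kp; rewrite mcoeffD hx // hy // addr0. Qed.

Fact rat_homogZ p a x : rat_homog p x -> rat_homog p (a *: x).
Proof. by move=> hx k kp; rewrite mcoeffZ hx // mulr0. Qed.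

Fact rat_grading_span (x : ratspace) : exists (N : nat) (w : nat -> ratspace),
  (forall p, rat_homog p (w p)) /\ x = \sum_(p < N) w p.
Proof.
exists (\max_(k <- msupp x) (tag k).+1)%N.
exists (fun p => \sum_(k <- msupp x | tag k == p) << x@_k *g k >>); split.
  move=> p k kp; rewrite raddf_sum /= big1 // => l /eqP lp.
  rewrite mcoeffU; case: eqP => // lk.
  by move: kp; rewrite -lk lp eqxx.
rewrite (exchange_big_dep xpredT) //= {1}[x]monalgE.
rewrite big_seq [RHS]big_seq; apply: eq_bigr => k kx.
have kN : (tag k < \max_(l <- msupp x) (tag l).+1)%N.
  by rewrite (big_rem k) //= leq_max leqnn.
rewrite (bigD1 (Ordinal kN)) //= big1 ?addr0 // => i /andP[/eqP ki].
by case/eqP; apply/val_inj; rewrite /= ki.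
Qed.

Fact rat_grading_direct (N : nat) (w : nat -> ratspace) :
  (forall p, rat_homog p (w p)) -> \sum_(p < N) w p = 0 ->
  forall p, (p < N)%N -> w p = 0.
Proof.
move=> hw sw p pN; apply/malgP => k; rewrite mcoeff0.
have [kp|/(hw p)//] := eqVneq (tag k) p.
move: (congr1 (mcoeff k) sw); rewrite mcoeff0 raddf_sum /=.
rewrite (bigD1 (Ordinal pN)) //= big1 ?addr0 // => i ip.
by apply: hw; rewrite kp eq_sym.
Qed.

Definition rat_grading : grading ratspace :=
  Grading rat_homog0 rat_homogD rat_homogZ rat_grading_span rat_grading_direct.

Definition rat_diff_cell (k : cell) : ratspace :=
  \sum_j << (ediff C (tag k) (tagged k) j)%:~R *g mkcell j >>.

Definition rat_diff_fun (x : ratspace) : ratspace :=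
  \sum_(k <- msupp x) x@_k *: rat_diff_cell k.

Lemma rat_diff_funEw (D : {fset cell}) (x : ratspace) : (msupp x `<=` D)%fset ->
  rat_diff_fun x = \sum_(k <- D) x@_k *: rat_diff_cell k.
Proof.
move=> xD; rewrite /rat_diff_fun; apply: big_fset_incl => // k _ kx.
by rewrite mcoeff_outdom // scale0r.
Qed.

Fact rat_diff_is_linear : linear rat_diff_fun.
Proof.
move=> a x y; pose D := (msupp x `|` msupp y `|` msupp (a *: x + y))%fset.
have xD : (msupp x `<=` D)%fset by rewrite /D -fsetUA fsubsetUl.
have yD : (msupp y `<=` D)%fset by rewrite /D fsetUAC fsubsetUr.
have zD : (msupp (a *: x + y) `<=` D)%fset by rewrite /D fsubsetUr.
rewrite (rat_diff_funEw xD) (rat_diff_funEw yD) (rat_diff_funEw zD).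
rewrite scaler_sumr -big_split /=; apply: eq_bigr => k _.
by rewrite mcoeffD mcoeffZ scalerDl scalerA.
Qed.

HB.instance Definition _ :=
  GRing.isLinear.Build rat ratspace ratspace _ rat_diff_fun rat_diff_is_linear.

Definition rat_diff : {linear ratspace -> ratspace} := rat_diff_fun.

Fact rat_diff_U (c : rat) (k : cell) :
  rat_diff << c *g k >> = c *: rat_diff_cell k.
Proof.
by rewrite /= (rat_diff_funEw msuppU_le) big_seq_fset1 mcoeffUU.
Qed.

Fact rat_diff_deg p x : rat_homog p x -> rat_homog p.+1 (rat_diff x).
Proof.
move=> hx k kp; rewrite /rat_diff /= /rat_diff_fun raddf_sum /= big1_seq //.
move=> l /andP[_ lx]; rewrite mcoeffZ.
have [lp|/hx ->] := eqVneq (tag l) p; last by rewrite mul0r.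
rewrite raddf_sum /= big1 ?mulr0 // => j _.
rewrite mcoeffU; case: eqP => // jk.
by move: kp; rewrite -jk /= eqSS (introT eqP lp).
Qed.

Fact rat_diff_sq x : rat_diff (rat_diff x) = 0.
Proof.
have sq0 k : rat_diff (rat_diff_cell k) = 0.
  case: k => p i; rewrite /rat_diff_cell linear_sum.
  transitivity (\sum_l << ((ediff C p *m ediff C p.+1) i l)%:~R *g mkcell l >>
                : ratspace); last first.
    by rewrite ediff_sq big1 // => l _; rewrite mxE raddf0.
  under eq_bigr => j _ do rewrite rat_diff_U /rat_diff_cell scaler_sumr.
  rewrite /= exchange_big; apply: eq_bigr => l _.
  apply/malgP => k; rewrite raddf_sum mcoeffU mxE rmorph_sum -sumrMnl.
  by apply: eq_bigr => j _; rewrite /= mcoeffZ mcoeffU rmorphM /= mulrnAr.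
have -> : rat_diff x = \sum_(k <- msupp x) x@_k *: rat_diff_cell k by [].
by rewrite linear_sum big1 // => k _; rewrite linearZ sq0 /= scaler0.
Qed.

Definition rationalization : cochain :=
  @Cochain ratspace rat_grading rat_diff rat_diff_deg rat_diff_sq.

(* Elements of C^p \otimes Q are represented by their lists of coordinates. *)
Definition rat_name_rel (p : nat) (v : val) (x : rationalization) : Prop :=
  hom p x /\ v = vrow (fun i : 'I_(rank C p) => (x : ratspace)@_(mkcell i)).

Fact rat_name_hom p v x : rat_name_rel p v x -> hom p x.
Proof. by case. Qed.

Fact rat_name_ex p x : hom p x -> exists v, rat_name_rel p v x.
Proof. by move=> hx; eexists; split. Qed.

Fact rat_name_inj p v x y : rat_name_rel p v x -> rat_name_rel p v y -> x = y.
Proof.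
have vseq_inj : injective vseq by elim=> [|a s IH] [|b t] //= [-> /IH ->].
move=> [hx ->] [hy /vseq_inj /eq_in_map exy]; apply/malgP => k.
have [|kp] := eqVneq (tag k) p; last by rewrite (hx k kp) (hy k kp).
case: k => q i /= qp; subst q.
by have [] := exy i (mem_enum _ i).
Qed.

Definition rat_name : naming rationalization :=
  Naming rat_name_hom rat_name_ex rat_name_inj.

End Rationalization.

Definition venc_ops (X : cochain) (N : naming X) (o : leff_ops N) : val :=
  vseq [:: op_zero o; op_add o; op_scale o; op_diff o].

Definition venc_reduction (X Y : cochain) (NX : naming X) (NY : naming Y)
    (r : leff_reduction NX NY) : val :=
  vseq [:: lr_f r; lr_g r; lr_h r].

(* The algorithm only receives the programs, not the structures they compute. *)
Definition venc_input (n : nat) (A : leff_dga) (C : eff_cochain)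
    (E : leff_equiv (ld_name A) (rat_name C)) : val :=
  vseq [:: vnat n;
           vseq [:: venc_ops (ld_ops A); ld_one A; ld_mul A];
           vseq [:: ec_rank C; ec_diff C];
           vseq [:: venc_ops (lc_ops (le_mid E));
                    venc_reduction (le_left E); venc_reduction (le_right E)]].

(* A free DGA on finitely many generators together with a morphism from it to
   another DGA, given by the degrees of the generators, their differentials as
   polynomials in the generators, and names for their images.  As elements of
   a free algebra are represented by polynomials, these data determine its
   operations and the morphism algorithmically. *)
Record presentation := Presentation {
  ngen : nat;
  gdeg : 'I_ngen -> nat;
  gdiff : 'I_ngen -> seq (rat * seq 'I_ngen);
  gimage : 'I_ngen -> val
}.

Definition venc_poly (k : nat) (P : seq (rat * seq 'I_k)) : val :=
  vseq [seq VPair (VNum m.1) (vseq [seq vnat (i : 'I_k) | i <- m.2]) | m <- P].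

Definition venc_presentation (P : presentation) : val :=
  vseq [seq vseq [:: vnat (gdeg i); venc_poly (gdiff i); gimage i]
       | i <- enum 'I_(ngen P)].

Definition presents (P : presentation) (M : dga) (A : leff_dga)
    (phi : dga_mor M A) : Prop :=
  exists x : 'I_(ngen P) -> dga_alg M,
    [/\ free_on (@gdeg P) x,
        forall i, dga_diff M (x i) = poly_eval x (gdiff i)
      & forall i, ld_name A (gdeg i) (gimage i) (phi (x i))].

(* Main.v *)
(** Let [X] be the middle complex of the equivalence, [f1, g1, h1] and
[f2, g2, h2] the reductions of [X] onto [A] and onto [C], with [C] tensored
with the rationals, and put [F = f2 g1 : A -> C], [G = f1 g2 : C -> A] and
[H = f1 h2 g1], so that [1 - G F = d H + H d].  The model is built one degree at
a time.  Given an m-minimal model [phi : M -> A] with generators of degrees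
2, ..., m, consider the cocycles [(z, c)] of the cone of [F phi], that is
[z] in [M^(m+2)] and [c] in [C^(m+1)] with [d z = 0] and [F phi z = d c], modulo
the pairs [(d y, F phi y + d e)].  These are finite-dimensional spaces with
explicit bases (standard words in the generators, and cells), so linear algebra
over the rationals yields a basis of the quotient; we take the harmonic
representatives, those orthogonal to the coboundaries.  For each of them one
adds a generator [x] of degree m+1 with [d x = z] and
[phi x = G c + H phi z].  Since [M^1 = 0], this changes [M] in degree m+1 only
(up to degree m+2), and the result is an (m+1)-minimal model.

The program is analysed by realizability: values are related to the elements that
they name, so no decidability of names is needed. *)

Require Import Defs.
From HB Require Import structures.
From Stdlib Require Import ClassicalEpsilon FunctionalExtensionality.
From mathcomp Require Import all_boot all_order all_algebra.
From mathcomp.multinomials Require Import monalg.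
From mathcomp Require Import ring zify.
Import Defs.

Set Implicit Arguments.
Unset Strict Implicit.
Unset Printing Implicit Defensive.

Import Order.TTheory GRing.Theory Num.Theory.

Local Open Scope ring_scope.

(** * Gradings *)

(** Comparing with [C] rather than [A] makes the problem finite: [A] may be infinite-dimensional and
    its names cannot be compared, whereas elements of [C] have computable coordinates. The price is
    that a cone cocycle gives a primitive [c] of [F phi z] in [C], while the generator needs a
    primitive of [phi z] in [A]. As [d G c = G F phi z = phi z - d H phi z], the term [H phi z] is
    the missing correction. Conversely [F (G c + H phi z)] must agree with [c] up to a coboundary;
    that [F G] is homotopic to the identity does not suffice for this, and the side conditions of
    the reductions provide it. Harmonic representatives avoid computing a quotient: the dot product
    over the rationals is definite, so closedness and orthogonality to the coboundaries form one
    linear system whose kernel is a complement of the coboundaries. That the harmonic classes span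
    gives surjectivity in degree m+1 and injectivity in degree m+2; that they are independent gives
    injectivity in degree m+1. [M] exists only as a mathematical object while the program handles
    words; the two meet in the invariant [model_gens]. *)

Lemma linear_ex (V W : lmodType rat) (f : V -> W) :
  linear f -> exists g : {linear V -> W}, g =1 f.
Proof.
move=> fl.
pose g : {linear V -> W} :=
  HB.pack_for {linear V -> W} f (GRing.isLinear.Build rat V W _ f fl).
by exists g.
Qed.

Section Grading.

Variables (V : lmodType rat) (g : grading V).

Lemma homogN p x : homog g p x -> homog g p (- x).
Proof. by move=> hx; rewrite -scaleN1r; apply: homogZ. Qed.

Lemma homogB p x y : homog g p x -> homog g p y -> homog g p (x - y).
Proof. by move=> hx hy; apply: homogD => //; apply: homogN. Qed.

Lemma homog_sum (I : Type) (r : seq I) (P : pred I) p (F : I -> V) :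
  (forall i, P i -> homog g p (F i)) -> homog g p (\sum_(i <- r | P i) F i).
Proof.
by move=> hF; elim/big_rec: _ => [|i x Pi]; [exact: homog0|apply: homogD; exact: hF].
Qed.

Lemma homog_ind (P : V -> Prop) :
  P 0 -> (forall x y, P x -> P y -> P (x + y)) ->
  (forall p x, homog g p x -> P x) -> forall x, P x.
Proof.
move=> P0 PD Ph x; have [N [w [hw ->]]] := grading_span g x.
by elim/big_rec: _ => // i y _; apply: PD; apply: Ph (hw i).
Qed.

(** Decompositions are only known to exist, so one is chosen for each vector; directness makes the
    rescaled sum independent of the choice, hence linear. Signs yield the parity automorphism,
    indicators the projections. *)
Lemma grading_scale (l : nat -> rat) :
  exists T : {linear V -> V}, forall p x, homog g p x -> T x = l p *: x.
Proof.
have /(_ _)/constructive_indefinite_description-ch := grading_span g.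
pose N x := sval (ch x).
have /(_ _)/constructive_indefinite_description-ch2 x := svalP (ch x).
pose w x := sval (ch2 x).
have wh x p : homog g p (w x p) by have [] := svalP (ch2 x).
have wE x : x = \sum_(p < N x) w x p by have [] := svalP (ch2 x).
pose T x := \sum_(p < N x) l p *: w x p.
(* Padding by zeros brings two decompositions to a common length, where directness can compare
   them. *)
pose tr K (v : nat -> V) p : V := if (p < K)%N then v p else 0.
have trh K v p : (forall p, homog g p (v p)) -> homog g p (tr K v p).
  by move=> hv; rewrite /tr; case: ifP => // _; apply: homog0.
have trE (c : nat -> rat) K L (v : nat -> V) : (K <= L)%N ->
    \sum_(p < K) c p *: v p = \sum_(p < L) c p *: tr K v p.
  move=> KL; rewrite (big_ord_widen _ (fun p => c p *: v p) KL) [RHS](bigID (fun p : 'I_L => p < K)%N) /=.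
  rewrite [X in _ + X]big1 ?addr0; last by move=> i /negPf; rewrite /tr => ->; rewrite scaler0.
  by apply: eq_bigr => i; rewrite /tr => ->.
have trS K L (v : nat -> V) : (K <= L)%N ->
    \sum_(p < K) v p = \sum_(p < L) tr K v p.
  move=> KL; have := trE (fun=> 1) K L v KL.
  by under eq_bigr do rewrite scale1r; under [RHS]eq_bigr do rewrite scale1r.
have uniqT K v x : (forall p, homog g p (v p)) -> x = \sum_(p < K) v p ->
    T x = \sum_(p < K) l p *: v p.
  move=> hv xE; pose L := maxn K (N x).
  have KL : (K <= L)%N by rewrite leq_maxl.
  have NL : (N x <= L)%N by rewrite leq_maxr.
  rewrite /T (trE l _ L) // (trE l K L) //; apply: eq_bigr => p _; congr (_ *: _).
  apply/eqP; rewrite -subr_eq0; apply/eqP.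
  apply: (@grading_direct _ g L (fun p => tr (N x) (w x) p - tr K v p)) => //.
    by move=> q; apply: homogB; apply: trh.
  by rewrite sumrB -(trS _ _ (w x) NL) -(trS _ _ v KL) -wE -xE subrr.
have Tl : linear T.
  move=> a x y; pose L := maxn (N x) (N y).
  have xL : (N x <= L)%N by rewrite leq_maxl.
  have yL : (N y <= L)%N by rewrite leq_maxr.
  rewrite (uniqT L (fun p => a *: tr (N x) (w x) p + tr (N y) (w y) p)).
  - rewrite /T (trE l _ L) // (trE l (N y) L) // scaler_sumr -big_split /=.
    by apply: eq_bigr => p _; rewrite scalerDr !scalerA mulrC.
  - by move=> p; apply: homogD; [apply: homogZ|]; apply: trh.
  - by rewrite big_split /= -scaler_sumr -(trS _ _ (w x)) // -(trS _ _ (w y)) // -!wE.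
have [f fE] := linear_ex Tl; exists f => p x hx; rewrite fE.
have xp : x = \sum_(q < p.+1) (if q == p :> nat then x else 0).
  rewrite (bigD1 ord_max) //= eqxx big1 ?addr0 // => i ip.
  by case: eqP => // ipE; case/eqP: ip; apply: val_inj.
rewrite (uniqT p.+1 (fun q => if q == p then x else 0)) //.
  rewrite (bigD1 ord_max) //= eqxx big1 ?addr0 // => i ip.
  by case: eqP => [ipE|]; rewrite ?scaler0 //; case/eqP: ip; apply: val_inj.
by move=> q; case: eqP => [->//|_]; apply: homog0.
Qed.

Lemma grading_proj p : exists T : {linear V -> V},
  (forall x, homog g p x -> T x = x) /\
  (forall q x, homog g q x -> q != p -> T x = 0).
Proof.
have [T hT] := grading_scale (fun q => (q == p)%:R); exists T; split.
  by move=> x /hT ->; rewrite eqxx scale1r.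
by move=> q x /hT -> /negPf->; rewrite scale0r.
Qed.

End Grading.

Section SpannedGen.
Variables (V : lmodType rat) (H : nat -> V -> Prop).
Hypotheses (H0 : forall p, H p 0) (HD : forall p x y, H p x -> H p y -> H p (x + y)).

(** The spanning clause of [grading] for a family not yet known to be a grading; both extensions
    below check it on generating elements. *)
Definition spannedP (x : V) : Prop := exists (N : nat) (w : nat -> V),
  (forall p, H p (w p)) /\ x = \sum_(p < N) w p.

Lemma spannedP_hom p x : H p x -> spannedP x.
Proof.
move=> hx; exists p.+1, (fun q => if q == p then x else 0); split.
  by move=> q; case: eqP => [->//|_].
rewrite (bigD1 ord_max) //= eqxx big1 ?addr0 // => i ip.
by case: eqP => // ipE; case/eqP: ip; apply: val_inj.
Qed.

Lemma spannedP_add x y : spannedP x -> spannedP y -> spannedP (x + y).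
Proof.
move=> [N [w [hw ->]]] [K [v [hv ->]]]; pose L := maxn N K.
have NL : (N <= L)%N by rewrite leq_maxl.
have KL : (K <= L)%N by rewrite leq_maxr.
exists L; exists (fun p => (if (p < N)%N then w p else 0) + (if (p < K)%N then v p else 0)).
split; first by move=> p; apply: HD; case: ifP.
rewrite big_split /= (big_ord_widen _ w NL) (big_ord_widen _ v KL).
by congr (_ + _); rewrite big_mkcond.
Qed.

End SpannedGen.

(** * Commutative cochain algebras *)

Section DgaTheory.

Variable M : dga.
Local Notation R := (dga_alg M).
Local Notation d := (dga_diff M).
Local Notation homM := (homog (dga_grading M)).
Implicit Types a b c z : R.

Lemma sgn_odd n : (-1) ^+ n = (if odd n then -1 else 1) :> rat.
Proof. by rewrite -signr_odd; case: odd; rewrite ?expr1 ?expr0. Qed.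

(** The sign [(-1) ^+ p] is multiplicative in [p], so it defines an automorphism. With it the
    Leibniz rule holds for all elements, as does commutation past a homogeneous one, so both apply
    to coefficients of polynomials. *)
Lemma dga_sign : exists tau : {lrmorphism R -> R},
  forall p a, homM p a -> tau a = (-1) ^+ p *: a.
Proof.
have [T hT] := grading_scale (dga_grading M) (fun p => (-1) ^+ p).
have T1 : T 1 = 1 by rewrite (hT _ _ (dga_one_deg M)) scale1r.
have TM : {morph T : a b / a * b}.
  move=> a b; elim/(homog_ind (g := dga_grading M)): a => [|a a' ha ha'|p a ha].
  - by rewrite !(mul0r, linear0).
  - by rewrite mulrDl !linearD /= ha ha' mulrDl.
  elim/(homog_ind (g := dga_grading M)): b => [|b b' hb hb'|q b hb].
  - by rewrite !(mulr0, linear0).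
  - by rewrite mulrDr !linearD hb hb' mulrDr.
  rewrite (hT _ _ ha) (hT _ _ hb) (hT _ _ (dga_mul_deg ha hb)).
  by rewrite -scalerAl -scalerAr scalerA exprD.
pose tau : {lrmorphism R -> R} := HB.pack_for {lrmorphism R -> R} (T : R -> R) T
  (GRing.isMonoidMorphism.Build R R T (conj T1 TM)).
by exists tau.
Qed.

Variable tau : {lrmorphism R -> R}.
Hypothesis tauE : forall p a, homM p a -> tau a = (-1) ^+ p *: a.

Lemma tauK a : tau (tau a) = a.
Proof.
elim/(homog_ind (g := dga_grading M)): a => [|a b ha hb|p a ha].
- by rewrite !linear0.
- by rewrite !linearD /= ha hb.
by rewrite !(tauE ha) linearZ /= (tauE ha) scalerA -expr2 sqrr_sign scale1r.
Qed.

Lemma tau_d a : d (tau a) = - tau (d a).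
Proof.
elim/(homog_ind (g := dga_grading M)): a => [|a b ha hb|p a ha].
- by rewrite !linear0 ?oppr0.
- by rewrite !linearD /= ha hb /= -opprD.
rewrite !(tauE ha) linearZ (tauE (dga_diff_deg ha)) /= exprS mulN1r.
by rewrite scaleNr opprK.
Qed.

Lemma leibniz a b : d (a * b) = d a * b + tau a * d b.
Proof.
elim/(homog_ind (g := dga_grading M)): a => [|a a' ha ha'|p a ha].
- by rewrite !(mul0r, linear0) ?addr0.
- by rewrite mulrDl !linearD /= ha ha' /= !mulrDl addrACA.
elim/(homog_ind (g := dga_grading M)): b => [|b b' hb hb'|q b hb].
- by rewrite !(mulr0, linear0) ?addr0.
- by rewrite mulrDr !linearD hb hb' /= !mulrDr addrACA.
by rewrite (dga_leibniz ha hb) (tauE ha) -scalerAl.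
Qed.

Lemma d_one : d 1 = 0.
Proof.
have := leibniz 1 1; rewrite mulr1 rmorph1 mul1r mulr1 => /eqP.
by rewrite -subr_eq subrr eq_sym => /eqP.
Qed.

Lemma tau_hom p a : homM p a -> homM p (tau a).
Proof. by move=> ha; rewrite (tauE ha); apply: homogZ. Qed.

Lemma comm_even p z : homM p z -> ~~ odd p -> forall c, z * c = c * z.
Proof.
move=> hz ep c; elim/(homog_ind (g := dga_grading M)): c => [|c c' ha hb|q c hc].
- by rewrite mulr0 mul0r.
- by rewrite mulrDr mulrDl ha hb.
by rewrite (dga_comm hz hc) -signr_odd oddM (negPf ep) scale1r.
Qed.

Lemma comm_odd p z : homM p z -> odd p -> forall c, z * c = tau c * z.
Proof.
move=> hz ep c; elim/(homog_ind (g := dga_grading M)): c => [|c c' ha hb|q c hc].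
- by rewrite linear0 mulr0 mul0r.
- by rewrite linearD /= mulrDr mulrDl ha hb.
by rewrite (dga_comm hz hc) (tauE hc) -scalerAl -signr_odd oddM ep signr_odd.
Qed.

(** Commuting [z] past itself changes the sign, and 2 is invertible. *)
Lemma sq_odd p z : homM p z -> odd p -> z * z = 0.
Proof.
move=> hz ep; have := comm_odd hz ep z.
rewrite (tauE hz) -signr_odd ep expr1 scaleN1r mulNr => /eqP.
rewrite -addr_eq0 -mulr2n -scaler_nat scaler_eq0 => /orP[//|/eqP//].
Qed.

End DgaTheory.

Section Shift.
Variables (V : lmodType rat) (g : grading V).

(** Degree [n] in the copy of [V] raised by [s] degrees. Truncated subtraction would send every [n]
    below [s] to degree 0, hence the separate case. *)
Definition hshift s n (v : V) : Prop := if (s <= n)%N then homog g (n - s) v else v = 0.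

Lemma hshift0 s n : hshift s n 0.
Proof. by rewrite /hshift; case: ifP => // _; apply: homog0. Qed.

Lemma hshiftD s n v w : hshift s n v -> hshift s n w -> hshift s n (v + w).
Proof.
rewrite /hshift; case: ifP => _; first exact: homogD.
by move=> -> ->; rewrite addr0.
Qed.

Lemma hshiftZ s n a v : hshift s n v -> hshift s n (a *: v).
Proof.
rewrite /hshift; case: ifP => _; first exact: homogZ.
by move=> ->; rewrite scaler0.
Qed.

Lemma hshift_direct s N (w : nat -> V) : (forall n, hshift s n (w n)) ->
  \sum_(n < N) w n = 0 -> forall n, (n < N)%N -> w n = 0.
Proof.
move=> hw sw n nN; have := hw n; rewrite /hshift; case: leqP => // sn hn.
have [T [T1 T2]] := grading_proj g (n - s).
have := congr1 T sw; rewrite linear0 linear_sum (bigD1 (Ordinal nN)) //= T1 //.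
rewrite big1 ?addr0 // => i ni; have := hw i; rewrite /hshift; case: leqP => si hi.
  apply: T2 hi _; apply: contra ni => /eqP ni; apply/eqP/val_inj => /=.
  by rewrite -(subnK sn) -(subnK si) ni.
by rewrite hi linear0.
Qed.

Lemma hshift_homog s n v : homog g n v -> hshift s (n + s) v.
Proof. by rewrite /hshift leq_addl addnK. Qed.

End Shift.

(** * Hirsch extensions *)

Definition even_ext (R : algType rat) : Type := {poly R}.

Section EvenExt.
Variable R : algType rat.

HB.instance Definition _ := GRing.NzRing.copy (even_ext R) {poly R}.

Definition even_scale (k : rat) (p : even_ext R) : even_ext R := k%:A%:P * p.

Fact even_scaleA a b v : even_scale a (even_scale b v) = even_scale (a * b) v.
Proof. by rewrite /even_scale mulrA -polyCM -scalerAl mul1r scalerA. Qed.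

Fact even_scale1 : left_id 1 even_scale.
Proof. by move=> v; rewrite /even_scale scale1r mul1r. Qed.

Fact even_scaleDr : right_distributive even_scale +%R.
Proof. by move=> a u v; rewrite /even_scale mulrDr. Qed.

Fact even_scaleDl v : {morph even_scale^~ v : a b / a + b}.
Proof. by move=> a b; rewrite /even_scale scalerDl polyCD mulrDl. Qed.

HB.instance Definition _ := GRing.Zmodule_isLmodule.Build rat (even_ext R)
  even_scaleA even_scale1 even_scaleDr even_scaleDl.

Fact even_scaleAl (a : rat) (u v : even_ext R) : a *: (u * v) = a *: u * v.
Proof. exact: mulrA. Qed.

HB.instance Definition _ :=
  GRing.Lmodule_isLalgebra.Build rat (even_ext R) even_scaleAl.

Fact even_coefZ (a : rat) (u : even_ext R) i : (a *: u : {poly R})`_i = a *: u`_i.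
Proof. by rewrite coefCM -scalerAl mul1r. Qed.

Fact even_scaleAr (a : rat) (u v : even_ext R) : a *: (u * v) = u * (a *: v).
Proof.
apply/polyP => i; rewrite even_coefZ !coefM scaler_sumr; apply: eq_bigr => j _.
by rewrite even_coefZ scalerAr.
Qed.

HB.instance Definition _ :=
  GRing.Lalgebra_isAlgebra.Build rat (even_ext R) even_scaleAr.

End EvenExt.

(** The carrier does not mention [tau]; the parameter selects the twisted product. *)
Definition odd_ext (R : algType rat) (tau : {lrmorphism R -> R}) : Type := (R * R)%type.

Section OddExt.
Variables (R : algType rat) (tau : {lrmorphism R -> R}).
Local Notation E := (odd_ext tau).

HB.instance Definition _ := GRing.Lmodule.copy E (R * R)%type.

(* [(a, b)] stands for [a + b x], where [x c = tau c x] and [x x = 0]. *)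
Definition odd_one : E := (1, 0).
Definition odd_mul (u v : E) : E := (u.1 * v.1, u.1 * v.2 + u.2 * tau v.1).

Fact odd_mulA : associative odd_mul.
Proof.
move=> [a b] [c e] [f g]; rewrite /odd_mul /=; congr pair; first by rewrite mulrA.
by rewrite mulrDr mulrDl rmorphM !mulrA addrA.
Qed.

Fact odd_mul1l : left_id odd_one odd_mul.
Proof. by move=> [a b]; rewrite /odd_mul /= !mul1r mul0r addr0. Qed.

Fact odd_mul1r : right_id odd_one odd_mul.
Proof. by move=> [a b]; rewrite /odd_mul /= rmorph1 !mulr1 mulr0 add0r. Qed.

Fact odd_mulDl : left_distributive odd_mul +%R.
Proof.
move=> [a b] [c e] [f g]; rewrite /odd_mul /=; congr pair; first by rewrite mulrDl.
by rewrite !mulrDl addrACA.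
Qed.

Fact odd_mulDr : right_distributive odd_mul +%R.
Proof.
move=> [a b] [c e] [f g]; rewrite /odd_mul /=; congr pair; first by rewrite mulrDr.
by rewrite /= rmorphD !mulrDr addrACA.
Qed.

Fact odd_one_neq0 : odd_one != 0.
Proof. by apply/eqP => -[] /eqP; rewrite oner_eq0. Qed.

HB.instance Definition _ := GRing.Zmodule_isNzRing.Build E
  odd_mulA odd_mul1l odd_mul1r odd_mulDl odd_mulDr odd_one_neq0.

Fact odd_scaleAl (a : rat) (u v : E) : a *: (u * v) = (a *: u : E) * v.
Proof.
case: u v => [x y] [z t]; congr pair; first exact: scalerAl.
change (a *: (x * t + y * tau z) = a *: x * t + a *: y * tau z).
by rewrite scalerDr !scalerAl.
Qed.

HB.instance Definition _ := GRing.Lmodule_isLalgebra.Build rat E odd_scaleAl.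

Fact odd_scaleAr (a : rat) (u v : E) : a *: (u * v) = u * (a *: v : E).
Proof.
case: u v => [x y] [z t]; congr pair; first exact: scalerAr.
change (a *: (x * t + y * tau z) = x * (a *: t) + y * tau (a *: z)).
by rewrite scalerDr linearZ /= !scalerAr.
Qed.

HB.instance Definition _ := GRing.Lalgebra_isAlgebra.Build rat E odd_scaleAr.

End OddExt.

(** The interface common to both parities, after which the two constructions are forgotten. Elements
    have unique normal forms with old coefficients on the left; the bound 2 for odd [p] encodes that
    [x] squares to zero. The last clause is the universal property, by which a morphism extends as
    soon as a primitive of the image of [z] is chosen. *)
Definition hirsch_ext (M : dga) (p : nat) (z : dga_alg M) (M' : dga)
    (iota : dga_mor M M') (x : dga_alg M') : Prop :=
  [/\ homog (dga_grading M') p x,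
      dga_diff M' x = iota z,
      forall a, exists N (b : nat -> dga_alg M),
        (odd p -> (N <= 2)%N) /\ a = \sum_(i < N) iota (b i) * x ^+ i,
      forall N (b : nat -> dga_alg M), (odd p -> (N <= 2)%N) ->
        \sum_(i < N) iota (b i) * x ^+ i = 0 -> forall i, (i < N)%N -> b i = 0
    & forall (A : dga) (phi : dga_mor M A) (a : dga_alg A),
        homog (dga_grading A) p a -> dga_diff A a = phi z ->
        exists psi : dga_mor M' A, (forall b, psi (iota b) = phi b) /\ psi x = a].

(** * Adjoining a generator of even degree: polynomials *)

Section Even.

Variables (M : dga) (p : nat) (z : dga_alg M).
Local Notation R := (dga_alg M).
Local Notation d := (dga_diff M).
Local Notation homM := (homog (dga_grading M)).
Hypotheses (p_even : ~~ odd p) (hz : homM p.+1 z) (dz : d z = 0).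
Variable tau : {lrmorphism R -> R}.
Hypothesis tauE : forall p a, homM p a -> tau a = (-1) ^+ p *: a.
Local Notation E := (even_ext R).
Local Notation tauP := (map_poly tau).

Definition even_homog n (P : E) := forall i, hshift (dga_grading M) (i * p) n (P : {poly R})`_i.

Fact even_homog0 n : even_homog n 0.
Proof. by move=> i; rewrite coef0; apply: hshift0. Qed.

Fact even_homogD n (P Q : E) : even_homog n P -> even_homog n Q -> even_homog n (P + Q).
Proof. by move=> hP hQ i; rewrite coefD; apply: hshiftD. Qed.

Fact even_homogZ n a (P : E) : even_homog n P -> even_homog n (a *: P).
Proof. by move=> hP i; rewrite even_coefZ; apply: hshiftZ. Qed.

Lemma even_homog_mono n i a : homM n a -> even_homog (n + i * p) (a%:P * 'X^i : {poly R}).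
Proof.
move=> ha j; rewrite coefCM coefXn; case: eqP => [->|_]; last by rewrite mulr0; apply: hshift0.
by rewrite mulr1; apply: hshift_homog.
Qed.

Lemma even_ind (T : {poly R} -> Prop) :
  T 0 -> (forall P Q, T P -> T Q -> T (P + Q)) ->
  (forall n i a, homM n a -> T (a%:P * 'X^i)) -> forall P, T P.
Proof.
move=> T0 TD Tm P; rewrite -[P]coefK poly_def.
elim/big_rec: _ => // i Q _ TQ; apply: (TD) => //; rewrite -mul_polyC.
move: (P`_i : R) => c.
apply: (homog_ind (g := dga_grading M) (P := fun c => T (c%:P * 'X^i))) => [|a b ha hb|n a ha].
- by rewrite mul0r.
- by rewrite polyCD mulrDl; apply: TD.
exact: Tm ha.
Qed.

Fact even_span (P : E) : exists (N : nat) (w : nat -> E),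
  (forall n, even_homog n (w n)) /\ P = \sum_(n < N) w n.
Proof.
apply: (even_ind (T := spannedP even_homog)) => [|P1 P2|n i a ha].
- exact: spannedP_hom even_homog0 0 _ (even_homog0 0).
- exact: spannedP_add even_homog0 even_homogD _ _.
- exact: spannedP_hom even_homog0 _ _ (even_homog_mono i ha).
Qed.

Fact even_direct (N : nat) (w : nat -> E) :
  (forall n, even_homog n (w n)) -> \sum_(n < N) w n = 0 ->
  forall n, (n < N)%N -> w n = 0.
Proof.
move=> hw sw n nN; apply/polyP => i; rewrite coef0.
apply: (hshift_direct (w := fun n => (w n : {poly R})`_i) (fun n => hw n i) _ nN).
by have := congr1 (fun P : {poly R} => P`_i) sw; rewrite coef_sum coef0.
Qed.

Definition even_grading : grading E :=
  Grading even_homog0 even_homogD even_homogZ even_span even_direct.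

(* The variable has differential [z], and signs come from moving [z] to the right. *)
Definition even_d (P : E) : E := map_poly d P + tauP (P : {poly R})^`() * z%:P.


Lemma even_d_coef (P : E) i :
  (even_d P : {poly R})`_i = d (P : {poly R})`_i + i.+1%:R *: (tau (P : {poly R})`_i.+1 * z).
Proof.
by rewrite scaler_nat /even_d coefD coefMC !coef_map /= coef_deriv raddfMn /= mulrnAl.
Qed.

Fact even_d_linear : linear even_d.
Proof.
move=> k P Q; apply/polyP => i; rewrite [RHS]coefD even_coefZ !even_d_coef.
rewrite !coefD !even_coefZ !linearD /= !linearZ /= mulrDl scalerDr -scalerAl.
by rewrite [_ *: (k *: _)]scalerA mulrC -scalerA addrACA.
Qed.

Lemma map_d_leib (P Q : {poly R}) :
  map_poly d (P * Q) = map_poly d P * Q + tauP P * map_poly d Q.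
Proof.
apply/polyP => i; rewrite coefD !coefM coef_map /= coefM linear_sum -big_split /=.
by apply: eq_bigr => j _; rewrite (leibniz tauE) !coef_map.
Qed.

Lemma z_polyC (Q : {poly R}) : z%:P * Q = tauP Q * z%:P.
Proof.
apply/polyP => i; rewrite coefCM coefMC coef_map.
exact: comm_odd tauE _ _ hz p_even _.
Qed.

(** The variable has even degree, so the parity of a polynomial is that of its coefficients. *)
Lemma tauP_homog n (P : E) : even_homog n P -> tauP P = (-1) ^+ n *: P.
Proof.
move=> hP; apply/polyP => i; rewrite coef_map even_coefZ /=.
have := hP i; rewrite /hshift; case: leqP => ip hi; last by rewrite hi linear0 scaler0.
rewrite (tauE hi); congr (_ *: _).
by rewrite -signr_odd oddB // oddM (negPf p_even) andbF addbF signr_odd.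
Qed.

Lemma even_d_leib (P Q : {poly R}) :
  even_d (P * Q) = even_d P * Q + tauP P * even_d Q.
Proof.
rewrite /even_d map_d_leib derivM rmorphD !rmorphM /= !(mulrDl, mulrDr).
rewrite -!addrA; congr (_ + _); rewrite -[RHS]addrCA; congr (_ + _).
by rewrite -!mulrA z_polyC.
Qed.

(** The two mixed terms cancel because [tau] anticommutes with [d], and the second derivative comes
    with [z * z], which is zero since [z] has odd degree. *)
Fact even_d_sq P : even_d (even_d P) = 0.
Proof.
apply/polyP => i; rewrite coef0 !even_d_coef.
rewrite !linearD /= !linearZ /= dga_diff_sq add0r (leibniz tauE) dz mulr0 addr0.
rewrite rmorphM /= (tauE hz) mulrDl -!scalerAl -!scalerAr -scalerAl -mulrA (sq_odd tauE hz p_even).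
rewrite !(mulr0, scaler0) addr0 (tau_d tauE) mulNr scalerN.
by rewrite addNr.
Qed.

Fact even_d_deg n P : even_homog n P -> even_homog n.+1 (even_d P).
Proof.
move=> hP i; rewrite even_d_coef; apply: hshiftD.
  have := hP i; rewrite /hshift; case: leqP => ip hi.
    by rewrite (leq_trans ip) ?subSn //; apply: dga_diff_deg.
  rewrite hi linear0; case: ifP => _ //; exact: homog0.
apply: hshiftZ.
have := hP i.+1; rewrite /hshift mulSn; case: leqP => ip hi; last first.
  by rewrite hi linear0 mul0r; case: ifP => // _; apply: homog0.
rewrite ifT; last by lia.
have -> : (n.+1 - i * p = n - (p + i * p) + p.+1)%N by lia.
by apply: dga_mul_deg => //; apply: (tau_hom tauE).
Qed.

Fact even_one_deg : even_homog 0 1.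
Proof.
by have := even_homog_mono 0 (dga_one_deg M); rewrite mul0n expr0 mulr1.
Qed.

Fact even_mul_deg n m (P Q : E) : even_homog n P -> even_homog m Q ->
  even_homog (n + m) (P * Q).
Proof.
move=> hP hQ i; rewrite /hshift coefM.
have [ip|ip] := leqP.
  apply: homog_sum => j _; have jp : (j <= i)%N by rewrite -ltnS.
  have := hP j; have := hQ (i - j)%N; rewrite /hshift.
  case: leqP => h1; last by move=> -> _; rewrite mulr0; apply: homog0.
  case: leqP => h2; last by move=> _ ->; rewrite mul0r; apply: homog0.
  move=> h3 h4; have := dga_mul_deg h4 h3.
  suff -> : (n + m - i * p = n - j * p + (m - (i - j) * p))%N by [].
  move: h1; rewrite mulnBl.
  by have : (j * p <= i * p)%N; [rewrite leq_mul2r jp orbT|lia].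
apply: big1 => j _; have jp : (j <= i)%N by rewrite -ltnS.
have := hP j; have := hQ (i - j)%N; rewrite /hshift.
case: leqP => h1; last by move=> -> _; rewrite mulr0.
case: leqP => h2; last by move=> _ ->; rewrite mul0r.
move: h1 ip; rewrite mulnBl => h1 ip _ _.
by have : (j * p <= i * p)%N; [rewrite leq_mul2r jp orbT|lia].
Qed.

Lemma even_comm n m (P Q : E) : even_homog n P -> even_homog m Q ->
  P * Q = (-1) ^+ (n * m) *: (Q * P).
Proof.
move=> hP hQ; apply/polyP => i; rewrite even_coefZ coefM coefMr scaler_sumr.
apply: eq_bigr => j _.
have := hP j; have := hQ (i - j)%N; rewrite /hshift.
case: leqP => h1; last by move=> ->; rewrite mulr0 mul0r scaler0.
case: leqP => h2; last by move=> _ ->; rewrite mulr0 mul0r scaler0.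
move=> h3 h4; rewrite (dga_comm h4 h3); congr (_ *: _).
rewrite -signr_odd -[RHS]signr_odd !oddM !oddB // !oddM (negPf p_even).
by rewrite !andbF !addbF.
Qed.

Lemma even_leibniz n m (P Q : E) : even_homog n P -> even_homog m Q ->
  even_d (P * Q) = even_d P * Q + (-1) ^+ n *: (P * even_d Q).
Proof. by move=> hP hQ; rewrite even_d_leib (tauP_homog hP) even_scaleAl. Qed.

Lemma hirsch_even : exists (M' : dga) (iota : dga_mor M M') x, hirsch_ext p z iota x.
Proof.
have [D DE] := linear_ex even_d_linear.
have Ddeg n P : even_homog n P -> even_homog n.+1 (D P).
  by rewrite DE; apply: even_d_deg.
have Dsq P : D (D P) = 0 by rewrite !DE even_d_sq.
have Dleib n m (P Q : E) : even_homog n P -> even_homog m Q ->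
    D (P * Q) = D P * Q + (-1) ^+ n *: (P * D Q).
  by rewrite !DE; apply: even_leibniz.
pose M' := @Dga E even_grading D Ddeg Dsq even_one_deg even_mul_deg even_comm Dleib.
have [i0 i0E] : exists i0 : {lrmorphism R -> E}, forall a, i0 a = a%:P.
  have il : linear (polyC : R -> E).
    move=> k a b; apply/polyP => i; rewrite [RHS]coefD even_coefZ !coefC.
    by case: eqP; rewrite ?scaler0 ?addr0.
  have im : monoid_morphism (polyC : R -> E) by split => // a b; apply: polyCM.
  pose i0 : {lrmorphism R -> E} := HB.pack_for {lrmorphism R -> E}
    (polyC : R -> E) (GRing.isLinear.Build rat R E _ (polyC : R -> E) il)
    (GRing.isMonoidMorphism.Build R E (polyC : R -> E) im).
  by exists i0.
have i0_deg n (a : M) : hom n a -> hom n (i0 a : M').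
  move=> ha; have := even_homog_mono 0 ha.
  by rewrite mul0n addn0 expr0 mulr1 i0E.
have i0_d (a : M) : i0 (codiff M a) = codiff M' (i0 a).
  rewrite /= !i0E DE; apply/polyP => i; rewrite even_d_coef !coefC /=.
  by rewrite linear0 mul0r scaler0 addr0; case: eqP => // _; rewrite linear0.
exists M', (@DgaMor M M' i0 i0_deg i0_d), ('X : {poly R}).
have sumE N (b : nat -> R) :
    \sum_(i < N) i0 (b i) * ('X : E) ^+ i = \poly_(i < N) b i :> E.
  rewrite poly_def; apply: eq_bigr => i _; rewrite i0E; exact: mul_polyC.
have hX : even_homog p ('X : {poly R}).
  by have := even_homog_mono 1 (dga_one_deg M); rewrite mul1n add0n mul1r.
have DX : D ('X : {poly R}) = z%:P.
  rewrite DE; apply/polyP => i; rewrite even_d_coef coefC !coefX.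
  case: i => [|i] /=; last by rewrite linear0 mul0r scaler0 addr0; case: i => [|i] /=; rewrite ?(d_one tauE) ?linear0.
  by rewrite linear0 add0r (rmorph1 tau) mul1r scale1r.
split=> /=.
- exact: hX.
- by rewrite DX i0E.
- move=> a; exists (size (a : {poly R})), (fun i => (a : {poly R})`_i).
  by split; [rewrite (negPf p_even)|rewrite sumE coefK].
- move=> N b _; rewrite sumE => bE i iN.
  by have := congr1 (fun P : {poly R} => P`_i) bE; rewrite coef_poly iN coef0.
- move=> A phi a ha da.
  (* Over a noncommutative ring, evaluation at [a] is multiplicative only if [a] commutes with the
     image of the coefficients; evenness of its degree ensures this. *)
  have cfu : commr_rmorph phi a.
    move=> b; rewrite /GRing.comm.
    have [tA tAE] := dga_sign A.
    by rewrite (comm_even ha).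
  have psi1 b : horner_morph cfu b%:P = phi b by rewrite horner_morphC.
  have psil : linear (horner_morph cfu : E -> dga_alg A).
    move=> k P Q; rewrite [LHS]rmorphD; congr (_ + _).
    rewrite [LHS]rmorphM /= psi1 linearZ /= rmorph1.
    by rewrite -scalerAl mul1r.
  have psim : monoid_morphism (horner_morph cfu : E -> dga_alg A).
    by split; [apply: rmorph1|apply: rmorphM].
  pose psi : {lrmorphism E -> dga_alg A} := HB.pack_for {lrmorphism E -> dga_alg A}
    (horner_morph cfu : E -> dga_alg A)
    (GRing.isLinear.Build rat E (dga_alg A) _ (horner_morph cfu : E -> dga_alg A) psil)
    (GRing.isMonoidMorphism.Build E (dga_alg A) (horner_morph cfu : E -> dga_alg A) psim).
  have psiXn b i : psi (b%:P * 'X^i : {poly R}) = phi b * a ^+ i.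
    by rewrite [LHS]rmorphM /= [X in X * _]psi1 [X in _ * X]rmorphXn /= horner_morphX.
  have psiE (P : E) : psi P = \sum_(i < size (P : {poly R})) phi (P : {poly R})`_i * a ^+ i.
    rewrite -{1}[P]coefK poly_def (raddf_sum psi); apply: eq_bigr => i _.
    by rewrite -mul_polyC; apply: psiXn.
  have psi_deg n (P : M') : hom n P -> hom n (psi P : A).
    move=> hP; rewrite psiE; apply: homog_sum => i _.
    have := hP i; rewrite /hshift; case: leqP => ip; last first.
      by move->; rewrite linear0 mul0r; apply: homog0.
    move=> hi; have ai : homog (dga_grading A) (i * p) (a ^+ i).
      elim: (i : nat) => [|j IH]; first by rewrite expr0; apply: dga_one_deg.
      by rewrite exprS mulSn; apply: dga_mul_deg.
    by rewrite -(subnK ip); apply: dga_mul_deg => //; apply: dga_fun_deg.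
  have psiX : psi ('X : {poly R}) = a by apply: horner_morphX.
  have psi_d (P : M') : psi (codiff M' P) = codiff A (psi P).
    (* It suffices to treat [b X^i]; peeling off one factor [X] at a time leaves [phi] commuting
       with [d] and the hypothesis on [a]. *)
    rewrite /=; apply: (even_ind (T := fun P => psi (D P) = dga_diff A (psi P))) P => [|P Q|n i b hb].
    - by rewrite !linear0.
    - by rewrite !linearD /= => -> ->.
    elim: i => [|i IH].
      rewrite expr0 mulr1 -i0E; have /= <- := i0_d b; rewrite !i0E.
      by rewrite [LHS]psi1 [psi _]psi1; apply: (dga_fun_d phi).
    rewrite exprSr mulrA.
    have hP := even_homog_mono i hb.
    have psiD (u v : E) : psi (u + v) = psi u + psi v by apply: raddfD.
    have psiM (u v : E) : psi (u * v) = psi u * psi v by apply: rmorphM.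
    have psiZ (k : rat) (u : E) : psi (k *: u) = k *: psi u by apply: linearZ.
    rewrite (Dleib _ _ _ _ hP hX) psiD psiZ !psiM IH.
    have psiC (c : R) : psi c%:P = phi c by apply: psi1.
    have psiM2 := esym (psiM b%:P (('X^i) : {poly R})).
    by rewrite DX psiX psiC !psiM2 (dga_leibniz (psi_deg _ _ hP) ha) da.
  by exists (@DgaMor M' A psi psi_deg psi_d); split => [b|]; rewrite /= ?i0E ?psi1 ?horner_morphX.
Qed.

End Even.

(** * Adjoining a generator of odd degree: pairs of coefficients *)

Section Odd.

Variables (M : dga) (p : nat) (z : dga_alg M).
Local Notation R := (dga_alg M).
Local Notation d := (dga_diff M).
Local Notation homM := (homog (dga_grading M)).
Hypotheses (p_odd : odd p) (hz : homM p.+1 z) (dz : d z = 0).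
Variable tau : {lrmorphism R -> R}.
Hypothesis tauE : forall p a, homM p a -> tau a = (-1) ^+ p *: a.
Local Notation E := (odd_ext tau).

Definition odd_homog n (u : E) := homM n u.1 /\ hshift (dga_grading M) p n u.2.

Fact odd_homog0 n : odd_homog n 0.
Proof. by split; [apply: homog0|apply: hshift0]. Qed.

Fact odd_homogD n (u v : E) : odd_homog n u -> odd_homog n v -> odd_homog n (u + v).
Proof. by move=> [h1 h2] [h3 h4]; split; [apply: homogD|apply: hshiftD]. Qed.

Fact odd_homogZ n a (u : E) : odd_homog n u -> odd_homog n (a *: u).
Proof. by move=> [h1 h2]; split; [apply: homogZ|apply: hshiftZ]. Qed.

Lemma odd_homog_l n a : homM n a -> odd_homog n ((a, 0) : E).
Proof. by move=> ha; split => //=; apply: hshift0. Qed.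

Lemma odd_homog_r n a : homM n a -> odd_homog (n + p) ((0, a) : E).
Proof. by move=> ha; split => /=; [apply: homog0|apply: hshift_homog]. Qed.

Lemma odd_ind (T : E -> Prop) :
  T 0 -> (forall u v, T u -> T v -> T (u + v)) ->
  (forall n a, homM n a -> T (a, 0)) -> (forall n a, homM n a -> T (0, a)) ->
  forall u, T u.
Proof.
move=> T0 TD Tl Tr [a b].
have -> : (a, b) = (a, 0) + (0, b) :> E by congr pair; rewrite /= ?addr0 ?add0r.
apply: (TD).
  apply: (homog_ind (g := dga_grading M) (P := fun c => T (c, 0))) => // x y hx hy.
  have -> : (x + y, 0) = (x, 0) + (y, 0) :> E by congr pair; rewrite /= ?addr0.
  exact: TD.
apply: (homog_ind (g := dga_grading M) (P := fun c => T (0, c))) => // x y hx hy.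
have -> : (0, x + y) = (0, x) + (0, y) :> E by congr pair; rewrite /= ?addr0.
exact: TD.
Qed.

Fact odd_span (u : E) : exists (N : nat) (w : nat -> E),
  (forall n, odd_homog n (w n)) /\ u = \sum_(n < N) w n.
Proof.
apply: (odd_ind (T := spannedP odd_homog)) => [|u1 u2|n a ha|n a ha].
- exact: spannedP_hom odd_homog0 0 _ (odd_homog0 0).
- exact: spannedP_add odd_homog0 odd_homogD _ _.
- exact: spannedP_hom odd_homog0 _ _ (odd_homog_l ha).
- exact: spannedP_hom odd_homog0 _ _ (odd_homog_r ha).
Qed.

Fact odd_fst_sum N (w : nat -> E) : (\sum_(n < N) w n).1 = \sum_(n < N) (w n).1.
Proof. by elim/big_rec2: _ => // i x y _ <-. Qed.

Fact odd_snd_sum N (w : nat -> E) : (\sum_(n < N) w n).2 = \sum_(n < N) (w n).2.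
Proof. by elim/big_rec2: _ => // i x y _ <-. Qed.

Fact odd_direct (N : nat) (w : nat -> E) :
  (forall n, odd_homog n (w n)) -> \sum_(n < N) w n = 0 ->
  forall n, (n < N)%N -> w n = 0.
Proof.
move=> hw sw n nN; rewrite [w n]surjective_pairing; congr pair.
  apply: (grading_direct (g := dga_grading M) (w := fun n => (w n).1) (fun n => (hw n).1) _ nN).
  by rewrite -odd_fst_sum sw.
apply: (hshift_direct (w := fun n => (w n).2) (fun n => (hw n).2) _ nN).
by rewrite -odd_snd_sum sw.
Qed.

Definition odd_grading : grading E :=
  Grading odd_homog0 odd_homogD odd_homogZ odd_span odd_direct.

(** Forced by the Leibniz rule: [d (b x) = (d b) x + tau b * d x] with [d x = z]. *)
Definition odd_d (u : E) : E := (d u.1 + tau u.2 * z, d u.2).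

Fact odd_d_linear : linear odd_d.
Proof.
move=> k [a b] [c e]; congr pair.
  change (d (k *: a + c) + tau (k *: b + e) * z =
    k *: (d a + tau b * z) + (d c + tau e * z)).
  by rewrite !linearP /= mulrDl scalerDr scalerAl addrACA.
by change (d (k *: b + e) = k *: d b + d e); rewrite linearP.
Qed.

Fact odd_d_sq u : odd_d (odd_d u) = 0.
Proof.
case: u => [a b]; congr pair.
  change (d (d a + tau b * z) + tau (d b) * z = 0).
  rewrite linearD /= dga_diff_sq add0r (leibniz tauE) dz mulr0 addr0.
  by rewrite (tau_d tauE) mulNr addNr.
exact: dga_diff_sq.
Qed.

Fact odd_d_deg n u : odd_homog n u -> odd_homog n.+1 (odd_d u).
Proof.
case: u => [a b] [/= ha hb]; split => /=; last first.
  move: hb; rewrite /hshift; case: leqP => pn; last first.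
    by move->; rewrite linear0; case: ifP => // _; apply: homog0.
  by move=> hb; rewrite (leq_trans pn) // subSn //; apply: dga_diff_deg.
apply: homogD; first exact: dga_diff_deg.
move: hb; rewrite /hshift; case: leqP => pn; last first.
  by move->; rewrite linear0 mul0r; apply: homog0.
move=> hb; have -> : (n.+1 = (n - p) + p.+1)%N by lia.
by apply: dga_mul_deg => //; apply: tau_hom.
Qed.

Fact odd_one_deg : odd_homog 0 1.
Proof. exact: odd_homog_l (dga_one_deg M). Qed.

Fact odd_mul_deg n m (u v : E) : odd_homog n u -> odd_homog m v ->
  odd_homog (n + m) (u * v).
Proof.
case: u v => [a b] [c e] [/= ha hb] [/= hc he]; split; first exact: dga_mul_deg.
change (hshift (dga_grading M) p (n + m) (a * e + b * tau c)).
apply: hshiftD.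
  move: he; rewrite /hshift; case: leqP => pm; last first.
    by move->; rewrite mulr0; case: ifP => // _; apply: homog0.
  move=> he; rewrite (leq_trans pm) ?leq_addl // -addnBA //; exact: dga_mul_deg.
move: hb; rewrite /hshift; case: leqP => pn; last first.
  by move->; rewrite mul0r; case: ifP => // _; apply: homog0.
move=> hb; rewrite (leq_trans pn) ?leq_addr // -addnBAC //.
by apply: dga_mul_deg => //; apply: tau_hom.
Qed.

Lemma odd_comm n m (u v : E) : odd_homog n u -> odd_homog m v ->
  u * v = (-1) ^+ (n * m) *: (v * u).
Proof.
case: u v => [a b] [c e] [/= ha hb] [/= hc he]; congr pair; first exact: dga_comm.
change (a * e + b * tau c = (-1) ^+ (n * m) *: (c * b + e * tau a)).
rewrite addrC scalerDr; congr (_ + _).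
  move: hb; rewrite /hshift; case: leqP => pn; last first.
    by move->; rewrite mul0r mulr0 scaler0.
  move=> hb; rewrite (tauE hc) -scalerAr (dga_comm hb hc) scalerA -exprD.
rewrite -[in LHS]signr_odd -[in RHS]signr_odd oddD !oddM oddB // p_odd.
  by case: (odd n); case: (odd m).
move: he; rewrite /hshift; case: leqP => pn; last first.
  by move->; rewrite mul0r mulr0 scaler0.
move=> he; rewrite (tauE ha) -scalerAr scalerA -exprD (dga_comm ha he).
rewrite -[in LHS]signr_odd -[in RHS]signr_odd oddD !oddM oddB // p_odd.
by case: (odd n); case: (odd m).
Qed.

Let ez : ~~ odd p.+1. Proof. by rewrite /= p_odd. Qed.

Lemma odd_leibniz n m (u v : E) : odd_homog n u -> odd_homog m v ->
  odd_d (u * v) = odd_d u * v + (-1) ^+ n *: (u * odd_d v).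
Proof.
case: u v => [a b] [c e] [/= ha hb] [/= hc he].
have tb : tau b = - (-1) ^+ n *: b.
  move: hb; rewrite /hshift; case: leqP => pn; last first.
    by move->; rewrite linear0 scaler0.
  by move=> /tauE ->; rewrite !sgn_odd oddB // p_odd; case: (odd n); rewrite ?opprK.
have ta := tauE ha.
have tz : tau z = z by rewrite (tauE hz) -signr_odd (negPf ez) scale1r.
congr pair.
  change (d (a * c) + tau (a * e + b * tau c) * z =
   (d a + tau b * z) * c + (-1) ^+ n *: (a * (d c + tau e * z))).
  rewrite (leibniz tauE) rmorphD !rmorphM /= (tauK tauE) ta.
  rewrite !mulrDl !mulrDr scalerDr -!mulrA (comm_even hz ez) -!scalerAl.
  by rewrite -!addrA; congr (_ + _); rewrite addrC -addrA addrC -addrA.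
change (d (a * e + b * tau c) =
   (d a + tau b * z) * e + d b * tau c + (-1) ^+ n *: (a * d e + b * tau (d c + tau e * z))).
rewrite linearD /= !(leibniz tauE) ta tb (tau_d tauE) rmorphD rmorphM /= (tauK tauE) tz.
rewrite mulrDl mulrDr !scalerDr -!scalerAl !scaleNr -!mulrA (comm_even hz ez).
rewrite mulrN scalerN opprK.
set A1 := d a * e; set A2 := _ *: (a * d e); set A3 := d b * _; set A4 := _ *: (b * tau _).
set A5 := _ *: (b * (e * z)).
(* The two terms that contain [z] are opposite: [b] lives in degree [n - p] with [p] odd, which
   flips one sign. *)
by rewrite [RHS](AC (3*(1*2)) (1*4*(3*5)*(6*2))) /= subrr addr0.
Qed.

Lemma hirsch_odd : exists (M' : dga) (iota : dga_mor M M') x, hirsch_ext p z iota x.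
Proof.
have [D DE] := linear_ex odd_d_linear.
have Ddeg n u : odd_homog n u -> odd_homog n.+1 (D u).
  by rewrite DE; apply: odd_d_deg.
have Dsq u : D (D u) = 0 by rewrite !DE odd_d_sq.
have Dleib n m (u v : E) : odd_homog n u -> odd_homog m v ->
    D (u * v) = D u * v + (-1) ^+ n *: (u * D v).
  by rewrite !DE; apply: odd_leibniz.
pose M' := @Dga E odd_grading D Ddeg Dsq odd_one_deg odd_mul_deg odd_comm Dleib.
pose inl (a : R) : E := (a, 0).
have [i0 i0E] : exists i0 : {lrmorphism R -> E}, forall a, i0 a = inl a.
  have il : linear inl.
    by move=> k a b; congr pair; rewrite /= ?scaler0 ?addr0.
  have im : monoid_morphism inl.
    by split => // a b; congr pair; rewrite /= ?mulr0 ?mul0r ?addr0.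
  pose i0 : {lrmorphism R -> E} := HB.pack_for {lrmorphism R -> E}
    inl (GRing.isLinear.Build rat R E _ inl il)
    (GRing.isMonoidMorphism.Build R E inl im).
  by exists i0.
have i0_deg n (a : M) : hom n a -> hom n (i0 a : M').
  by move=> ha; rewrite i0E; apply: odd_homog_l.
have i0_d (a : M) : i0 (codiff M a) = codiff M' (i0 a).
  rewrite /= !i0E DE; congr pair; rewrite /= ?linear0 ?mul0r ?addr0 //.
pose x : E := (0, 1).
have hx : odd_homog p x := odd_homog_r (dga_one_deg M).
have Dx : D x = inl z.
  by rewrite DE; congr pair; rewrite /= ?linear0 ?rmorph1 ?mul1r ?add0r // (d_one tauE).
have mulx (b : R) : i0 b * x = (0, b).
  by rewrite i0E; congr pair; rewrite /= ?mulr0 // mulr1 mul0r addr0.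
exists M', (@DgaMor M M' i0 i0_deg i0_d), x; split=> /=.
- exact: hx.
- by rewrite Dx i0E.
- move=> [a b]; exists 2, (fun i => if i is 0%N then a else b); split=> //.
  rewrite big_ord_recl big_ord1 expr0 expr1 mulr1 mulx i0E.
  by congr pair; rewrite /= ?addr0 ?add0r.
- move=> N b /(_ p_odd); case: N => [|[|[|//]]] // _.
    by rewrite big_ord1 expr0 mulr1 i0E => -[b0] [].
  rewrite big_ord_recl big_ord1 expr0 expr1 mulr1 mulx i0E => -[].
  by rewrite /= addr0 add0r => b0 b1 [|[]].
- move=> A phi a ha da.
  have [tA tAE] := dga_sign A.
  have aa : a * a = 0 := sq_odd tAE ha p_odd.
  (* A morphism preserves degrees, hence parity; this makes the map on pairs respect the twisted
     product. *)
  have phi_tau b : phi (tau b) = tA (phi b).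
    elim/(homog_ind (g := dga_grading M)): b => [|b c hb hc|n b hb].
    - by rewrite !linear0.
    - by rewrite !linearD /= hb hc.
    by rewrite (tauE hb) linearZ /= (tAE n) //; apply: dga_fun_deg.
  pose psi0 (u : E) : dga_alg A := phi u.1 + phi u.2 * a.
  have psil : linear psi0.
    move=> k [u1 u2] [v1 v2]; rewrite /psi0 /=.
    rewrite !linearD /= !linearZ /= mulrDl -scalerAl.
    by rewrite addrACA.
  have psim : monoid_morphism psi0.
    split; first by rewrite /psi0 /= rmorph1 linear0 mul0r addr0.
    move=> [u1 u2] [v1 v2]; rewrite /psi0 /=.
    rewrite linearD /= !rmorphM /= phi_tau !mulrDl !mulrDr -!mulrA.
    rewrite (mulrA a (phi v2)) (comm_odd tAE ha p_odd (phi v2)).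
    rewrite -(mulrA _ a a) aa !mulr0 addr0 (comm_odd tAE ha p_odd (phi v1)).
    by rewrite addrA.
  pose psi : {lrmorphism E -> dga_alg A} := HB.pack_for {lrmorphism E -> dga_alg A}
    psi0 (GRing.isLinear.Build rat E (dga_alg A) _ psi0 psil)
    (GRing.isMonoidMorphism.Build E (dga_alg A) psi0 psim).
  have psi_deg n (u : M') : hom n u -> hom n (psi u : A).
    case: u => [u1 u2] [/= h1 h2]; apply: homogD; first exact: dga_fun_deg.
    move: h2; rewrite /hshift /=; case: leqP => pn; last first.
      by move->; rewrite linear0 mul0r; apply: homog0.
    by move=> h2; rewrite -(subnK pn); apply: dga_mul_deg => //; apply: dga_fun_deg.
  have psi_d (u : M') : psi (codiff M' u) = codiff A (psi u).
    case: u => [u1 u2]; rewrite /= DE /psi0 /= linearD rmorphM linearD /=.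
    rewrite (leibniz tAE) da phi_tau.
    have -> : phi (d u1) = dga_diff A (phi u1) := dga_fun_d phi u1.
    have -> : phi (d u2) = dga_diff A (phi u2) := dga_fun_d phi u2.
    by rewrite -addrA [X in _ + X]addrC.
  exists (@DgaMor M' A psi psi_deg psi_d); split => [b|] /=; rewrite ?i0E /psi0 /=.
    by rewrite linear0 mul0r addr0.
  by rewrite linear0 add0r rmorph1 mul1r.
Qed.

End Odd.

Lemma hirsch_ex (M : dga) p (z : dga_alg M) :
  homog (dga_grading M) p.+1 z -> dga_diff M z = 0 ->
  exists (M' : dga) (iota : dga_mor M M') x, hirsch_ext p z iota x.
Proof.
move=> hz dz; have [tau tauE] := dga_sign M; case: (boolP (odd p)) => p_odd.
  exact: hirsch_odd p_odd hz dz tau tauE.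
exact: hirsch_even p_odd hz dz tau tauE.
Qed.

(** * Free graded commutative algebras *)

Notation word := (seq nat).

Definition letter_lt (deg : nat -> nat) : rel nat :=
  fun i j => (i < j)%N || (i == j) && ~~ odd (deg i).

Lemma letter_lt_trans deg : transitive (letter_lt deg).
Proof. by move=> j i l; rewrite /letter_lt; case: ltngtP => // [ij _|->]; case: ltngtP; lia. Qed.

(** The pairwise form splits along concatenations. *)
Lemma standardE deg (s : word) : standard deg s = pairwise (letter_lt deg) s.
Proof. by rewrite -(sorted_pairwise (@letter_lt_trans deg)). Qed.

Definition wdeg (deg : nat -> nat) (w : word) : nat := sumn (map deg w).

Lemma wdeg_cons deg i w : wdeg deg (i :: w) = (deg i + wdeg deg w)%N.
Proof. by []. Qed.

Lemma wdeg_cat deg u w : wdeg deg (u ++ w) = (wdeg deg u + wdeg deg w)%N.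
Proof. by rewrite /wdeg map_cat sumn_cat. Qed.

Definition wstd (k : nat) (deg : nat -> nat) (w : word) : bool :=
  all (gtn k) w && standard deg w.

Lemma eq_wstd k deg deg' w : (forall i, (i < k)%N -> deg i = deg' i) ->
  wstd k deg w = wstd k deg' w.
Proof.
move=> e; rewrite /wstd; case: (boolP (all _ w)) => //= wk; rewrite !standardE.
apply: (@eq_in_pairwise _ (gtn k)) wk => i j /e ei _.
by rewrite /letter_lt ei.
Qed.

Lemma eq_wdeg k deg deg' w : (forall i, (i < k)%N -> deg i = deg' i) ->
  all (gtn k) w -> wdeg deg w = wdeg deg' w.
Proof.
by move=> e /allP wk; congr sumn; apply/eq_in_map => i /wk /e.
Qed.

(** [free_on] for generators numbered by the naturals below [k]. With a bound instead of an ordinal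
    type, words stay unchanged when generators are adjoined; the passage to ordinals is made once,
    at the end. *)
Definition wfree (M : dga) (k : nat) (deg : nat -> nat) (x : nat -> dga_alg M) : Prop :=
  [/\ forall i, (i < k)%N -> hom (deg i) (x i : M),
      forall a : dga_alg M, exists P : seq (rat * word),
        all (fun m => wstd k deg m.2) P /\ a = poly_eval x P
    & forall (S : seq word) (c : word -> rat),
        uniq S -> all (wstd k deg) S ->
        \sum_(s <- S) c s *: monomial x s = 0 -> {in S, forall s, c s = 0}].

Lemma sorted_split k (s : word) : sorted leq s ->
  s = [seq i <- s | (i < k)%N] ++ [seq i <- s | (k <= i)%N].
Proof.
elim: s => //= x s IH ps; have sx : all (leq x) s := order_path_min leq_trans ps.
have [xk|kx] /= := ltnP x k; first by rewrite -IH // (path_sorted ps).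
have ks : all (leq k) s by apply: sub_all sx => i /(leq_trans kx).
rewrite (eq_in_filter (a2 := pred0)) ?filter_pred0 /=; last first.
  by move=> i /(allP ks) /=; rewrite ltnNge => ->.
by rewrite (all_filterP ks).
Qed.

Lemma standard_leq deg s : standard deg s -> sorted leq s.
Proof.
rewrite standardE (sorted_pairwise leq_trans); apply: sub_pairwise => i j.
by rewrite /letter_lt => /orP[/ltnW//|/andP[/eqP-> _]].
Qed.

(** The largest letter forms a final block, so standard words match the normal forms of a Hirsch
    extension: an old word times a power of the new generator. *)
Lemma wstd_split k deg s : wstd k.+1 deg s ->
  [/\ s = [seq i <- s | (i < k)%N] ++ nseq (count_mem k s) k,
      wstd k deg [seq i <- s | (i < k)%N]
    & odd (deg k) -> (count_mem k s <= 1)%N].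
Proof.
move=> /andP[sk st].
have ek : [seq i <- s | (k <= i)%N] = nseq (count_mem k s) k.
  rewrite -size_filter (@eq_in_filter _ _ (pred1 k)); last first.
    by move=> i /(allP sk) /=; rewrite ltnS eqn_leq => ->.
  by apply/all_pred1P/filter_all.
have es := sorted_split k (standard_leq st); rewrite ek in es.
move: st; rewrite standardE {1}es pairwise_cat => /and3P[_ st1 st2]; split => //.
  by rewrite /wstd filter_all standardE.
move=> ok; move: st2; case: (count_mem k s) => [|[|j]] //=.
by rewrite /letter_lt ltnn eqxx ok.
Qed.

Lemma wstd_cat k deg s j : wstd k deg s -> (odd (deg k) -> (j <= 1)%N) ->
  wstd k.+1 deg (s ++ nseq j k).
Proof.
move=> /andP[sk st] oj; apply/andP; split.
  rewrite all_cat all_nseq /= ltnSn orbT andbT.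
  by apply: sub_all sk => i /= /ltnW.
move: st; rewrite !standardE pairwise_cat => ->; rewrite andTb; apply/andP; split.
  apply/allrelP => a b /(allP sk) /= ak; rewrite mem_nseq => /andP[_ /eqP->].
  by rewrite /letter_lt ak.
case: (boolP (odd (deg k))) oj => ok oj; first by case: j oj => [|[|j]] //= /(_ isT).
by elim: {oj} j => //= j ->; rewrite andbT all_nseq /letter_lt eqxx ok orbT orbT.
Qed.

Section Monomials.
Variables (M : dga) (x : nat -> dga_alg M).

Lemma monomial0 : monomial x [::] = 1. Proof. exact: big_nil. Qed.

Lemma monomial_cons i w : monomial x (i :: w) = x i * monomial x w.
Proof. exact: big_cons. Qed.

Lemma monomial_cat u w : monomial x (u ++ w) = monomial x u * monomial x w.
Proof. exact: big_cat. Qed.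

Lemma monomial_nseq j k : monomial x (nseq j k) = x k ^+ j.
Proof. by elim: j => [|j IH]; rewrite ?monomial0 // monomial_cons IH exprS. Qed.

Lemma poly_eval_cat P Q : poly_eval x (P ++ Q) = poly_eval x P + poly_eval x Q.
Proof. exact: big_cat. Qed.

Lemma eq_monomial (y : nat -> dga_alg M) w : {in w, x =1 y} -> monomial x w = monomial y w.
Proof. by move=> e; apply: eq_big_seq. Qed.

Lemma monomial_hom k deg : (forall i, (i < k)%N -> hom (deg i) (x i : M)) ->
  forall w, all (gtn k) w -> hom (wdeg deg w) (monomial x w : M).
Proof.
move=> hx; elim=> [_|i w IH] /=; first by rewrite monomial0; apply: dga_one_deg.
by move=> /andP[ik wk]; rewrite monomial_cons; apply: dga_mul_deg; [apply: hx|apply: IH].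
Qed.

End Monomials.

Lemma monomial_map (M N : dga) (f : dga_mor M N) (x : nat -> dga_alg M) w :
  f (monomial x w) = monomial (fun i => f (x i)) w.
Proof. exact: rmorph_prod. Qed.

Lemma poly_eval_map (M N : dga) (f : dga_mor M N) (x : nat -> dga_alg M) P :
  f (poly_eval x P) = poly_eval (fun i => f (x i)) P.
Proof. by rewrite raddf_sum; apply: eq_bigr => m _; rewrite /= linearZ /= monomial_map. Qed.

Lemma poly_evalZ (M : dga) (x : nat -> dga_alg M) a P :
  poly_eval x [seq (a * m.1, m.2) | m <- P] = a *: poly_eval x P.
Proof.
by rewrite /poly_eval big_map scaler_sumr; apply: eq_bigr => m _; rewrite scalerA.
Qed.

(** Spanning: expand each coefficient of the normal form in old words. Independence: group the words
    by the exponent of the new letter, then use uniqueness of the normal form and freeness of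
    [M]. *)
Lemma wfree_hirsch (M M' : dga) (iota : dga_mor M M') k deg deg' x y (z : dga_alg M) :
  wfree k deg x -> (forall i, (i < k)%N -> deg i = deg' i) ->
  hirsch_ext (deg' k) z iota y ->
  wfree k.+1 deg' (fun i => if (i < k)%N then iota (x i) else y).
Proof.
move=> [hx sp ind] edeg [hy dy sp' ind' _]; set x' := fun i => _.
have x'k : x' k = y by rewrite /x' ltnn.
have mon_old w : all (gtn k) w -> monomial x' w = iota (monomial x w).
  move=> wk; rewrite monomial_map; apply: eq_monomial => i /(allP wk) /= ik.
  by rewrite /x' ik.
have mon_new w j : all (gtn k) w ->
    monomial x' (w ++ nseq j k) = iota (monomial x w) * y ^+ j.
  by move=> wk; rewrite monomial_cat mon_old // monomial_nseq x'k.
split.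
- move=> i; rewrite ltnS leq_eqVlt /x'; have [ik _|_ /orP[/eqP->|//]] := ltnP i k.
    by rewrite -edeg //; apply: dga_fun_deg; apply: hx.
  exact: hy.
- move=> a; have [N [b [oN ->]]] := sp' a.
  have {sp' a} : forall j, (j < N)%N -> (odd (deg' k) -> (j <= 1)%N).
    by move=> j jN /oN N2; rewrite -ltnS (leq_trans jN).
  elim: N {oN} => [|N IH] oj; first by exists [::]; rewrite big_ord0 /poly_eval big_nil.
  rewrite big_ord_recr /=.
  have [|P [aP ->]] := IH; first by move=> j jN; apply: oj; apply: ltnW.
  have [Q [aQ QE]] := sp (b N).
  exists (P ++ [seq (m.1, m.2 ++ nseq N k) | m <- Q]).
  rewrite all_cat aP all_map poly_eval_cat; split.
    apply: sub_all aQ => m /= mk; apply: wstd_cat; last exact: oj.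
    by rewrite -(eq_wstd _ edeg).
  congr (_ + _); rewrite QE /poly_eval big_map raddf_sum mulr_suml.
  rewrite !big_seq; apply: eq_bigr => m mQ; rewrite mon_new; last by have /andP[] := allP aQ m mQ.
  by rewrite /= linearZ /= -scalerAl.
- move=> S c uS aS S0 s0 s0S.
  pose sp1 (s : word) := [seq i <- s | (i < k)%N]; pose ct (s : word) := count_mem k s.
  (* A strict bound on the exponents that occur. In the odd case it has to be at most 2, the range
     in which [hirsch_ext] asserts uniqueness. *)
  pose N := if odd (deg' k) then 2%N else (\max_(s <- S) ct s).+1.
  have ctN s : s \in S -> (ct s < N)%N.
    move=> sS; have [_ _ o1] := wstd_split (allP aS s sS).
    rewrite /N; case: ifP => [/o1//|_]; rewrite ltnS.
    by rewrite (big_rem s) //= leq_maxl.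
  pose Sj j := [seq sp1 s | s <- S & ct s == j].
  pose b j := \sum_(u <- Sj j) c (u ++ nseq j k) *: monomial x u.
  have spE s : s \in S -> s = sp1 s ++ nseq (ct s) k.
    by move=> sS; have [] := wstd_split (allP aS s sS).
  have spS s : s \in S -> wstd k deg (sp1 s).
    by move=> sS; have [] := wstd_split (allP aS s sS); rewrite (eq_wstd _ edeg).
  (* The given relation, rewritten as a normal form whose [j]-th coefficient collects the words with
     exponent [j]. *)
  have sumE : \sum_(j < N) iota (b j) * y ^+ j = 0.
    rewrite -[RHS]S0.
    transitivity (\sum_(j < N) \sum_(s <- S | ct s == j) c s *: monomial x' s).
      apply: eq_bigr => j _; rewrite /b big_map big_filter raddf_sum mulr_suml.
      rewrite big_seq_cond [RHS]big_seq_cond; apply: eq_bigr => s /andP[sS /eqP sj].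
      rewrite /= linearZ /= -scalerAl -sj -spE //; congr (_ *: _).
      rewrite [in RHS](spE _ sS) mon_new //.
      by have /andP[] := spS _ sS.
    rewrite (exchange_big_dep xpredT) //= big_seq [RHS]big_seq.
    apply: eq_bigr => s sS; rewrite (big_pred1 (Ordinal (ctN _ sS))) //.
  have oN : odd (deg' k) -> (N <= 2)%N by rewrite /N => ->.
  have b0 := ind' N b oN sumE (ct s0) (ctN _ s0S).
  have uSj : uniq (Sj (ct s0)).
    rewrite map_inj_in_uniq ?filter_uniq // => s t.
    rewrite !mem_filter => /andP[/eqP sc sS] /andP[/eqP tc tS] st.
    by rewrite (spE _ sS) (spE _ tS) st sc tc.
  have aSj : all (wstd k deg) (Sj (ct s0)).
    by apply/allP => u /mapP[s]; rewrite mem_filter => /andP[_ sS] ->; apply: spS.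
  have := ind _ (fun u => c (u ++ nseq (ct s0) k)) uSj aSj b0 (sp1 s0).
  by rewrite -spE //; apply; apply: map_f; rewrite mem_filter eqxx.
Qed.

(** The generators may be adjoined one after the other because all the cocycles [z j] already lie in
    [M]. Two degree functions occur since [deg] is meaningful only below [k]. *)
Lemma hirsch_seq (A : dga) p (L : nat -> dga_alg A) r :
  forall (M : dga) (phi : dga_mor M A) k deg deg' (x : nat -> dga_alg M) (z : nat -> dga_alg M),
  wfree k deg x ->
  (forall i, (i < k)%N -> deg i = deg' i) ->
  (forall j, (j < r)%N -> deg' (k + j)%N = p) ->
  (forall j, (j < r)%N -> [/\ cocycle p.+1 (z j : M), hom p (L j : A) &
     codiff A (L j) = phi (z j)]) ->
  exists (M' : dga) (iota : dga_mor M M') (phi' : dga_mor M' A) (x' : nat -> dga_alg M'),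
  [/\ wfree (k + r) deg' x',
      forall b, phi' (iota b) = phi b,
      forall b, iota b = 0 -> b = 0,
      forall i, (i < k)%N -> x' i = iota (x i)
    & forall j, (j < r)%N -> dga_diff M' (x' (k + j)%N) = iota (z j) /\
         phi' (x' (k + j)%N) = L j].
Proof.
elim: r L => [|r IH] L M phi k deg deg' x z fx edeg degp hz.
  have idd : forall a : M, (idfun : {lrmorphism dga_alg M -> dga_alg M}) (codiff M a) =
     codiff M ((idfun : {lrmorphism dga_alg M -> dga_alg M}) a) by [].
  exists M, (@DgaMor M M idfun (fun p a h => h) idd), phi, x; split => //.
  case: fx => [hx sp ind]; rewrite addn0; split.
  - by move=> i ik; rewrite -edeg //; apply: hx.
  - move=> a; have [P [aP PE]] := sp a; exists P; split => //.
    by apply: sub_all aP => m; rewrite (eq_wstd _ edeg).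
  - move=> S c uS aS; apply: ind => //.
    by apply: sub_all aS => m; rewrite (eq_wstd _ edeg).
have [[hz0 dz0] hL0 dL0] := hz 0%N isT.
have [M1 [i1 [y hy]]] := hirsch_ex hz0 dz0.
have degk : deg' k = p by rewrite -[k]addn0 degp.
have hy' := hy; rewrite -{1}degk in hy'.
have fx1 := wfree_hirsch fx edeg hy'.
have [hy1 dy1 _ ind1 /(_ A phi (L 0%N) hL0 dL0) [phi1 [phi1E phi1y]]] := hy.
have := IH (fun j => L j.+1) M1 phi1 k.+1 deg' deg' _ (fun j => i1 (z j.+1)) fx1.
case=> // [j jr|j jr|M' [iota [phi' [x' [fx' h1 h2 h3 h4]]]]].
- by rewrite addSnnS degp.
- have [[hzj dzj] hLj dLj] := hz j.+1 jr; split; rewrite ?phi1E //; split.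
    exact: dga_fun_deg.
  by rewrite -(dga_fun_d i1) dzj linear0.
have cd : forall a : M, (iota \o i1 : {lrmorphism dga_alg M -> dga_alg M'}) (codiff M a) =
    codiff M' ((iota \o i1 : {lrmorphism dga_alg M -> dga_alg M'}) a).
  by move=> a; rewrite /= -(dga_fun_d iota) -(dga_fun_d i1).
have cdeg q (a : M) : hom q a ->
    hom q ((iota \o i1 : {lrmorphism dga_alg M -> dga_alg M'}) a : M').
  by move=> ha; apply: (dga_fun_deg iota); apply: (dga_fun_deg i1).
exists M', (@DgaMor M M' (iota \o i1) cdeg cd), phi', x'; split => /=.
- by rewrite -addSnnS.
- by move=> b; rewrite h1 phi1E.
(* Injectivity of one extension is uniqueness of normal forms of length 1. *)
- move=> b /h2 b0; have := ind1 1%N (fun=> b) (fun=> isT); rewrite big_ord1 expr0 mulr1.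
  by move/(_ b0 0%N isT).
- by move=> i ik; rewrite h3 ?ik // ltnW.
- case=> [_|j jr]; last by rewrite -addSnnS; apply: h4.
  rewrite addn0 h3 // ltnn; split; last by rewrite h1.
  by have /= := dga_fun_d iota y; rewrite dy1 => ->.
Qed.

Fixpoint all_words (k l : nat) : seq word :=
  if l is l'.+1 then [::] :: [seq i :: w | i <- iota 0 k, w <- all_words k l']
  else [:: [::]].

Definition words (k : nat) (deg : nat -> nat) (p : nat) : seq word :=
  [seq w <- all_words k p | standard deg w && (wdeg deg w == p)].

Lemma mem_all_words k l w : (w \in all_words k l) = all (gtn k) w && (size w <= l)%N.
Proof.
elim: l w => [|l IH] [|i w] //=; rewrite ?in_cons /=.
  by rewrite ltn0 andbF.
apply/allpairsP/idP => [[[j v] /= [jk vl [-> ->]]]|/andP[/andP[ik wk] wl]].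
  by move: jk vl; rewrite mem_iota add0n IH ltnS /= => jk /andP[vk ->]; rewrite vk jk.
by exists (i, w); split => //=; [rewrite mem_iota add0n|rewrite IH wk].
Qed.

Lemma all_words_uniq k l : uniq (all_words k l).
Proof.
elim: l => //= l IH; apply/andP; split; first by apply/negP => /allpairsP[[i w] []].
by apply: allpairs_uniq => //; [apply: iota_uniq|move=> [i w] [j v] _ _ [-> ->]].
Qed.

Lemma words_uniq k deg p : uniq (words k deg p).
Proof. exact/filter_uniq/all_words_uniq. Qed.

(** All degrees are positive, so a word of degree [p] has at most [p] letters and the enumeration by
    length misses none. *)
Lemma mem_words k deg p w : (forall i, (i < k)%N -> (0 < deg i)%N) ->
  (w \in words k deg p) = wstd k deg w && (wdeg deg w == p).
Proof.
move=> dpos; rewrite mem_filter mem_all_words /wstd andbC -!andbA.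
case: (boolP (all _ w)) => //= wk; rewrite andbC -andbA; case: (standard deg w) => //=.
case: eqP => //= <-.
elim: w wk => //= i w IH /andP[/= ik /IH]; rewrite wdeg_cons => wl.
by apply: leq_ltn_trans wl _; rewrite -add1n leq_add2r dpos.
Qed.

Definition pwf k (deg : nat -> nat) p (P : seq (rat * word)) : bool :=
  all (fun m => all (gtn k) m.2 && (wdeg deg m.2 == p)) P.

(** * Koszul signs and normal forms of words *)

Section Coef.
Variable deg : nat -> nat.

(* Moving the first occurrence of [x] in [t] to the front: the sign (0 if there
   is none) and the remaining word. *)
Fixpoint extract (x : nat) (t : word) : rat * word :=
  if t is y :: t' then
    if x == y then (1, t')
    else ((-1) ^+ (deg x * deg y) * (extract x t').1, y :: (extract x t').2)
  else (0, [::]).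

(* The coefficient of the standard monomial [t] in the word [u]. *)
Fixpoint coef (u t : word) : rat :=
  if u is x :: u' then (extract x t).1 * coef u' (extract x t).2 else (nilp t)%:R.

Fixpoint pcoef (P : seq (rat * word)) (t : word) : rat :=
  if P is m :: P' then m.1 * coef m.2 t + pcoef P' t else 0.

Lemma pcoefE P t : pcoef P t = \sum_(m <- P) m.1 * coef m.2 t.
Proof. by elim: P => [|m P IH]; rewrite ?big_nil ?big_cons //= IH. Qed.

Lemma extract_perm x t : x \in t -> perm_eq t (x :: (extract x t).2).
Proof.
elim: t => //= y t IH; rewrite in_cons; case: eqP => [-> //|_ /= /IH tx] /=.
apply: (perm_trans (y := y :: x :: (extract x t).2)); first by rewrite perm_cons.
exact/permEl/(perm_catCA [:: y] [:: x]).
Qed.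

Lemma extract_notin x t : x \notin t -> (extract x t).1 = 0.
Proof.
elim: t => //= y t IH; rewrite in_cons negb_or => /andP[/negPf-> /IH /= ->].
by rewrite mulr0.
Qed.

Lemma coef_nperm u t : ~~ perm_eq u t -> coef u t = 0.
Proof.
elim: u t => [|x u IH] t /=; first by case: t.
case: (boolP (x \in t)) => [xt|/extract_notin->]; last by rewrite mul0r.
by rewrite (permPr (extract_perm xt)) perm_cons => /IH ->; rewrite mulr0.
Qed.

End Coef.

Section Normal.

Variables (M : dga) (k : nat) (deg : nat -> nat) (x : nat -> dga_alg M).
Hypothesis hx : forall i, (i < k)%N -> hom (deg i) (x i : M).

Lemma extract_monomial i t : (i < k)%N -> all (gtn k) t -> i \in t ->
  (extract deg i t).1 *: monomial x t = x i * monomial x (extract deg i t).2.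
Proof.
move=> ik; elim: t => //= y t IH /andP[yk tk]; rewrite in_cons monomial_cons.
case: eqP => [->|_ /= it]; first by rewrite /= scale1r.
rewrite /= monomial_cons -scalerA scalerAr IH // !mulrA.
by rewrite (dga_comm (hx ik) (hx yk)) scalerAl.
Qed.

(** Needed for every rearrangement [t] of [u], standard or not: the sorted word may repeat an odd
    letter. *)
Lemma coef_monomial u t : all (gtn k) t -> perm_eq u t ->
  monomial x u = coef deg u t *: monomial x t.
Proof.
elim: u t => [|i u IH] t tk /=.
  by rewrite perm_sym => /perm_nilP->; rewrite scale1r.
move=> ut; have it : i \in t by rewrite -(perm_mem ut) mem_head.
have ik : (i < k)%N := allP tk _ it.
have pt := extract_perm deg it.
have rk : all (gtn k) (extract deg i t).2 by move: tk; rewrite (perm_all _ pt) => /andP[].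
rewrite monomial_cons (IH _ rk); last by rewrite -(perm_cons i) -(permPr pt).
by rewrite -scalerAr -extract_monomial // scalerA mulrC.
Qed.

(** A weakly increasing word fails to be standard only by repeating an odd letter, and those squares
    vanish. *)
Lemma sorted_nonstandard s : all (gtn k) s -> sorted leq s -> ~~ standard deg s -> monomial x s = 0.
Proof.
elim: s => // i [|j s] IH //= /andP[ik /andP[jk sk]] /andP[ij js].
rewrite !monomial_cons /standard /=.
case: (boolP (_ || _)) => [_ nst|].
  by rewrite -[X in _ * X]monomial_cons IH ?mulr0 //=; rewrite jk.
rewrite negb_or ltEnat /= -leqNgt => /andP[ji].
have -> : i = j by apply/eqP; rewrite eqn_leq ij.
rewrite eqxx negbK => oj _; have [tau tauE] := dga_sign M.
by rewrite mulrA (sq_odd tauE (hx jk) oj) mul0r.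
Qed.

Hypothesis dpos : forall i, (i < k)%N -> (0 < deg i)%N.

(** Only the sorted rearrangement of [u] can have a nonzero coefficient; when it is not standard,
    both sides vanish. *)
Lemma monomial_words p u : all (gtn k) u -> wdeg deg u = p ->
  monomial x u = \sum_(t <- words k deg p) coef deg u t *: monomial x t.
Proof.
move=> uk up; pose t0 := sort leq u.
have ut0 : perm_eq u t0 by rewrite perm_sym perm_sort.
have t0k : all (gtn k) t0 by rewrite -(perm_all _ ut0).
have uniq_t t : t \in words k deg p -> t != t0 -> coef deg u t = 0.
  rewrite mem_words // => /andP[/andP[tk /standard_leq st] _] tt0; apply: coef_nperm.
  apply: contra tt0 => ut; apply/eqP/(sorted_eq leq_trans anti_leq) => //.
    exact: (sort_sorted leq_total).
  by rewrite -(permPl ut).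
rewrite (coef_monomial t0k ut0).
case: (boolP (standard deg t0)) => st0.
  have t0W : t0 \in words k deg p.
    rewrite mem_words // /wstd t0k st0 -up /=; apply/eqP/esym/perm_sumn.
    exact: perm_map.
  rewrite (bigD1_seq t0) ?words_uniq //= big_seq_cond big1 ?addr0 // => t /andP[tW tt0].
  by rewrite uniq_t // scale0r.
rewrite (sorted_nonstandard t0k (sort_sorted leq_total _) st0) scaler0 big_seq big1 //.
move=> t tW; rewrite uniq_t ?scale0r //; apply: contraNneq st0 => <-.
by move: tW; rewrite mem_words // => /andP[/andP[_ ->]].
Qed.

Lemma poly_eval_words p P : pwf k deg p P ->
  poly_eval x P = \sum_(t <- words k deg p) pcoef deg P t *: monomial x t.
Proof.
move=> wP; under eq_bigr do rewrite pcoefE scaler_suml.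
rewrite exchange_big /= /poly_eval !big_seq; apply: eq_bigr => m mP.
have /andP[mk /eqP mp] := allP wP m mP.
by rewrite (monomial_words mk mp) scaler_sumr; apply: eq_bigr => t _; rewrite scalerA.
Qed.

End Normal.

Section Differential.

Variables (deg : nat -> nat) (dp : nat -> seq (rat * word)).

(** The Leibniz rule letter by letter, without collecting or sorting terms; [pcoef] later reads
    coefficients off such unreduced polynomials. *)
Fixpoint dword (w : word) : seq (rat * word) :=
  if w is i :: w' then
    [seq (m.1, m.2 ++ w') | m <- dp i] ++
    [seq ((-1) ^+ deg i * m.1, i :: m.2) | m <- dword w']
  else [::].

Lemma dword_pwf k w : (forall i, (i < k)%N -> pwf k deg (deg i).+1 (dp i)) ->
  all (gtn k) w -> pwf k deg (wdeg deg w).+1 (dword w).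
Proof.
move=> hdp; elim: w => //= i w IH /andP[ik wk]; rewrite /pwf all_cat !all_map.
apply/andP; split.
  apply: sub_all (hdp i ik) => m /= /andP[mk /eqP mi].
  by rewrite all_cat mk wk wdeg_cat mi wdeg_cons addSn eqxx.
apply: sub_all (IH wk) => m /= /andP[-> /eqP mi].
by rewrite ik !wdeg_cons mi addnS eqxx.
Qed.

Lemma dword_eval (M : dga) k (x : nat -> dga_alg M) w :
  (forall i, (i < k)%N -> hom (deg i) (x i : M)) ->
  (forall i, (i < k)%N -> dga_diff M (x i) = poly_eval x (dp i)) ->
  all (gtn k) w -> dga_diff M (monomial x w) = poly_eval x (dword w).
Proof.
move=> hx dx; elim: w => [_|i w IH /= /andP[ik wk]].
  by have [tau tauE] := dga_sign M; rewrite monomial0 (d_one tauE) /poly_eval big_nil.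
rewrite monomial_cons (dga_leibniz (hx _ ik) (monomial_hom hx wk)) dx // IH //.
rewrite poly_eval_cat; congr (_ + _); rewrite /poly_eval big_map.
  by rewrite mulr_suml; apply: eq_bigr => m _; rewrite monomial_cat scalerAl.
rewrite mulr_sumr scaler_sumr; apply: eq_bigr => m _.
by rewrite monomial_cons /= -scalerAr scalerA.
Qed.

End Differential.

Section FreeHom.

Variables (M : dga) (k : nat) (deg : nat -> nat) (x : nat -> dga_alg M).
Hypothesis fx : wfree k deg x.
Hypothesis dpos : forall i, (i < k)%N -> (0 < deg i)%N.

(** Freeness gives an expansion with words of arbitrary degrees; the projection onto degree [p]
    discards the wrong ones. *)
Lemma wfree_hom p (a : M) : hom p a ->
  exists c : word -> rat, a = \sum_(t <- words k deg p) c t *: monomial x t.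
Proof.
case: (fx) => hx sp _ ha; have [P [aP PE]] := sp a.
have [T [T1 T2]] := grading_proj (cograding M) p.
pose Q := [seq m <- P | wdeg deg m.2 == p].
have aE : a = poly_eval x Q.
  rewrite -(T1 a ha) PE /poly_eval /Q big_filter raddf_sum (bigID (fun m => wdeg deg m.2 == p)) /=.
  rewrite [X in _ + X]big1_seq ?addr0.
    rewrite big_seq_cond [RHS]big_seq_cond; apply: eq_bigr => m /andP[/(allP aP) /andP[mk _] /eqP mp].
    by rewrite linearZ /= T1 // -mp; apply: (monomial_hom hx).
  move=> m /andP[mp /(allP aP) /andP[mk _]].
  by rewrite linearZ /= (T2 (wdeg deg m.2)) ?scaler0 //; apply: (monomial_hom hx).
exists (pcoef deg Q); rewrite aE; apply: poly_eval_words => //.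
apply/allP => m; rewrite mem_filter => /andP[-> /(allP aP) /andP[-> _]] //.
Qed.

Lemma words_free p c : \sum_(t <- words k deg p) c t *: monomial x t = 0 ->
  {in words k deg p, forall t, c t = 0}.
Proof.
case: (fx) => _ _ ind; apply: ind; first exact: words_uniq.
by apply/allP => t; rewrite mem_words // => /andP[].
Qed.

End FreeHom.

(** * Linear algebra *)

(** One step of Gaussian elimination with pivot row [w]; the cleared first column is dropped. *)
Definition eliminate (w v : seq rat) : seq rat :=
  [seq nth 0 v j.+1 - (head 0 v / head 0 w) * nth 0 w j.+1 | j <- iota 0 (size v).-1].

(* Each row lists the values of some linear forms at a vector, followed by the
   coordinates of this vector.  [cut] passes to a basis of the kernel of the first
   form and drops its values. *)
Fixpoint cut (R : seq (seq rat)) : seq (seq rat) :=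
  if R is w :: R' then
    if head 0 w == 0 then behead w :: cut R' else [seq eliminate w v | v <- R']
  else [::].

Fixpoint lincomb (c : nat -> rat) (R : seq (seq rat)) (j : nat) : rat :=
  if R is w :: R' then c 0%N * nth 0 w j + lincomb (fun i => c i.+1) R' j else 0.

Lemma lincombE c R j :
  lincomb c R j = \sum_(i < size R) c i * nth 0 (nth [::] R i) j.
Proof. by elim: R c => [|w R IH] c; rewrite ?big_ord0 //= big_ord_recl IH. Qed.

Lemma nth_behead (w : seq rat) j : nth 0 (behead w) j = nth 0 w j.+1.
Proof. by case: w => //=; rewrite nth_nil. Qed.

Lemma nth_eliminate w v j : size w = size v ->
  nth 0 (eliminate w v) j = nth 0 v j.+1 - (head 0 v / head 0 w) * nth 0 w j.+1.
Proof.
move=> wv; have [jv|vj] := ltnP j (size v).-1.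
  by rewrite (nth_map 0%N) ?size_iota // nth_iota.
have vj' : (size v <= j.+1)%N by rewrite -ltnS; move: vj; case: (size v).
rewrite [nth 0 v _]nth_default // [nth 0 w _]nth_default ?wv //.
by rewrite nth_default ?size_map ?size_iota // mulr0 subr0.
Qed.

Section Cut.

Variable N : nat.
Implicit Types R : seq (seq rat).

Lemma lincomb_eliminate c w R j : size w = N.+1 -> all (fun v => size v == N.+1) R ->
  lincomb c [seq eliminate w v | v <- R] j =
  lincomb c R j.+1 - (lincomb c R 0 / head 0 w) * nth 0 w j.+1.
Proof.
move=> sw; elim: R c => [|v R IH] c /=; first by rewrite !mul0r subrr.
move=> /andP[/eqP sv sR]; rewrite IH // nth_eliminate ?sw // -nth0.
by rewrite !mulrDl; ring.
Qed.

Lemma cut_size R : all (fun v => size v == N.+1) R -> all (fun v => size v == N) (cut R).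
Proof.
elim: R => //= w R IH /andP[/eqP sw sR]; case: ifP => _ /=.
  by rewrite size_behead sw eqxx IH.
rewrite all_map; apply: sub_all sR => v /eqP sv /=.
by rewrite size_map size_iota sv.
Qed.

(** Combinations after the cut are combinations before it that annihilate the first form. The last
    clause transports linear independence. *)
Lemma cut_lift R : all (fun v => size v == N.+1) R -> forall c', exists c,
  [/\ lincomb c R 0 = 0, forall j, lincomb c R j.+1 = lincomb c' (cut R) j
    & (forall i, (i < size R)%N -> c i = 0) ->
      forall i, (i < size (cut R))%N -> c' i = 0].
Proof.
elim: R => [|w R IH] /=; first by move=> _ c'; exists c'.
move=> /andP[/eqP sw sR] c'; case: eqP => [w0|/eqP w0].
  have [c [c0 cS cz]] := IH sR (fun i => c' i.+1).
  exists (fun i => if i is i'.+1 then c i' else c' 0%N); split => /=.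
  - by rewrite nth0 w0 mulr0 add0r.
  - by move=> j; rewrite cS nth_behead.
  - move=> z [_|i iR]; first exact: (z 0%N).
    by apply: cz iR => l lR; apply: (z l.+1).
(* The coefficient of the pivot row is the one that makes the first form vanish. *)
exists (fun i => if i is i'.+1 then c' i' else - (lincomb c' R 0 / head 0 w)); split => /=.
- by rewrite nth0 mulNr divfK // addNr.
- by move=> j; rewrite lincomb_eliminate // mulNr addrC.
- by move=> z i; rewrite size_map => iR; apply: (z i.+1).
Qed.

(** Conversely, vanishing of the first form forces the coefficient of the pivot row, so no kernel
    vector is lost. *)
Lemma cut_proj R : all (fun v => size v == N.+1) R -> forall c,
  lincomb c R 0 = 0 -> exists c', forall j, lincomb c R j.+1 = lincomb c' (cut R) j.
Proof.
elim: R => [|w R IH] /=; first by move=> _ c; exists c.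
move=> /andP[/eqP sw sR] c; rewrite nth0; case: eqP => [->|/eqP w0] c0.
  have [|c' c'E] := IH sR (fun i => c i.+1); first by rewrite -c0 mulr0 add0r.
  exists (fun i => if i is i'.+1 then c' i' else c 0%N) => j /=.
  by rewrite c'E nth_behead.
exists (fun i => c i.+1) => j; rewrite lincomb_eliminate // addrC; congr (_ + _).
have -> : c 0%N = - (lincomb (fun i => c i.+1) R 0 / head 0 w).
  move/eqP: c0; rewrite addr_eq0 => /eqP c0; apply: (mulIf w0).
  by rewrite c0 mulNr divfK.
by rewrite mulNr.
Qed.

End Cut.

Lemma iter_cut_lift L q R : all (fun v => size v == (L + q)%N) R -> forall c', exists c,
  [/\ forall j, (j < L)%N -> lincomb c R j = 0,
      forall j, lincomb c R (L + j) = lincomb c' (iter L cut R) j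
    & (forall i, (i < size R)%N -> c i = 0) ->
      forall i, (i < size (iter L cut R))%N -> c' i = 0].
Proof.
elim: L R => [|L IH] R sR c'; first by exists c'.
have [c1 [c10 c1S c1z]] := IH _ (cut_size sR) c'.
have [c [c0 cS cz]] := cut_lift sR c1.
exists c; rewrite iterSr; split.
- by case=> // j jL; rewrite cS c10.
- by move=> j; rewrite addSn cS c1S.
- by move=> z; apply: c1z; apply: cz.
Qed.

Lemma iter_cut_proj L q R : all (fun v => size v == (L + q)%N) R -> forall c,
  (forall j, (j < L)%N -> lincomb c R j = 0) ->
  exists c', forall j, lincomb c R (L + j) = lincomb c' (iter L cut R) j.
Proof.
elim: L R => [|L IH] R sR c c0; first by exists c.
have [c1 c1E] := cut_proj sR (c0 0%N isT).
have [|c' c'E] := IH _ (cut_size sR) c1; first by move=> j jL; rewrite -c1E c0.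
by exists c' => j; rewrite iterSr addSn c1E c'E.
Qed.

Definition unit_row (q i : nat) : seq rat := [seq (i == j)%:R | j <- iota 0 q].

(** * A basis of the common kernel of finitely many linear forms *)

Section Kernel.

Variables (L q : nat) (vals : nat -> seq rat).
Hypothesis svals : forall i, (i < q)%N -> size (vals i) = L.

Let rows := [seq vals i ++ unit_row q i | i <- iota 0 q].
(** The rows are those of the values matrix augmented by the identity. After [L] cuts all values are
    consumed and the identity part has become the coordinates of a kernel basis. *)
Definition kernel_basis := iter L cut rows.

Let srows : all (fun v => size v == (L + q)%N) rows.
Proof.
rewrite all_map; apply/allP => i; rewrite mem_iota add0n => /= iq.
by rewrite size_cat svals // size_map size_iota.
Qed.

Let rows_size : size rows = q. Proof. by rewrite size_map size_iota. Qed.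

Let nth_rows i : (i < q)%N -> nth [::] rows i = vals i ++ unit_row q i.
Proof. by move=> iq; rewrite (nth_map 0%N) ?size_iota // nth_iota. Qed.

Let rows_vals c j : (j < L)%N ->
  lincomb c rows j = \sum_(i < q) c i * nth 0 (vals i) j.
Proof.
move=> jL; rewrite lincombE rows_size; apply: eq_bigr => i _.
by rewrite nth_rows // nth_cat svals // jL.
Qed.

Let rows_unit c j : (j < q)%N -> lincomb c rows (L + j) = c j.
Proof.
move=> jq; rewrite lincombE rows_size (bigD1 (Ordinal jq)) //= big1 ?addr0.
  rewrite nth_rows // nth_cat svals // ltnNge leq_addr /= addKn.
  by rewrite (nth_map 0%N) ?size_iota // nth_iota // eqxx mulr1.
move=> i ij; rewrite nth_rows // nth_cat svals // ltnNge leq_addr /= addKn.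
rewrite (nth_map 0%N) ?size_iota // nth_iota // add0n.
by rewrite -(inj_eq val_inj) /= in ij; rewrite (negPf ij) mulr0.
Qed.

Lemma kernel_basis_val c' j : (j < L)%N ->
  \sum_(i < q) lincomb c' kernel_basis i * nth 0 (vals i) j = 0.
Proof.
move=> jL; have [c [c0 cE _]] := iter_cut_lift srows c'.
have := c0 _ jL; rewrite rows_vals // => z; rewrite -[RHS]z; apply: eq_bigr => i _.
by rewrite -cE rows_unit.
Qed.

Lemma kernel_basis_free c' : (forall j, (j < q)%N -> lincomb c' kernel_basis j = 0) ->
  forall i, (i < size kernel_basis)%N -> c' i = 0.
Proof.
move=> z; have [c [c0 cE cz]] := iter_cut_lift srows c'.
by apply: cz => i; rewrite rows_size => iq; rewrite -rows_unit // cE z.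
Qed.

Lemma kernel_basis_span (c : nat -> rat) :
  (forall j, (j < L)%N -> \sum_(i < q) c i * nth 0 (vals i) j = 0) ->
  exists c', forall j, (j < q)%N -> c j = lincomb c' kernel_basis j.
Proof.
move=> z; have [|c' c'E] := iter_cut_proj srows (c := c).
  by move=> j jL; rewrite rows_vals // z.
by exists c' => j jq; rewrite -rows_unit // c'E.
Qed.

End Kernel.

(** * Orthogonal projection over the rationals *)

Section Orthogonal.

Variable q : nat.
Implicit Types u v : nat -> rat.

Definition dot u v : rat := \sum_(j < q) u j * v j.

Lemma dot_eq0 u : dot u u = 0 -> forall j, (j < q)%N -> u j = 0.
Proof.
move/eqP; rewrite psumr_eq0; last by move=> j _; rewrite -expr2 sqr_ge0.
move=> /allP z j jq; have := z (Ordinal jq) (mem_index_enum _).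
by rewrite /= mulf_eq0 orbb => /eqP.
Qed.

Fixpoint comb (b : nat -> rat) (B : seq (nat -> rat)) (j : nat) : rat :=
  if B is v :: B' then b 0%N * v j + comb (fun i => b i.+1) B' j else 0.

Fixpoint perp u (B : seq (nat -> rat)) : Prop :=
  if B is v :: B' then dot u v = 0 /\ perp u B' else True.

Lemma perp_comb u B b : perp u B -> dot u (comb b B) = 0.
Proof.
elim: B b => [|v B IH] b /=; first by move=> _; rewrite /dot big1 // => j _; rewrite mulr0.
move=> [uv /(IH (fun i => b i.+1)) uB]; rewrite /dot.
under eq_bigr do rewrite mulrDr mulrCA.
by rewrite big_split /= -mulr_sumr -/(dot u v) uv mulr0 add0r.
Qed.

Lemma comb_lin a b b' B j : comb (fun i => b i + a * b' i) B j = comb b B j + a * comb b' B j.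
Proof.
elim: B b b' => [|v B IH] b b' /=; first by rewrite mulr0 addr0.
by rewrite (IH (fun i => b i.+1) (fun i => b' i.+1)); ring.
Qed.

Lemma perp_lin a u v B : perp u B -> perp v B ->
  perp (fun j => u j + a * v j) B.
Proof.
elim: B => //= w B IH [uw uB] [vw vB]; split; last exact: IH.
rewrite /dot; under eq_bigr do rewrite mulrDl -mulrA.
by rewrite big_split /= -mulr_sumr -/(dot u w) uw -/(dot v w) vw mulr0 addr0.
Qed.

(** Gram-Schmidt for a list that may be linearly dependent: [u] and [v] are first made orthogonal to
    the tail, then [u'] to [v']. *)
Lemma perp_decomp B u : exists b, perp (fun j => u j - comb b B j) B.
Proof.
elim: B u => [|v B IH] u /=; first by exists (fun=> 0).
have [b bu] := IH u; have [b' bv] := IH v.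
pose u' j := u j - comb b B j; pose v' j := v j - comb b' B j.
(* If the denominator is zero, [v'] vanishes on the first [q] coordinates by definiteness, and any
   [a] would do. *)
pose a := dot u' v' / dot v' v'.
exists (fun i => if i is i'.+1 then b i' + (- a) * b' i' else a).
have eu : (fun j => u j - (a * v j + comb (fun i => b i + - a * b' i) B j)) =1
    (fun j => u' j + (- a) * v' j).
  by move=> j; rewrite /u' /v' comb_lin; ring.
have eo : forall f g C, f =1 g -> perp f C -> perp g C.
  move=> f g C fg; elim: C => //= w C IHC [fw fC]; split; last exact: IHC.
  by rewrite -fw; apply: eq_bigr => j _; rewrite fg.
have oB : perp (fun j => u' j + - a * v' j) B by apply: perp_lin.
have dE f g h : (forall j, h j = f j + comb g B j) -> perp (fun j => u' j + - a * v' j) B ->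
    dot (fun j => u' j + - a * v' j) h = dot (fun j => u' j + - a * v' j) f.
  move=> hE o; rewrite -[RHS]addr0 -(perp_comb g o) /dot -big_split /=.
  by apply: eq_bigr => j _; rewrite hE mulrDr.
split; last by apply: eo oB => j; rewrite eu.
rewrite (_ : dot _ v = dot (fun j => u' j + - a * v' j) v); last first.
  by apply: eq_bigr => j _; rewrite eu.
rewrite (dE v' b') //; last by move=> j; rewrite /v' subrK.
rewrite /dot; under eq_bigr do rewrite mulrDl -mulrA.
rewrite big_split /= -mulr_sumr -/(dot u' v') -/(dot v' v') mulNr /a.
have [z|nz] := eqVneq (dot v' v') 0; last by rewrite divfK // subrr.
rewrite z mulr0 subr0 /dot big1 // => j _.
by rewrite (dot_eq0 z) ?mulr0.
Qed.

End Orthogonal.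

(** * The effective complex *)

Section Coordinates.

Variable C : eff_cochain.
Local Notation CQ := (rationalization C).

Definition cvec (p : nat) (g : nat -> rat) : CQ :=
  \sum_(i < rank C p) g i *: (<< mkcell i >> : ratspace C).

Definition ccoord (p : nat) (c : CQ) : seq rat :=
  [seq (c : ratspace C)@_(mkcell i) | i <- enum 'I_(rank C p)].

Definition drows (p : nat) : seq (seq rat) :=
  [seq [seq (ediff C p i j)%:~R | j <- enum 'I_(rank C p.+1)] | i <- enum 'I_(rank C p)].

Lemma size_ccoord p c : size (ccoord p c) = rank C p.
Proof. by rewrite size_map size_enum_ord. Qed.

Lemma size_drows p : size (drows p) = rank C p.
Proof. by rewrite size_map size_enum_ord. Qed.

Lemma nth_ccoord p c (i : 'I_(rank C p)) : nth 0 (ccoord p c) i = (c : ratspace C)@_(mkcell i).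
Proof. by rewrite (nth_map i) ?size_enum_ord // nth_ord_enum. Qed.

Lemma nth_drows p (i : 'I_(rank C p)) :
  nth [::] (drows p) i = [seq (ediff C p i j)%:~R | j <- enum 'I_(rank C p.+1)].
Proof. by rewrite (nth_map i) ?size_enum_ord // nth_ord_enum. Qed.

Lemma nth_drows2 p (i : 'I_(rank C p)) (j : 'I_(rank C p.+1)) :
  nth 0 (nth [::] (drows p) i) j = (ediff C p i j)%:~R.
Proof. by rewrite nth_drows (nth_map j) ?size_enum_ord // nth_ord_enum. Qed.

Lemma cvec_hom p g : hom p (cvec p g).
Proof.
apply: homog_sum => i _; apply: homogZ => k kp; rewrite mcoeffU.
by case: eqP => // ik; move: kp; rewrite -ik /= eqxx.
Qed.

Lemma ccoordE p g (i : 'I_(rank C p)) : (cvec p g : ratspace C)@_(mkcell i) = g i.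
Proof.
rewrite /cvec raddf_sum (bigD1 i) //= mcoeffZ mcoeffUU mulr1 big1 ?addr0 // => j ji.
rewrite mcoeffZ mcoeffU; case: eqP => [/eqP|_]; last by rewrite mulr0.
by rewrite eq_Tagged /= (negPf ji).
Qed.

Lemma hom_ccoord p (c c' : CQ) : hom p c -> hom p c' ->
  (forall i : 'I_(rank C p), (c : ratspace C)@_(mkcell i) = (c' : ratspace C)@_(mkcell i)) ->
  c = c'.
Proof.
move=> hc hc' cc'; apply/malgP => -[q i].
have [qp|qp] := eqVneq q p; last by rewrite hc ?hc'.
by subst q; apply: cc'.
Qed.

Lemma cvec_ccoord p c : hom p c -> c = cvec p (nth 0 (ccoord p c)).
Proof.
move=> hc; apply: (hom_ccoord hc) => [|i]; first exact: cvec_hom.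
by rewrite ccoordE nth_ccoord.
Qed.

Lemma eq_cvec p g g' : (forall i, (i < rank C p)%N -> g i = g' i) -> cvec p g = cvec p g'.
Proof. by move=> e; apply: eq_bigr => i _; rewrite e. Qed.

Lemma cvec_lin p a g g' : cvec p (fun i => g i + a * g' i) = cvec p g + a *: cvec p g'.
Proof.
rewrite /cvec scaler_sumr -big_split; apply: eq_bigr => i _.
by rewrite scalerDl scalerA.
Qed.

Lemma codiff_cvec p g :
  codiff CQ (cvec p g) =
  cvec p.+1 (fun j => \sum_(i < rank C p) g i * nth 0 (nth [::] (drows p) i) j).
Proof.
apply: (hom_ccoord (p := p.+1)).
- exact: (codiff_deg (c := CQ) (cvec_hom _)).
- exact: cvec_hom.
move=> j; rewrite ccoordE /cvec.
have -> : codiff CQ (\sum_(i < rank C p) g i *: (<< mkcell i >> : ratspace C)) =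
    \sum_(i < rank C p) g i *: rat_diff_cell (mkcell i).
  transitivity (rat_diff C (\sum_(i < rank C p) g i *: (<< mkcell i >> : ratspace C))) => //.
  rewrite raddf_sum; apply: eq_bigr => i _; rewrite -rat_diff_U; congr (rat_diff C _).
  by apply/malgP => l; rewrite mcoeffZ !mcoeffU; case: eqP; rewrite ?mulr1 ?mulr0.
rewrite raddf_sum; apply: eq_bigr => i _; rewrite nth_drows2.
rewrite /= mcoeffZ /rat_diff_cell raddf_sum (bigD1 j) //= mcoeffUU big1 ?addr0 // => l lj.
by rewrite mcoeffU; case: eqP => [/eqP|//]; rewrite eq_Tagged /= (negPf lj).
Qed.

End Coordinates.

(** * The maps between the algebra and the effective complex *)

Section Equivalence.

Variables (X A C : cochain) (r1 : reduction X A) (r2 : reduction X C).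

Definition eqF (a : A) : C := red_f r2 (red_g r1 a).
Definition eqG (c : C) : A := red_f r1 (red_g r2 c).
Definition eqH (a : A) : A := red_f r1 (red_h r2 (red_g r1 a)).

Lemma eqF_lin : linear eqF. Proof. by move=> k a b; rewrite /eqF !linearP. Qed.
Lemma eqH_lin : linear eqH. Proof. by move=> k a b; rewrite /eqH !linearP. Qed.

Lemma eqF_deg p a : hom p a -> hom p (eqF a).
Proof. by move=> ha; apply/red_f_deg/red_g_deg. Qed.

Lemma eqG_deg p a : hom p a -> hom p (eqG a).
Proof. by move=> ha; apply/red_f_deg/red_g_deg. Qed.

Lemma eqH_deg p a : hom p.+1 a -> hom p (eqH a).
Proof. by move=> ha; apply/red_f_deg/red_h_deg/red_g_deg. Qed.

Lemma eqF_d a : eqF (codiff A a) = codiff C (eqF a).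
Proof. by rewrite /eqF red_g_d red_f_d. Qed.

Lemma eqG_d c : eqG (codiff C c) = codiff A (eqG c).
Proof. by rewrite /eqG red_g_d red_f_d. Qed.

(** The homotopy relation of [r2], evaluated at [g1 a] and pushed forward by [f1]. *)
Lemma eqGF a : eqG (eqF a) = a - (codiff A (eqH a) + eqH (codiff A a)).
Proof.
have := red_gf r2 (red_g r1 a); move/(congr1 (red_f r1)).
rewrite linearB /= red_fg linearD /= red_f_d -red_g_d => e.
by rewrite /eqH -e /eqG /eqF opprB addrC subrK.
Qed.

(* The composite of the homotopies, [f2 h1 h2 g1], compares [F H] with [K F]
   where [K = f2 h1 g2] is the homotopy between [F G] and the identity. *)
Lemma eqF_lift p (c : C) (z : A) : hom p.+1 c -> hom p.+2 z -> codiff A z = 0 ->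
  eqF z = codiff C c ->
  exists2 e, hom p e & eqF (eqG c + eqH z) = c + codiff C e.
Proof.
move=> hc hz dz Fz.
pose K := red_f r2 (red_h r1 (red_g r2 c)).
pose Y := red_f r2 (red_h r1 (red_h r2 (red_g r1 z))).
exists (- (K + Y)).
  apply: homogN; apply: homogD.
    by apply/red_f_deg/red_h_deg/red_g_deg.
  by apply/red_f_deg/red_h_deg/red_h_deg/red_g_deg.
have gf1 x : red_g r1 (red_f r1 x) = x - (codiff X (red_h r1 x) + red_h r1 (codiff X x)).
  by rewrite -red_gf opprB addrC subrK.
(* The term [f2 h1 d w] enters [FG] and [FH] with opposite signs; everything else besides [c] is a
   coboundary. The first uses [h1 g1 = 0], the second [f2 h2 = 0]. *)
pose w := red_h r2 (red_g r1 z).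
have FG : eqF (eqG c) = c - codiff C K + red_f r2 (red_h r1 (codiff X w)).
  rewrite /eqF /eqG gf1 !linearB /= red_fg linearD /= red_f_d -/K -red_g_d -Fz /eqF.
  have -> : red_g r2 (red_f r2 (red_g r1 z)) = red_g r1 z - codiff X w.
    by have /esym := red_gf r2 (red_g r1 z); rewrite -red_g_d dz !linear0 addr0 => ->; rewrite opprB addrC subrK.
  by rewrite linearB red_hg sub0r linearN /= opprD opprK addrA.
have FH : eqF (eqH z) = - codiff C Y - red_f r2 (red_h r1 (codiff X w)).
  rewrite /eqF /eqH gf1 -/w linearB /= red_fh sub0r linearD /= red_f_d.
  by rewrite opprD.
have -> : eqF (eqG c + eqH z) = eqF (eqG c) + eqF (eqH z).
  by have := eqF_lin 1 (eqG c) (eqH z); rewrite !scale1r.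
rewrite FG FH linearN linearD /= opprD.
by rewrite addrACA subrr addr0 addrA.
Qed.

End Equivalence.

(** * The relative cohomology of a partial model *)

Lemma codiffD (X : cochain) (a b : X) : codiff X (a + b) = codiff X a + codiff X b.
Proof. exact: linearD. Qed.

Lemma codiffZ (X : cochain) k (a : X) : codiff X (k *: a) = k *: codiff X a.
Proof. exact: linearZ. Qed.

Lemma codiff0 (X : cochain) : codiff X 0 = 0.
Proof. exact: linear0. Qed.

(** * The linear system for the harmonic vectors, in coordinates *)

Section StepDefs.

Variables (A : dga) (C : eff_cochain) (F : A -> rationalization C).
Variables (k : nat) (deg : nat -> nat) (dp : nat -> seq (rat * word)) (img : nat -> dga_alg A).
Variable m : nat. (* [m.+1] is the degree of the new generators. *)

Definition crow p (s : word) : seq rat := ccoord p (F (monomial img s)).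

(* The values at the basis vectors of [M^(m+2) + C^(m+1)] of the linear forms that
   cut out the harmonic subspace: the coordinates of the differential of the cone,
   then the inner products with the coboundaries of the words of degree m+1 and of
   the cells of degree m. *)
Definition word_vals (s : word) : seq rat :=
  [seq pcoef deg (dword deg dp s) t | t <- words k deg m.+3] ++
  crow m.+2 s ++
  [seq pcoef deg (dword deg dp y) s | y <- words k deg m.+1] ++
  nseq (rank C m) 0.

Definition cell_vals (i : nat) : seq rat :=
  nseq (size (words k deg m.+3)) 0 ++
  [seq - e | e <- nth [::] (drows C m.+1) i] ++
  [seq nth 0 (crow m.+1 y) i | y <- words k deg m.+1] ++
  [seq nth 0 r i | r <- drows C m].

Definition nwords := size (words k deg m.+2).
Definition ncoords := (nwords + rank C m.+1)%N.
Definition nconds := (size (words k deg m.+3) + (rank C m.+2 +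
  (size (words k deg m.+1) + rank C m)))%N.

Definition cone_vals (i : nat) : seq rat :=
  if (i < nwords)%N then word_vals (nth [::] (words k deg m.+2) i)
  else cell_vals (i - nwords).

Definition harmonic : seq (seq rat) := kernel_basis nconds ncoords cone_vals.

Definition zpoly (v : seq rat) : seq (rat * word) :=
  [seq (nth 0 v i, nth [::] (words k deg m.+2) i) | i <- iota 0 nwords].

Definition cpart (v : seq rat) : rationalization C :=
  cvec C m.+1 (fun i => nth 0 v (nwords + i)).

End StepDefs.

Section Step.

Variables (X : cochain) (A : dga) (C : eff_cochain).
Variables (r1 : reduction X A) (r2 : reduction X (rationalization C)).
Local Notation CQ := (rationalization C).
Local Notation F := (eqF r1 r2).
Local Notation G := (eqG r1 r2).
Local Notation H := (eqH r1 r2).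
Variables (k : nat) (deg : nat -> nat) (dp : nat -> seq (rat * word)) (m : nat).
Variables (M : dga) (phi : dga_mor M A) (x : nat -> dga_alg M).
Hypothesis fx : wfree k deg x.
Hypothesis deg2 : forall i, (i < k)%N -> (2 <= deg i <= m)%N.
Hypothesis hdp : forall i, (i < k)%N -> pwf k deg (deg i).+1 (dp i).
Hypothesis dx : forall i, (i < k)%N -> dga_diff M (x i) = poly_eval x (dp i).

Let img i := phi (x i).
Local Notation W := (words k deg).
Local Notation vals := (cone_vals F k deg dp img m).
Local Notation q := (ncoords C k deg m).
Local Notation n1 := (nwords k deg m).
Local Notation L := (nconds C k deg m).

Let hx i : (i < k)%N -> hom (deg i) (x i : M). Proof. by case: fx => h _ _ ik; exact: h. Qed.
Let dpos i : (i < k)%N -> (0 < deg i)%N. Proof. by move=> ik; have /andP[/ltnW] := deg2 ik. Qed.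

Let phi_mon s : monomial img s = phi (monomial x s).
Proof. by rewrite monomial_map. Qed.

Let phi_d (a : M) : phi (codiff M a) = codiff A (phi a). Proof. exact: dga_fun_d. Qed.

Definition zval (u : nat -> rat) : dga_alg M :=
  \sum_(i < n1) u i *: monomial x (nth [::] (W m.+2) i).
Definition cval (u : nat -> rat) : CQ := cvec C m.+1 (fun i => u (n1 + i)%N).

Definition cone_closed (u : nat -> rat) : Prop :=
  dga_diff M (zval u) = 0 /\ F (phi (zval u)) = codiff CQ (cval u).

Definition cone_exact (u : nat -> rat) : Prop := exists (y : dga_alg M) (e : CQ),
  [/\ hom m.+1 (y : M), hom m e, zval u = dga_diff M y
    & cval u = F (phi y) + codiff CQ e].

Lemma zval_lin a u v : zval (fun i => u i + a * v i) = zval u + a *: zval v.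
Proof.
rewrite /zval scaler_sumr -big_split; apply: eq_bigr => i _.
by rewrite scalerDl scalerA.
Qed.

Lemma cval_lin a u v : cval (fun i => u i + a * v i) = cval u + a *: cval v.
Proof. exact: cvec_lin. Qed.

Let FD (a b : A) : F (a + b) = F a + F b.
Proof. by have := eqF_lin r1 r2 1 a b; rewrite !scale1r. Qed.

Let FZ c (a : A) : F (c *: a) = c *: F a.
Proof.
have F0 : F 0 = 0 by have := eqF_lin r1 r2 (-1) 0 0; rewrite !scaleN1r !addNr.
by have := eqF_lin r1 r2 c a 0; rewrite F0 !addr0.
Qed.

Lemma eq_zval u v : u =1 v -> zval u = zval v.
Proof. by move=> uv; apply: eq_bigr => i _; rewrite uv. Qed.

Lemma eq_cval u v : u =1 v -> cval u = cval v.
Proof. by move=> uv; apply: eq_bigr => i _; rewrite uv. Qed.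

Lemma zval0 : zval (fun=> 0) = 0.
Proof. by apply: big1 => i _; rewrite scale0r. Qed.

Lemma cval0 : cval (fun=> 0) = 0.
Proof. by apply: big1 => i _; exact: scale0r. Qed.

Let F0 : F 0 = 0.
Proof. by rewrite -[0 in LHS](scale0r 0) FZ scale0r. Qed.

Lemma closed_lin a u v : cone_closed u -> cone_closed v -> cone_closed (fun i => u i + a * v i).
Proof.
move=> [du Fu] [dv Fv]; rewrite /cone_closed zval_lin cval_lin; split.
  by rewrite linearD linearZ /= du dv scaler0 addr0.
by rewrite linearD linearZ /= FD FZ Fu Fv linearD linearZ.
Qed.

Lemma exact_lin a u v : cone_exact u -> cone_exact v -> cone_exact (fun i => u i + a * v i).
Proof.
move=> [y [e [hy he zy cy]]] [y' [e' [hy' he' zy' cy']]].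
exists (y + a *: y'), (e + a *: e'); split.
- by apply: homogD => //; apply: homogZ.
- by apply: homogD => //; apply: homogZ.
- by rewrite zval_lin zy zy' linearD linearZ.
- have -> : phi (y + a *: y') = phi y + a *: phi y' by rewrite linearD linearZ.
  have -> : codiff CQ (e + a *: e') = codiff CQ e + a *: codiff CQ e'.
    by rewrite linearD linearZ.
  by rewrite cval_lin cy cy' FD FZ scalerDr addrACA.
Qed.

Lemma exact_closed u : cone_exact u -> cone_closed u.
Proof.
move=> [y [e [hy he zy cy]]]; split; first by rewrite zy dga_diff_sq.
have -> : codiff CQ (cval u) = codiff CQ (F (phi y)).
  by rewrite cy codiffD codiff_sq addr0.
by rewrite zy [phi _]phi_d eqF_d.
Qed.

Lemma zval_inj u : zval u = 0 -> forall i, (i < n1)%N -> u i = 0.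
Proof.
move=> zu i i1; have wi := mem_nth [::] i1; pose c s := u (index s (W m.+2)).
suff cz : \sum_(t <- W m.+2) c t *: monomial x t = 0.
  have := words_free fx dpos cz wi.
  by rewrite /c index_uniq // words_uniq.
rewrite -[RHS]zu (big_nth [::]) big_mkord; apply: eq_bigr => j _.
by rewrite /c index_uniq ?words_uniq.
Qed.

Lemma cval_inj u : cval u = 0 -> forall i, (i < rank C m.+1)%N -> u (n1 + i)%N = 0.
Proof.
move=> cu i ir; have := congr1 (fun c : ratspace C => c@_(mkcell (Ordinal ir))) cu.
by rewrite ccoordE mcoeff0.
Qed.

Lemma coords_inj u v : zval u = zval v -> cval u = cval v ->
  forall j, (j < q)%N -> u j = v j.
Proof.
move=> zuv cuv j jq; apply/eqP; rewrite -subr_eq0 -mulN1r; apply/eqP.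
pose w i := u i + -1 * v i; rewrite -/(w j).
have zw : zval w = 0 by rewrite zval_lin zuv scaleN1r subrr.
have cw : cval w = 0 by rewrite cval_lin cuv scaleN1r subrr.
have [j1|j1] := ltnP j n1; first exact: zval_inj.
by rewrite -(subnKC j1); apply: cval_inj => //; rewrite ltn_subLR.
Qed.

Lemma zval_surj (z : M) : hom m.+2 z -> exists u, zval u = z.
Proof.
move=> hz; have [c zE] := wfree_hom fx dpos hz.
exists (fun i => c (nth [::] (W m.+2) i)).
by rewrite zE (big_nth [::]) big_mkord.
Qed.

Lemma coords_surj (z : M) (c : CQ) : hom m.+2 z -> hom m.+1 c ->
  exists u, zval u = z /\ cval u = c.
Proof.
move=> /zval_surj [u uz] hc.
exists (fun i => if (i < n1)%N then u i else nth 0 (ccoord m.+1 c) (i - n1)%N); split.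
  by rewrite -uz; apply: eq_bigr => i _; rewrite ltn_ord.
rewrite [RHS](cvec_ccoord hc); apply: eq_cvec => i _.
by rewrite ltnNge leq_addr addKn.
Qed.

Definition word_vec (y : word) (i : nat) : rat :=
  if (i < n1)%N then pcoef deg (dword deg dp y) (nth [::] (W m.+2) i)
  else nth 0 (crow F img m.+1 y) (i - n1).

Definition cell_vec (r : seq rat) (i : nat) : rat :=
  if (i < n1)%N then 0 else nth 0 r (i - n1).

(** Generators of the coboundaries of the cone, one for each word of degree m+1 and each cell of
    degree m. They are functions, without decidable equality, hence membership by [List.In]. *)
Definition exact_vecs : seq (nat -> rat) :=
  [seq word_vec y | y <- W m.+1] ++ [seq cell_vec r | r <- drows C m].

Let mem_W p y : y \in W p -> [/\ all (gtn k) y, wdeg deg y = p & hom p (monomial x y : M)].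
Proof.
rewrite mem_words // => /andP[/andP[yk _] /eqP yp]; split => //.
by rewrite -yp; apply: monomial_hom yk.
Qed.

Lemma zval_hom u : hom m.+2 (zval u : M).
Proof.
apply: homog_sum => i _; apply: homogZ.
by have [] := mem_W (mem_nth [::] (ltn_ord i)).
Qed.

Lemma word_vec_val y : y \in W m.+1 ->
  zval (word_vec y) = dga_diff M (monomial x y) /\
  cval (word_vec y) = F (phi (monomial x y)).
Proof.
move=> /mem_W [yk yp hy]; split.
  rewrite (dword_eval hx dx yk) (poly_eval_words hx dpos (p := m.+2)).
    rewrite (big_nth [::]) big_mkord; apply: eq_bigr => i _.
    by rewrite /word_vec ltn_ord.
  by rewrite -yp; apply: dword_pwf.
have hFy : hom m.+1 (F (phi (monomial x y))) by apply: eqF_deg; apply: dga_fun_deg.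
rewrite [RHS](cvec_ccoord hFy); apply: eq_cvec => i _.
by rewrite /word_vec ltnNge leq_addr addKn /crow phi_mon.
Qed.

Lemma cell_vec_val (i : 'I_(rank C m)) :
  zval (cell_vec (nth [::] (drows C m) i)) = 0 /\
  cval (cell_vec (nth [::] (drows C m) i)) =
    codiff CQ (cvec C m (fun j => (j == i)%:R)).
Proof.
split.
  by apply: big1 => j _; rewrite /cell_vec ltn_ord scale0r.
rewrite codiff_cvec; apply: eq_cvec => j _; rewrite /cell_vec ltnNge leq_addr addKn.
rewrite (bigD1 i) //= eqxx mul1r big1 ?addr0 // => l li.
by rewrite -val_eqE /= in li; rewrite (negPf li) mul0r.
Qed.

Lemma exact_vecs_exact v : List.In v exact_vecs -> cone_exact v.
Proof.
move=> /List.in_app_iff [] /List.in_map_iff [y [<- yW]].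
  have {}yW : y \in W m.+1 by elim: (W m.+1) yW => //= a s IH [->|/IH]; rewrite in_cons ?eqxx // => ->; rewrite orbT.
  have [zy cy] := word_vec_val yW; have [_ _ hy] := mem_W yW.
  exists (monomial x y), 0; split => //; first exact: homog0.
  by rewrite cy linear0 addr0.
have [i <-] : exists i : 'I_(rank C m), nth [::] (drows C m) i = y.
  have {}yW : y \in drows C m by elim: (drows C m) yW => //= a s IH [->|/IH]; rewrite in_cons ?eqxx // => ->; rewrite orbT.
  move: yW => /(nthP [::]) [i]; rewrite size_drows => ir e.
  by exists (Ordinal ir).
have [z c] := cell_vec_val i.
exists 0, (cvec C m (fun j => (j == i)%:R)); split => //; first exact: homog0.
- exact: cvec_hom.
- by rewrite z linear0.
- by rewrite c linear0 F0 add0r.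
Qed.

Lemma comb_exact b (B : seq (nat -> rat)) :
  (forall v, List.In v B -> cone_exact v) -> cone_exact (comb b B).
Proof.
have ex0 : cone_exact (fun=> 0).
  exists 0, 0; split; try exact: homog0.
  - by rewrite linear0 zval0.
  - by rewrite linear0 F0 codiff0 addr0 cval0.
have eq_ex u v : u =1 v -> cone_exact u -> cone_exact v.
  by move=> uv [y [e [h1 h2 h3 h4]]]; exists y, e; rewrite -(eq_zval uv) -(eq_cval uv).
elim: B b => [|v B IH] b hB; first by apply: eq_ex ex0.
have hv := hB v (or_introl erefl).
have h1 := IH (fun i => b i.+1) (fun w wB => hB w (or_intror wB)).
by apply: eq_ex (exact_lin (b 0%N) h1 hv) => i /=; rewrite addrC.
Qed.

(** Vectors are functions on all naturals, of which only the first [q] values are coordinates. *)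
Definition in_comb (u : nat -> rat) (B : seq (nat -> rat)) :=
  exists b, forall j, (j < q)%N -> u j = comb b B j.

Lemma in_comb_lin a u v B : in_comb u B -> in_comb v B ->
  in_comb (fun i => u i + a * v i) B.
Proof.
move=> [b hb] [b' hb']; exists (fun i => b i + a * b' i) => j jq.
by rewrite comb_lin hb ?hb'.
Qed.

Lemma in_comb0 B : in_comb (fun=> 0) B.
Proof.
exists (fun=> 0) => j _; elim: B => //= v B IH.
by rewrite mul0r add0r.
Qed.

Lemma in_comb_mem v B : List.In v B -> in_comb v B.
Proof.
elim: B => //= w B IH [->|/IH [b hb]].
  exists (fun i => (i == 0%N)%:R) => j _ /=; rewrite mul1r.
  suff -> : comb (fun i => (i.+1 == 0%N)%:R) B j = 0 by rewrite addr0.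
  by elim: {IH} B => //= u B IH; rewrite mul0r add0r.
by exists (fun i => if i is i'.+1 then b i' else 0) => j jq /=; rewrite mul0r add0r hb.
Qed.

(** Expand [y] in standard words and [e] in cells; the partial sums [S] and [T] are treated by
    induction on the list of summands, and injectivity of the coordinates concludes. *)
Lemma exact_in_comb u : cone_exact u -> in_comb u exact_vecs.
Proof.
move=> [y [e [hy he zu cu]]].
have [c yE] := wfree_hom fx dpos hy.
pose S (s : seq word) (i : nat) := \sum_(t <- s) c t * word_vec t i.
pose g := nth 0 (ccoord m e).
pose T (s : seq 'I_(rank C m)) (i : nat) := \sum_(l <- s) g l * cell_vec (nth [::] (drows C m) l) i.
have eq_ic u' v' : u' =1 v' -> in_comb u' exact_vecs -> in_comb v' exact_vecs.
  by move=> uv [b hb]; exists b => j jq; rewrite -uv hb.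
have mem_In (U : eqType) (a : U) s : a \in s -> List.In a s.
  by elim: s => //= a' s IH; rewrite in_cons => /orP[/eqP->|/IH]; [left|right].
have SP s : {subset s <= W m.+1} -> [/\ in_comb (S s) exact_vecs,
    zval (S s) = dga_diff M (\sum_(t <- s) c t *: monomial x t)
    & cval (S s) = F (phi (\sum_(t <- s) c t *: monomial x t))].
  elim: s => [_|t s IH ts].
    have S0 : S [::] =1 fun=> 0 by move=> i; apply: big_nil.
    rewrite (eq_zval S0) (eq_cval S0) big_nil !linear0 zval0 cval0 F0; split => //.
    by apply: eq_ic (in_comb0 _) => i; rewrite S0.
  have tW := ts t (mem_head t s); have [zt ct] := word_vec_val tW.
  have [ics zs cs] := IH (fun w ws => ts w (mem_behead (s := t :: s) ws)).
  have Sc : S (t :: s) =1 fun i => S s i + c t * word_vec t i.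
    by move=> i; rewrite /S big_cons addrC.
  rewrite (eq_zval Sc) (eq_cval Sc) zval_lin cval_lin zs cs zt ct big_cons; split.
  - apply: eq_ic (in_comb_lin (c t) ics (in_comb_mem _)) => [i|]; first by rewrite Sc.
    apply/List.in_app_iff; left; apply: List.in_map; exact: mem_In tW.
  - by rewrite linearD linearZ /= addrC.
  - by rewrite [phi (_ + _)]linearD /= [phi (_ *: _)]linearZ /= FD FZ addrC.
have TP s : [/\ in_comb (T s) exact_vecs, zval (T s) = 0
    & cval (T s) = codiff CQ (\sum_(l <- s) g l *: cvec C m (fun j => (j == l)%:R))].
  elim: s => [|l s [ics zs cs]].
    have T0 : T [::] =1 fun=> 0 by move=> i; apply: big_nil.
    rewrite (eq_zval T0) (eq_cval T0) big_nil codiff0 zval0 cval0; split => //.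
    by apply: eq_ic (in_comb0 _) => i; rewrite T0.
  have [zl cl] := cell_vec_val l.
  have Tc : T (l :: s) =1 fun i => T s i + g l * cell_vec (nth [::] (drows C m) l) i.
    by move=> i; rewrite /T big_cons addrC.
  rewrite (eq_zval Tc) (eq_cval Tc) zval_lin cval_lin zs cs zl cl big_cons; split.
  - apply: eq_ic (in_comb_lin (g l) ics (in_comb_mem _)) => [i|]; first by rewrite Tc.
    apply/List.in_app_iff; right; apply: List.in_map; apply: mem_In.
    by apply: mem_nth; rewrite size_drows.
  - by rewrite scaler0 addr0.
  - by rewrite addrC codiffD codiffZ.
have [ic1 z1 c1] := SP _ (fun t h => h).
have [ic2 z2 c2] := TP (enum 'I_(rank C m)).
have [b hb] := in_comb_lin 1 ic1 ic2; exists b => j jq; rewrite -hb //.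
apply: (coords_inj (v := fun i => S (W m.+1) i + 1 * T (enum 'I_(rank C m)) i)) jq.
  by rewrite zval_lin z1 z2 zu yE scaler0 addr0.
rewrite cval_lin c1 c2 cu -yE scale1r; congr (_ + codiff _ _).
rewrite [LHS](cvec_ccoord he) big_enum /=; apply: eq_bigr => i _; congr (_ *: _).
rewrite /cvec (bigD1 i) //= eqxx scale1r big1 ?addr0 // => l li.
by rewrite -val_eqE /= in li; rewrite (negPf li) scale0r.
Qed.

(** * The linear forms, and the harmonic vectors as their kernel *)

Local Notation N3 := (size (W m.+3)).
Local Notation N1 := (size (W m.+1)).

Lemma size_word_vals s : size (word_vals F k deg dp img m s) = L.
Proof. by rewrite size_cat size_map size_cat size_ccoord size_cat size_map size_nseq. Qed.
Lemma size_cell_vals i : (i < rank C m.+1)%N -> size (cell_vals F k deg img m i) = L.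
Proof.
move=> ir; rewrite size_cat size_nseq size_cat size_map (nth_drows (Ordinal ir)).
rewrite size_map size_enum_ord size_cat size_map.
by rewrite [size (map _ (drows C m))]size_map size_drows.
Qed.

Lemma size_cone_vals i : (i < q)%N -> size (vals i) = L.
Proof.
rewrite /cone_vals => iq; case: ltnP => [_|i1]; first exact: size_word_vals.
by apply: size_cell_vals; rewrite ltn_subLR.
Qed.

Definition cond (u : nat -> rat) j := \sum_(i < q) u i * nth 0 (vals i) j.

Lemma condE u j : cond u j =
  \sum_(i < n1) u i * nth 0 (word_vals F k deg dp img m (nth [::] (W m.+2) i)) j +
  \sum_(i < rank C m.+1) u (n1 + i)%N * nth 0 (cell_vals F k deg img m i) j.
Proof.
rewrite /cond big_split_ord /=; congr (_ + _); apply: eq_bigr => i _.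
  by rewrite /cone_vals ltn_ord.
by rewrite /cone_vals ltnNge leq_addr addKn.
Qed.

Lemma cond_diff u : dga_diff M (zval u) = \sum_(j < N3) cond u j *: monomial x (nth [::] (W m.+3) j).
Proof.
rewrite /zval linear_sum.
transitivity (\sum_(i < n1) \sum_(j < N3)
    (u i * pcoef deg (dword deg dp (nth [::] (W m.+2) i)) (nth [::] (W m.+3) j)) *:
      monomial x (nth [::] (W m.+3) j)).
  apply: eq_bigr => i _; have [wk wp _] := mem_W (mem_nth [::] (ltn_ord i)).
  rewrite linearZ /= (dword_eval hx dx wk) (poly_eval_words hx dpos (p := m.+3)).
    rewrite (big_nth [::]) big_mkord scaler_sumr; apply: eq_bigr => j _.
    by rewrite scalerA.
  by have := dword_pwf hdp wk; rewrite wp.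
rewrite exchange_big; apply: eq_bigr => j _; rewrite -scaler_suml; congr (_ *: _).
rewrite condE [X in _ + X]big1 ?addr0.
  by apply: eq_bigr => i _; rewrite /word_vals nth_cat size_map ltn_ord (nth_map [::]).
by move=> i _; rewrite /cell_vals nth_cat size_nseq ltn_ord nth_nseq ltn_ord mulr0.
Qed.

Let F_sum (I : Type) (s : seq I) (h : I -> A) : F (\sum_(i <- s) h i) = \sum_(i <- s) F (h i).
Proof. by elim: s => [|i s IH]; rewrite ?big_nil ?big_cons ?FD ?IH. Qed.

Lemma cond_cell u (j : 'I_(rank C m.+2)) : cond u (N3 + j) =
  (F (phi (zval u)) - codiff CQ (cval u) : ratspace C)@_(mkcell j).
Proof.
rewrite condE mcoeffB; congr (_ + _).
  rewrite /zval linear_sum F_sum raddf_sum; apply: eq_bigr => i _.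
  rewrite linearZ /= FZ mcoeffZ; congr (_ * _).
  rewrite /word_vals nth_cat size_map ltnNge leq_addr addKn nth_cat size_ccoord ltn_ord /=.
  by rewrite nth_ccoord phi_mon.
rewrite /cval codiff_cvec ccoordE -sumrN; apply: eq_bigr => i _.
rewrite /cell_vals nth_cat size_nseq ltnNge leq_addr addKn nth_cat size_map /=.
rewrite nth_drows size_map size_enum_ord ltn_ord -mulrN; congr (_ * _).
by rewrite (nth_map (0 : rat)) // size_map size_enum_ord ltn_ord.
Qed.

Lemma cond_exact u j : (j < N1 + rank C m)%N ->
  cond u (N3 + (rank C m.+2 + j)) = dot q u (nth (fun=> 0) exact_vecs j).
Proof.
move=> jN; rewrite condE /dot big_split_ord /=; congr (_ + _); apply: eq_bigr => i _; congr (_ * _).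
  rewrite /word_vals nth_cat size_map ltnNge leq_addr /= addKn nth_cat size_ccoord.
  rewrite ltnNge leq_addr /= addKn nth_cat size_map /exact_vecs nth_cat size_map.
  case: ltnP => j1; first by rewrite !(nth_map [::]) // /word_vec ltn_ord.
  rewrite nth_nseq ltn_subLR // jN (nth_map [::]) ?size_drows ?ltn_subLR //.
  by rewrite /cell_vec ltn_ord.
rewrite /cell_vals nth_cat size_nseq ltnNge leq_addr /= addKn nth_cat size_map.
rewrite nth_drows size_map size_enum_ord ltnNge leq_addr /= addKn nth_cat size_map.
rewrite /exact_vecs nth_cat size_map; case: ltnP => j1.
  by rewrite !(nth_map [::]) // /word_vec ltnNge leq_addr /= addKn.
rewrite !(nth_map [::]) ?size_drows ?ltn_subLR //.
by rewrite /cell_vec ltnNge leq_addr /= addKn.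
Qed.

Lemma perpP u B :
  perp q u B <-> forall j, (j < size B)%N -> dot q u (nth (fun=> 0) B j) = 0.
Proof.
elim: B => //= v B [IH1 IH2]; split; first by move=> [uv /IH1 uB] [|j] // jB; apply: uB.
by move=> h; split; [apply: (h 0%N)|apply: IH2 => j jB; apply: (h j.+1)].
Qed.

(** The forms come in blocks: the coordinates of [d z], those of [F phi z - d c], and the inner
    products with the coboundaries. Freeness of the words makes the first block equivalent to
    [d z = 0]. *)
Lemma condP u : (forall j, (j < L)%N -> cond u j = 0) <->
  cone_closed u /\ perp q u exact_vecs.
Proof.
have sB : size exact_vecs = (N1 + rank C m)%N.
  by rewrite size_cat size_map [size (map _ (drows C m))]size_map size_drows.
split=> [h|[[dz Fz] /perpP o] j].
  split; first split.
  - rewrite cond_diff big1 // => j _; rewrite h ?scale0r //.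
    by rewrite (leq_trans (ltn_ord j)) ?leq_addr.
  - apply/eqP; rewrite -subr_eq0; apply/eqP.
    apply: (hom_ccoord (p := m.+2)); last 1 first.
    + by move=> i; rewrite -cond_cell h ?mcoeff0 // /nconds !ltn_add2l ltn_addr.
    + have h1 : hom m.+2 (F (phi (zval u))).
        by apply: eqF_deg; apply: (dga_fun_deg phi); apply: zval_hom.
      have h2 : hom m.+2 (codiff CQ (cval u)) by apply: codiff_deg; apply: cvec_hom.
      exact: homogB h1 h2.
    + exact: homog0.
  - by apply/perpP => j jB; rewrite -cond_exact -?sB // h // /nconds !ltn_add2l -sB.
have [j3|j3] := ltnP j N3 => jL.
  have z : \sum_(t <- W m.+3) cond u (index t (W m.+3)) *: monomial x t = 0.
    rewrite (big_nth [::]) big_mkord -[RHS]dz cond_diff; apply: eq_bigr => i _.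
    by rewrite index_uniq ?words_uniq.
  have := words_free fx dpos z (mem_nth [::] j3).
  by rewrite index_uniq ?words_uniq.
move: jL; rewrite -(subnKC j3); set l := (j - _)%N; rewrite /nconds ltn_add2l.
have [l2 _|l2] := ltnP l (rank C m.+2).
  by rewrite (cond_cell u (Ordinal l2)) Fz subrr mcoeff0.
by rewrite -(subnKC l2) ltn_add2l => h; rewrite cond_exact // o ?sB.
Qed.

Local Notation hb := (harmonic F k deg dp img m).

Lemma harmonic_closed c :
  cone_closed (lincomb c hb) /\ perp q (lincomb c hb) exact_vecs.
Proof.
apply/condP => j jL.
exact: (kernel_basis_val size_cone_vals c jL).
Qed.

(** An exact harmonic vector is orthogonal to itself, hence zero, and the kernel basis is
    independent. *)
Lemma harmonic_free c : cone_exact (lincomb c hb) -> forall i, (i < size hb)%N -> c i = 0.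
Proof.
move=> /exact_in_comb [b hb']; apply: (kernel_basis_free size_cone_vals) => j jq.
apply: (dot_eq0 (q := q)) jq; rewrite -[RHS](perp_comb b (harmonic_closed c).2).
by apply: eq_bigr => l _; rewrite [X in _ * X]hb'.
Qed.

(** Subtracting from a closed vector its projection onto the coboundaries leaves a closed vector
    orthogonal to them, that is, a harmonic one. *)
Lemma harmonic_span u : cone_closed u -> exists c, cone_exact (fun i => u i + -1 * lincomb c hb i).
Proof.
move=> cu; have [b ob] := perp_decomp q exact_vecs u.
have eb : cone_exact (comb b exact_vecs) by apply: comb_exact; apply: exact_vecs_exact.
have cv := closed_lin (-1) cu (exact_closed eb).
pose u' j := u j - comb b exact_vecs j.
have uu' : (fun j => u j + -1 * comb b exact_vecs j) =1 u' by move=> j; rewrite mulN1r.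
have cu' : cone_closed u' by rewrite /cone_closed -(eq_zval uu') -(eq_cval uu').
have /condP vu := conj cu' ob.
have [c cE] := kernel_basis_span size_cone_vals vu.
have uE j : (j < q)%N -> u j + -1 * lincomb c hb j = comb b exact_vecs j.
  by move=> jq; rewrite -[lincomb c hb j](cE j jq) mulN1r /u' subKr.
exists c; case: eb => [y [e [h1 h2 h3 h4]]]; exists y, e; split => //.
  rewrite -h3; apply: eq_bigr => i _; rewrite uE //.
  by rewrite (leq_trans (ltn_ord i)) ?leq_addr.
by rewrite -h4; apply: eq_cvec => i ir; rewrite uE // ltn_add2l.
Qed.

End Step.

(** * Adjoining generators of one degree *)

Lemma sum_iota (V : nmodType) n (f : nat -> V) : \sum_(i <- iota 0 n) f i = \sum_(i < n) f i.
Proof. by rewrite -(big_mkord xpredT f) /index_iota subn0. Qed.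

Section StepTheorem.

Variables (X : cochain) (A : dga) (C : eff_cochain).
Variables (r1 : reduction X A) (r2 : reduction X (rationalization C)).
Local Notation CQ := (rationalization C).
Local Notation F := (eqF r1 r2).
Local Notation G := (eqG r1 r2).
Local Notation H := (eqH r1 r2).
Variables (k : nat) (deg : nat -> nat) (dp : nat -> seq (rat * word)) (m : nat).
Variables (M : dga) (phi : dga_mor M A) (x : nat -> dga_alg M).
Hypothesis fx : wfree k deg x.
Hypothesis deg2 : forall i, (i < k)%N -> (2 <= deg i <= m)%N.
Hypothesis hdp : forall i, (i < k)%N -> pwf k deg (deg i).+1 (dp i).
Hypothesis dx : forall i, (i < k)%N -> dga_diff M (x i) = poly_eval x (dp i).
Hypothesis m_gt0 : (0 < m)%N.
Hypothesis phi_iso : n_quasi_iso m (phi : M -> A).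

Let img i := phi (x i).
Local Notation hb := (harmonic F k deg dp img m).
Local Notation r := (size hb).
Local Notation zv := (zval k deg m x).
Local Notation cv := (cval C k deg m).
Local Notation v j := (nth 0 (nth [::] hb j)).

Let aj j : A := G (cv (v j)) + H (phi (zv (v j))).

Lemma lincomb_zval c : zv (lincomb c hb) = \sum_(j < r) c j *: zv (v j).
Proof.
rewrite /zval; under [RHS]eq_bigr do rewrite scaler_sumr.
rewrite exchange_big; apply: eq_bigr => i _; rewrite lincombE scaler_suml.
by apply: eq_bigr => j _; rewrite scalerA.
Qed.

Lemma lincomb_cval c : cv (lincomb c hb) = \sum_(j < r) c j *: cv (v j).
Proof.
rewrite /cval /cvec; under [RHS]eq_bigr do rewrite scaler_sumr.
rewrite exchange_big; apply: eq_bigr => i _; rewrite lincombE scaler_suml.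
by apply: eq_bigr => j _; rewrite scalerA.
Qed.

Lemma v_closed j : (j < r)%N -> dga_diff M (zv (v j)) = 0 /\
  F (phi (zv (v j))) = codiff CQ (cv (v j)).
Proof.
move=> jr; have [] := harmonic_closed r1 r2 phi fx deg2 hdp dx (fun i => (i == j)%:R).
have e : lincomb (fun i => (i == j)%:R) hb =1 v j.
  move=> i; rewrite lincombE (bigD1 (Ordinal jr)) //= eqxx mul1r big1 ?addr0 // => l lj.
  by rewrite -val_eqE /= in lj; rewrite (negPf lj) mul0r.
by rewrite /cone_closed (eq_zval _ _ _ _ e) (eq_cval _ _ _ _ e).
Qed.

Let FD (a b : A) : F (a + b) = F a + F b.
Proof. by have := eqF_lin r1 r2 1 a b; rewrite !scale1r. Qed.

Let F0 : F 0 = 0.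
Proof. by have := eqF_lin r1 r2 (-1) 0 0; rewrite !scaleN1r !addNr. Qed.

Let FZ c (a : A) : F (c *: a) = c *: F a.
Proof. by have := eqF_lin r1 r2 c a 0; rewrite F0 !addr0. Qed.

Let FB (a b : A) : F (a - b) = F a - F b.
Proof. by rewrite FD -scaleN1r FZ scaleN1r. Qed.

Let F_sum (I : Type) (s : seq I) (h : I -> A) : F (\sum_(i <- s) h i) = \sum_(i <- s) F (h i).
Proof. by elim: s => [|i s IH]; rewrite ?big_nil ?big_cons ?FD ?IH. Qed.

Lemma aj_deg j : (j < r)%N -> hom m.+1 (aj j).
Proof.
move=> jr; apply: homogD; first by apply: eqG_deg; apply: cvec_hom.
by apply: eqH_deg; apply: (dga_fun_deg phi); apply: (zval_hom fx deg2).
Qed.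

Lemma aj_d j : (j < r)%N -> codiff A (aj j) = phi (zv (v j)).
Proof.
move=> jr; have [dz Fz] := v_closed jr; rewrite /aj codiffD -eqG_d -Fz eqGF.
have -> : codiff A (phi (zv (v j))) = 0.
  by rewrite -(dga_fun_d phi) [codiff M _]dz linear0.
have -> : H 0 = 0 by have := eqH_lin r1 r2 (-1) 0 0; rewrite !scaleN1r !addNr.
by rewrite addr0 subrK.
Qed.

(** The image of a generator remembers the second component of its cone cocycle, up to a coboundary.
    Both assertions about degree m+1 rest on this. *)
Lemma aj_F j : (j < r)%N -> exists2 e, hom m e & F (aj j) = cv (v j) + codiff CQ e.
Proof.
move=> jr; have [dz Fz] := v_closed jr; apply: eqF_lift => //.
- exact: cvec_hom.
- by apply: (dga_fun_deg phi); apply: (zval_hom fx deg2).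
- by rewrite -(dga_fun_d phi) [codiff M _]dz linear0.
Qed.

Variables (deg' : nat -> nat).
Hypothesis degE : forall i, (i < k)%N -> deg i = deg' i.
Hypothesis degN : forall j, (j < r)%N -> deg' (k + j)%N = m.+1.

(** Every letter has degree at least 2 and a new one has degree m+1, so any further letter would
    push the degree beyond m+2. *)
Lemma word_case t : all (gtn (k + r)) t -> (wdeg deg' t <= m.+2)%N ->
  all (gtn k) t \/ wdeg deg' t = m.+1 /\ exists2 j, (j < r)%N & t = [:: (k + j)%N].
Proof.
have d2 i : (i < k + r)%N -> (2 <= deg' i)%N.
  have [ik _|ki ikr] := ltnP i k; first by rewrite -degE //; have /andP[] := deg2 ik.
  by rewrite -(subnKC ki) degN // ltn_subLR.
have d0 s : all (gtn (k + r)) s -> (wdeg deg' s <= 1)%N -> s = [::].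
  by case: s => // i s /andP[ikr _]; rewrite wdeg_cons; have := d2 _ ikr; lia.
elim: t => [|i t IH]; first by left.
move=> /= /andP[ikr tk]; rewrite wdeg_cons => le2; have i2 := d2 _ ikr.
have [ik|ki] := ltnP i k.
  have [|tk'|[td _]] := IH tk; first by lia.
    by left.
  by move: le2; rewrite td; lia.
have iE : deg' i = m.+1 by rewrite -(subnKC ki) degN // ltn_subLR.
have t0 : t = [::] by apply: d0 => //; lia.
right; rewrite t0 iE addn0; split=> //; exists (i - k)%N; first by rewrite ltn_subLR.
by rewrite subnKC.
Qed.

Variables (M' : dga) (iota : dga_mor M M') (phi' : dga_mor M' A) (x' : nat -> dga_alg M').
Hypothesis fx' : wfree (k + r) deg' x'.
Hypothesis phi'E : forall b, phi' (iota b) = phi b.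
Hypothesis iota_inj : forall b, iota b = 0 -> b = 0.
Hypothesis x'E : forall i, (i < k)%N -> x' i = iota (x i).
Hypothesis x'N : forall j, (j < r)%N ->
  dga_diff M' (x' (k + j)%N) = iota (zv (v j)) /\ phi' (x' (k + j)%N) = aj j.

Definition new_sum (c : nat -> rat) := \sum_(j < r) c j *: x' (k + j)%N.

Lemma new_sum_hom c : hom m.+1 (new_sum c : M').
Proof.
apply: homog_sum => j _; apply: homogZ; rewrite -(degN (ltn_ord j)).
by case: fx' => h _ _; apply: h; rewrite ltn_add2l.
Qed.

Lemma new_sum_d (c : nat -> rat) : dga_diff M' (new_sum c) = iota (\sum_(j < r) c j *: zv (v j)).
Proof.
rewrite /new_sum !linear_sum; apply: eq_bigr => j _.
by rewrite !linearZ /= (x'N (ltn_ord j)).1.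
Qed.

Lemma new_sum_phi (c : nat -> rat) : phi' (new_sum c) = \sum_(j < r) c j *: aj j.
Proof.
rewrite /new_sum linear_sum; apply: eq_bigr => j _.
by rewrite linearZ /= (x'N (ltn_ord j)).2.
Qed.

Lemma new_sum_F (c : nat -> rat) : exists2 e, hom m e &
  F (\sum_(j < r) c j *: aj j) = cv (lincomb c hb) + codiff CQ e.
Proof.
rewrite lincomb_cval F_sum.
elim/big_ind2: _ => [|a a' b b' [e he ->] [e' he' ->]|j _].
- by exists 0; [apply: homog0|rewrite codiff0 addr0].
- by exists (e + e'); [apply: homogD|rewrite codiffD addrACA].
have [e he fe] := aj_F (ltn_ord j).
by exists (c j *: e); [apply: homogZ|rewrite FZ fe scalerDr codiffZ].
Qed.

(** Up to degree m+2 the extension therefore adds nothing but linear combinations of the new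
    generators. *)
Lemma hom_decomp p (a : M') : (p <= m.+2)%N -> hom p a -> exists (y : M) (c : nat -> rat),
  [/\ hom p y, a = iota y + new_sum c & p != m.+1 -> forall j, c j = 0].
Proof.
move=> pm ha.
have dpos i : (i < k + r)%N -> (0 < deg' i)%N.
  have [ik _|ki ikr] := ltnP i k.
    by rewrite -degE //; have /andP[/ltnW] := deg2 ik.
  by rewrite -(subnKC ki) degN // ltn_subLR.
have [c ->] := wfree_hom fx' dpos ha; rewrite big_seq.
elim/big_ind: _ => [|a1 a2 [y1 [c1 [h1 -> z1]]] [y2 [c2 [h2 -> z2]]]|t tW].
- exists 0, (fun=> 0); split; [exact: homog0| |by []].
  by rewrite linear0 add0r /new_sum big1 // => j _; rewrite scale0r.
- exists (y1 + y2), (fun j => c1 j + c2 j); split; first exact: homogD.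
    rewrite linearD addrACA; congr (_ + _); rewrite /new_sum -big_split.
    by apply: eq_bigr => j _; rewrite scalerDl.
  by move=> pm1 j; rewrite z1 // z2 // addr0.
move: tW; rewrite mem_words // => /andP[/andP[tk _] /eqP tp].
have tle : (wdeg deg' t <= m.+2)%N by rewrite tp.
have [tk'|[td [j jr tE]]] := word_case tk tle.
- exists (c t *: monomial x t), (fun=> 0); split; last by [].
    apply: homogZ; rewrite -tp -(eq_wdeg degE tk').
    by case: fx => h _ _; apply: monomial_hom tk'.
  rewrite /new_sum [X in _ + X]big1 ?addr0; last by move=> j _; rewrite scale0r.
  rewrite linearZ /= monomial_map; congr (_ *: _).
  by apply: eq_monomial => i /(allP tk') /= /x'E.
exists 0, (fun i => c t * (i == j)%:R); split; first exact: homog0.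
  rewrite linear0 add0r /new_sum (bigD1 (Ordinal jr)) //= eqxx mulr1 big1 ?addr0.
    by rewrite tE monomial_cons monomial0 mulr1.
  move=> i ij; rewrite -val_eqE /= in ij.
  by rewrite (negPf ij) mulr0 scale0r.
by rewrite -tp td eqxx.
Qed.

Lemma iota_cocycle (y : M) : codiff M' (iota y) = 0 -> codiff M y = 0.
Proof. by rewrite -(dga_fun_d iota) => /iota_inj. Qed.

Lemma iota_coboundary p (y : M) : coboundary p y -> coboundary p (iota y : M').
Proof.
case: p => [|p] /=; first by move=> ->; rewrite linear0.
by move=> [w hw ->]; exists (iota w); [apply: dga_fun_deg|apply: (dga_fun_d iota)].
Qed.

Lemma hom_old p (a : M') : (p <= m.+2)%N -> p != m.+1 -> hom p a ->
  exists2 y : M, hom p y & a = iota y.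
Proof.
move=> pm pm1 ha; have [y [c [hy -> /(_ pm1) c0]]] := hom_decomp pm ha.
exists y => //; rewrite /new_sum big1 ?addr0 // => j _.
by rewrite c0 scale0r.
Qed.

Lemma step_inj_old p : (p <= m)%N -> cohom_inj (phi' : M' -> A) p.
Proof.
move=> pm a [ha da] ca.
have pm2 : (p <= m.+2)%N by lia.
have pm1 : p != m.+1 by lia.
have [y hy ay] := hom_old pm2 pm1 ha.
rewrite ay; apply: iota_coboundary; have [/(_ p pm) [inj _] _] := phi_iso.
apply: inj; last by rewrite -phi'E -ay.
by split=> //; apply: iota_cocycle; rewrite -ay.
Qed.

Lemma step_surj_old p : (p <= m)%N -> cohom_surj (phi' : M' -> A) p.
Proof.
move=> pm b hb'; have [/(_ p pm) [_ surj] _] := phi_iso.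
have [y [hy dy] yb] := surj b hb'; exists (iota y); last by rewrite phi'E.
split; first exact: dga_fun_deg.
by rewrite -(dga_fun_d iota) dy linear0.
Qed.

(** Write the cocycle as an old element plus a combination of new generators. If its image bounds,
    the same combination of harmonic vectors is exact, hence trivial; the cocycle is then old, and
    [phi] is injective in degree m+1. *)
Lemma step_inj_new : cohom_inj (phi' : M' -> A) m.+1.
Proof.
move=> a [ha da] [b hb' db].
have [y [c [hy ay _]]] := hom_decomp (leqnSn _) ha.
have dy : dga_diff M y = - \sum_(j < r) c j *: zv (v j).
  apply/eqP; rewrite -addr_eq0; apply/eqP; apply: iota_inj.
  rewrite linearD /= -new_sum_d -[RHS]da ay codiffD; congr (_ + _).
  exact: (dga_fun_d iota).
have py : phi y + \sum_(j < r) c j *: aj j = codiff A b.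
  by rewrite -db ay linearD /= phi'E new_sum_phi.
have [e he Fe] := new_sum_F c.
have ex : cone_exact r1 r2 k deg m phi x (lincomb c hb).
  (* By [dy] the first component bounds [- y]. Applying [F] to [py] expresses the second one as
     [- F phi y + d (F b - e)]. *)
  exists (- y), (F b - e); split.
  - exact: homogN.
  - have hFb : hom m (F b) by apply: eqF_deg.
    exact: homogB hFb he.
  - by rewrite linearN dy opprK lincomb_zval.
  have := congr1 F py; rewrite FD Fe eqF_d => h.
  have -> : F (phi (- y)) = - F (phi y).
    by rewrite linearN -[- phi y]scaleN1r FZ scaleN1r.
  rewrite -[F b - e]addrC codiffD -h -[- e]scaleN1r codiffZ scaleN1r.
  by rewrite [- codiff CQ e + _]addrCA addKr addrC addrK.
have c0 := harmonic_free fx deg2 hdp dx ex.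
have y0 : \sum_(j < r) c j *: zv (v j) = 0.
  by apply: big1 => j _; rewrite c0 // scale0r.
have a0 : \sum_(j < r) c j *: aj j = 0.
  by apply: big1 => j _; rewrite c0 // scale0r.
have aE : a = iota y.
  rewrite ay /new_sum big1 ?addr0 // => j _; by rewrite c0 // scale0r.
rewrite aE; apply: iota_coboundary; have [_ inj] := phi_iso.
apply: inj; first by split=> //; rewrite -[LHS]/(dga_diff M y) dy y0 oppr0.
by exists b => //; rewrite -py a0 addr0.
Qed.

(** In degree m+2 a cocycle is an old [y]; if its image is [d b], then [(y, F b)] is a cone cocycle.
    Modulo coboundaries it is harmonic, and the harmonic part has become exact through the new
    generators. *)
Lemma step_inj_next : cohom_inj (phi' : M' -> A) m.+2.
Proof.
move=> a [ha da] [b hb' db].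
have pm1 : m.+2 != m.+1 by lia.
have [y hy ay] := hom_old (leqnn _) pm1 ha.
have dy : dga_diff M y = 0 by apply: iota_cocycle; rewrite -ay.
have [u [zu cu]] := coords_surj (C := C) (c := F b) fx deg2 hy (eqF_deg r1 r2 hb').
have cl : cone_closed r1 r2 k deg m phi x u.
  split; first by rewrite zu.
  by rewrite zu cu -eqF_d -db ay phi'E.
have [c [y' [e [hy' he zy _]]]] := harmonic_span fx deg2 hdp dx cl.
exists (iota y' + new_sum c); first by apply: homogD (new_sum_hom c); apply: dga_fun_deg.
rewrite codiffD [codiff M' (new_sum c)]new_sum_d -(dga_fun_d iota) -[codiff M y']zy.
rewrite -linearD -lincomb_zval zval_lin zu ay; congr (iota _).
by rewrite scaleN1r subrK.
Qed.

(** A cocycle [b] gives the cone cocycle [(0, F b)]. Its harmonic part together with the coboundary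
    correction defines a cocycle [w] of the extension. *)
Lemma step_surj_new : cohom_surj (phi' : M' -> A) m.+1.
Proof.
move=> b [hb' db].
have [u [zu cu]] := coords_surj (C := C) (c := F b) fx deg2 (homog0 (dga_grading M) m.+2)
  (eqF_deg r1 r2 hb').
have cl : cone_closed r1 r2 k deg m phi x u.
  split; first by rewrite zu linear0.
  by rewrite zu cu -eqF_d db linear0.
have [c [y' [e [hy' he zy cy]]]] := harmonic_span fx deg2 hdp dx cl.
pose w : M' := iota y' + new_sum c.
have hw : hom m.+1 w by apply: homogD (new_sum_hom c); apply: dga_fun_deg.
have dw : codiff M' w = 0.
  rewrite codiffD [codiff M' (new_sum c)]new_sum_d -(dga_fun_d iota) -[codiff M y']zy.
  rewrite -linearD -lincomb_zval zval_lin zu add0r scaleN1r addNr.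
  exact: linear0.
exists w => //.
have [e2 he2 Fe2] := new_sum_F c.
(* [F t] turns out to be a coboundary; since [G F] is homotopic to the identity, so is [t]. *)
pose t : A := b - phi' w.
have ht : hom m.+1 t by apply: homogB => //; apply: (dga_fun_deg phi').
have dt : codiff A t = 0.
  rewrite /t -scaleN1r codiffD db codiffZ -(dga_fun_d phi') dw.
  by rewrite linear0 scaler0 addr0.
have Ft : F t = codiff CQ (e - e2).
  have pw : phi' w = phi y' + \sum_(j < r) c j *: aj j.
    by rewrite /w linearD /= phi'E new_sum_phi.
  rewrite /t FB pw FD Fe2 -cu.
  move: cy; rewrite cval_lin scaleN1r => /eqP; rewrite subr_eq => /eqP ->.
  rewrite -[- e2]scaleN1r codiffD codiffZ scaleN1r.
  by rewrite -[_ + _ + cv _]addrA opprD addrACA subrr add0r opprD addrA addrK.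
exists (G (e - e2) + H t).
  apply: homogD; first by apply: eqG_deg; apply: homogB.
  exact: eqH_deg.
have := eqGF r1 r2 t; rewrite Ft dt eqG_d codiffD => ->.
have -> : H 0 = 0 by have := eqH_lin r1 r2 (-1) 0 0; rewrite !scaleN1r !addNr.
by rewrite addr0 subrK.
Qed.

Lemma step_quasi_iso : n_quasi_iso m.+1 (phi' : M' -> A).
Proof.
split; last exact: step_inj_next.
move=> j; rewrite leq_eqVlt => /orP[/eqP->|].
  by split; [apply: step_inj_new|apply: step_surj_new].
by rewrite ltnS => jm; split; [apply: step_inj_old|apply: step_surj_old].
Qed.

End StepTheorem.

(** * Programs *)

(** Total correctness: each rule below also proves termination. *)
Definition runs (e : seq val) (t : tm) (Q : val -> Prop) : Prop :=
  exists2 v, eval e t v & Q v.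

Definition appv (f u v : val) : Prop := exists e b, f = VClos e b /\ eval (u :: e) b v.

(** The function clause of a logical relation on values, again with termination. *)
Definition arr (P Q : val -> Prop) (f : val) : Prop :=
  forall u, P u -> exists2 v, appv f u v & Q v.

Section Rules.

Variable e : seq val.
Implicit Types (P Q : val -> Prop).

Lemma runs_sub t P Q : runs e t P -> (forall v, P v -> Q v) -> runs e t Q.
Proof. by move=> [v ev pv] PQ; exists v; last exact: PQ. Qed.

Lemma runs_var k v Q : onth e k = Some v -> Q v -> runs e (Var k) Q.
Proof. by move=> ek qv; exists v => //; apply: EVar. Qed.

Lemma runs_clos t : runs e (Lam t) (eq (VClos e t)).
Proof. by exists (VClos e t) => //; apply: ELam. Qed.

Lemma runs_lam t P Q : (forall u, P u -> runs (u :: e) t Q) -> runs e (Lam t) (arr P Q).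
Proof.
move=> h; exists (VClos e t); first exact: ELam.
by move=> u /h [v ev qv]; exists v => //; exists e, t.
Qed.

(** The closure exists before [x] is given, so one value meets all the specifications; this serves
    recursions that return functions. *)
Lemma runs_lam_all T t (R : T -> val -> Prop) (Q : T -> val -> Prop) :
  (forall x u, R x u -> runs (u :: e) t (Q x)) ->
  runs e (Lam t) (fun f => forall x, arr (R x) (Q x) f).
Proof.
move=> h; exists (VClos e t); first exact: ELam.
by move=> x u /h [v ev qv]; exists v => //; exists e, t.
Qed.

Lemma runs_app s t P Q : runs e s (arr P Q) -> runs e t P -> runs e (App s t) Q.
Proof.
move=> [f ef hf] [u eu /hf [v [e' [b [fE ev]]] qv]]; exists v => //.
by rewrite fE in ef; apply: EApp ef eu ev.
Qed.

(** The closure is known literally, so its body can be verified afresh for each specification of the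
    argument. *)
Lemma runs_app_clos s t e' b P Q : runs e s (eq (VClos e' b)) -> runs e t P ->
  (forall u, P u -> runs (u :: e') b Q) -> runs e (App s t) Q.
Proof.
move=> [f ef fE] [u eu pu] h; have [v ev qv] := h u pu; exists v => //; subst f.
exact: EApp ef eu ev.
Qed.

(** The programs of the input are known only through [call]; inverting it exposes a closure, which
    can then be applied in any environment. *)
Lemma runs_call f t w P Q : runs e f (eq w) -> runs e t P ->
  (forall v, P v -> exists2 u, call w v u & Q u) -> runs e (App f t) Q.
Proof.
move=> [w' ew ww] [v ev pv] /(_ v pv) [u cu qu]; exists u => //; subst w'.
inversion cu; subst.
match goal with H : eval _ (Var 0) _ |- _ => inversion H; subst end.
match goal with H : eval _ (Var 1) _ |- _ => inversion H; subst end.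
repeat match goal with H : onth _ _ = Some _ |- _ => simpl in H; injection H; clear H; intros; subst end.
by apply: EApp ew ev _; eassumption.
Qed.

Lemma runs_let s t P Q : runs e s P -> (forall u, P u -> runs (u :: e) t Q) ->
  runs e (App (Lam t) s) Q.
Proof. by move=> hs ht; apply: runs_app_clos (runs_clos t) hs ht. Qed.

Definition Rq (a : rat) (v : val) : Prop := v = VNum a.
Definition Rnat (n : nat) (v : val) : Prop := v = vnat n.
Definition Rbool (b : bool) (v : val) : Prop := v = VNum b%:R.

Lemma runs_num a : runs e (Num a) (Rq a).
Proof. by exists (VNum a) => //; apply: ENum. Qed.

Lemma runs_op o s t a b : runs e s (Rq a) -> runs e t (Rq b) ->
  runs e (Op o s t) (Rq (arith_sem o a b)).
Proof.
move=> [u eu uE] [v ev vE]; rewrite uE in eu; rewrite vE in ev.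
by exists (VNum (arith_sem o a b)) => //; apply: EOp.
Qed.

Lemma runs_pair s t P Q : runs e s P -> runs e t Q ->
  runs e (Pair s t) (fun v => exists u w, [/\ v = VPair u w, P u & Q w]).
Proof.
by move=> [u eu pu] [w ew qw]; exists (VPair u w); [apply: EPair|exists u, w].
Qed.

Lemma runs_fst t Q : runs e t (fun v => exists u w, v = VPair u w /\ Q u) -> runs e (Fst t) Q.
Proof. by move=> [v ev [u [w [vE qu]]]]; exists u => //; subst v; apply: EFst ev. Qed.

Lemma runs_snd t Q : runs e t (fun v => exists u w, v = VPair u w /\ Q w) -> runs e (Snd t) Q.
Proof. by move=> [v ev [u [w [vE qu]]]]; exists w => //; subst v; apply: ESnd ev. Qed.

Lemma runs_isnum t P : runs e t P ->
  runs e (IsNum t) (fun v => exists2 u, P u & v = VNum (is_num u)%:R).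
Proof. by move=> [v ev pv]; exists (VNum (is_num v)%:R); [apply: EIsNum|exists v]. Qed.

Lemma runs_ifz c s t a Q : runs e c (Rq a) -> (a = 0 -> runs e s Q) ->
  (a <> 0 -> runs e t Q) -> runs e (Ifz c s t) Q.
Proof.
move=> [v ev vE] hs ht; rewrite vE in ev.
have [a0|/eqP a0] := eqVneq a 0.
  have [w ew qw] := hs a0; exists w => //; apply: EIfz ev _.
  by rewrite a0 eqxx.
have [w ew qw] := ht a0; exists w => //; apply: EIfz ev _.
by move/eqP/negPf: a0 => ->.
Qed.

End Rules.

(** * Lists, recursion and iteration *)

Section Lists.

(** Programs detect the empty list by [IsNum]. [R] need not be functional, as an element may have
    many names. *)
Fixpoint Rseq T (R : T -> val -> Prop) (s : seq T) (v : val) : Prop :=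
  if s is x :: s' then exists u w, [/\ v = VPair u w, R x u & Rseq R s' w]
  else v = VNum 0.

Definition Rpair T1 T2 (R1 : T1 -> val -> Prop) (R2 : T2 -> val -> Prop) (p : T1 * T2) v :=
  exists u w, [/\ v = VPair u w, R1 p.1 u & R2 p.2 w].

Lemma Rseq_sub T (R R' : T -> val -> Prop) s v :
  (forall x u, List.In x s -> R x u -> R' x u) -> Rseq R s v -> Rseq R' s v.
Proof.
elim: s v => //= x s IH v h [u [w [-> xu sw]]]; exists u, w; split => //.
  by apply: h => //; left.
by apply: IH sw => y z ys; apply: h; right.
Qed.

Lemma Rseq_mem (T : eqType) (R R' : T -> val -> Prop) s v :
  (forall x u, x \in s -> R x u -> R' x u) -> Rseq R s v -> Rseq R' s v.
Proof.
elim: s v => //= x s IH v h [u [w [-> xu sw]]]; exists u, w; split => //.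
  by apply: h => //; apply: mem_head.
by apply: IH sw => y z ys; apply: h; rewrite in_cons ys orbT.
Qed.

Lemma Rseq_map T T' (f : T -> T') (R : T' -> val -> Prop) s v :
  Rseq R (map f s) v <-> Rseq (fun x => R (f x)) s v.
Proof.
elim: s v => //= x s IH v.
by split=> -[u [w [-> h /IH h']]]; exists u, w.
Qed.

Lemma Rseq_vseq T (enc : T -> val) s v :
  Rseq (fun x u => u = enc x) s v <-> v = vseq (map enc s).
Proof.
elim: s v => //= x s IH v; split=> [[u [w [-> -> /IH->]]]|->] //.
by exists (enc x), (vseq (map enc s)); split => //; apply/IH.
Qed.

Section WithEnv.
Variable e : seq val.

Lemma runs_nil T (R : T -> val -> Prop) : runs e (Num 0) (Rseq R [::]).
Proof. exact: runs_num. Qed.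

Lemma runs_cons T (R : T -> val -> Prop) x s t1 t2 : runs e t1 (R x) ->
  runs e t2 (Rseq R s) -> runs e (Pair t1 t2) (Rseq R (x :: s)).
Proof. exact: runs_pair. Qed.

Lemma runs_Rpair T1 T2 (R1 : T1 -> val -> Prop) (R2 : T2 -> val -> Prop) x y t1 t2 :
  runs e t1 (R1 x) -> runs e t2 (R2 y) -> runs e (Pair t1 t2) (Rpair R1 R2 (x, y)).
Proof. exact: runs_pair. Qed.

Lemma runs_Rfst T1 T2 (R1 : T1 -> val -> Prop) (R2 : T2 -> val -> Prop) p t :
  runs e t (Rpair R1 R2 p) -> runs e (Fst t) (R1 p.1).
Proof.
by move=> h; apply: runs_fst; apply: runs_sub h _ => v [u [w [-> ? _]]]; exists u, w.
Qed.

Lemma runs_Rsnd T1 T2 (R1 : T1 -> val -> Prop) (R2 : T2 -> val -> Prop) p t :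
  runs e t (Rpair R1 R2 p) -> runs e (Snd t) (R2 p.2).
Proof.
by move=> h; apply: runs_snd; apply: runs_sub h _ => v [u [w [-> _ ?]]]; exists u, w.
Qed.

End WithEnv.

(* Recursion is obtained by self-application: [Var 1] is the recursive function
   itself, to be applied to itself first. *)
Definition crec : tm :=
  Lam (Lam (App (Lam (App (Var 0) (Var 0)))
    (Lam (Lam (Ifz (IsNum (Var 0))
      (App (App (App (Var 3) (Fst (Var 0))) (Snd (Var 0)))
         (App (App (Var 1) (Var 1)) (Snd (Var 0))))
      (Var 2)))))).

(* [body] is evaluated with the result on the tail, the tail and the head. *)
Definition trec (body z l : tm) : tm :=
  App (App (App crec (Lam (Lam (Lam body)))) z) l.

(** [Q] is an invariant on the suffixes of [s]. The body is verified for every value related to the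
    head, as values are not determined by what they represent. *)
Lemma runs_rec T (R : T -> val -> Prop) e body z l s (Q : seq T -> val -> Prop) :
  runs e l (Rseq R s) -> runs e z (Q [::]) ->
  (forall x s' u us r, R x u -> Rseq R s' us -> Q s' r ->
     runs (r :: us :: u :: e) body (Q (x :: s'))) ->
  runs e (trec body z l) (Q s).
Proof.
move=> hl [vz ez qz] hb.
pose b0 := Ifz (IsNum (Var 0))
      (App (App (App (Var 3) (Fst (Var 0))) (Snd (Var 0)))
         (App (App (Var 1) (Var 1)) (Snd (Var 0))))
      (Var 2).
pose F := VClos e (Lam (Lam body)).
pose W := VClos [:: vz, F & e] (Lam b0).
have hF x u s' us r : R x u -> Rseq R s' us -> Q s' r ->
    exists2 v, eval (r :: us :: u :: e) body v & Q (x :: s') v by apply: hb.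
suff hW s' us : Rseq R s' us -> exists2 v, eval [:: us, W, vz, F & e] b0 v & Q s' v.
  case: hl => ul el rl; have [v ev qv] := hW _ _ rl; exists v => //.
  apply: EApp el ev; apply: EApp ez _; first by apply: EApp (ELam _ _) (ELam _ _) (ELam _ _).
  by apply: EApp (ELam _ _) (ELam _ _) _; apply: EApp (EVar _) (EVar _) (ELam _ _).
elim: s' us => [|x s' IH] us /=.
  move=> ->; exists vz => //; apply: (EIfz (a := 1)); last exact: EVar.
  by apply: (EIsNum (v := VNum 0)); apply: EVar.
move=> [u [w [-> hu hw]]]; have [r er qr] := IH _ hw.
have [v ev qv] := hF x u s' w r hu hw qr.
exists v => //; apply: (EIfz (a := 0)).
  by apply: (EIsNum (v := VPair u w)); apply: EVar.
rewrite eqxx.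
set E := [:: VPair u w, _, _, _ & _].
have e0 : eval E (Var 0) (VPair u w) by apply: EVar.
apply: EApp ev.
  apply: EApp (ELam _ _); last exact: ESnd e0.
  apply: EApp (ELam _ _); last exact: EFst e0.
  exact: EVar.
apply: EApp er; last exact: ESnd e0.
by apply: EApp (ELam _ _); apply: EVar.
Qed.

(** Iteration by the same self-application; it stops only at zero, so the count must be a natural
    number. *)
Definition citer : tm :=
  Lam (Lam (App (Lam (App (Var 0) (Var 0)))
    (Lam (Lam (Ifz (Var 0) (Var 2)
      (App (App (Var 3) (Op OSub (Var 0) (Num 1)))
         (App (App (Var 1) (Var 1)) (Op OSub (Var 0) (Num 1))))))))).

(* [body] is evaluated with the previous result and the index. *)
Definition titer (body z n : tm) : tm :=
  App (App (App citer (Lam (Lam body))) z) n.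

Lemma runs_iter e body z t n (Q : nat -> val -> Prop) :
  runs e t (Rnat n) -> runs e z (Q 0%N) ->
  (forall i r, (i < n)%N -> Q i r -> runs (r :: vnat i :: e) body (Q i.+1)) ->
  runs e (titer body z t) (Q n).
Proof.
move=> hl [vz ez qz] hb.
pose b0 := Ifz (Var 0) (Var 2)
      (App (App (Var 3) (Op OSub (Var 0) (Num 1)))
         (App (App (Var 1) (Var 1)) (Op OSub (Var 0) (Num 1)))).
pose F := VClos e (Lam body).
pose W := VClos [:: vz, F & e] (Lam b0).
suff hW i : (i <= n)%N -> exists2 v, eval [:: vnat i, W, vz, F & e] b0 v & Q i v.
  case: hl => ul el rl; have [v ev qv] := hW _ (leqnn n); exists v => //.
  rewrite rl in el; apply: EApp el ev; apply: EApp ez _.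
    by apply: EApp (ELam _ _) (ELam _ _) (ELam _ _).
  by apply: EApp (ELam _ _) (ELam _ _) _; apply: EApp (EVar _) (EVar _) (ELam _ _).
elim: i => [|i IH] le_in.
  exists vz => //; apply: (EIfz (a := 0)); exact: EVar.
have [r er qr] := IH (ltnW le_in); have [v ev qv] := hb i r le_in qr.
have sub1 E : eval (vnat i.+1 :: E) (Op OSub (Var 0) (Num 1)) (vnat i).
  have -> : vnat i = VNum (arith_sem OSub i.+1%:R 1).
    by rewrite /= -natr1 addrK.
  by apply: EOp; [apply: EVar|apply: ENum].
exists v => //; apply: (EIfz (a := i.+1%:R)); first exact: EVar.
rewrite pnatr_eq0 /=; apply: EApp ev.
  by apply: EApp (ELam _ _); [apply: EVar|apply: sub1].
by apply: EApp er; [apply: EApp (ELam _ _); apply: EVar|apply: sub1].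
Qed.

End Lists.

Definition let2 (b s t : tm) : tm := App (App (Lam (Lam b)) s) t.
Definition let3 (b s t u : tm) : tm := App (App (App (Lam (Lam (Lam b))) s) t) u.
Definition let4 (b s t u w : tm) : tm := App (let3 (Lam b) s t u) w.

Lemma runs_let2 e b s t P1 P2 Q : runs e s P1 -> runs e t P2 ->
  (forall u v, P1 u -> P2 v -> runs (v :: u :: e) b Q) -> runs e (let2 b s t) Q.
Proof.
move=> h1 h2 hb.
apply: (runs_app (P := P2)) h2; apply: (runs_app (P := P1)) h1.
by apply: runs_lam => u pu; apply: runs_lam => v pv; apply: hb.
Qed.

Lemma runs_let3 e b s t r P1 P2 P3 Q : runs e s P1 -> runs e t P2 -> runs e r P3 ->
  (forall u v w, P1 u -> P2 v -> P3 w -> runs (w :: v :: u :: e) b Q) ->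
  runs e (let3 b s t r) Q.
Proof.
move=> h1 h2 h3 hb.
apply: (runs_app (P := P3)) h3; apply: (runs_app (P := P2)) h2.
apply: (runs_app (P := P1)) h1.
apply: runs_lam => u pu; apply: runs_lam => v pv; apply: runs_lam => w pw.
exact: hb.
Qed.

Lemma runs_let4 e b s t r q P1 P2 P3 P4 Q :
  runs e s P1 -> runs e t P2 -> runs e r P3 -> runs e q P4 ->
  (forall u v w x, P1 u -> P2 v -> P3 w -> P4 x -> runs (x :: w :: v :: u :: e) b Q) ->
  runs e (let4 b s t r q) Q.
Proof.
move=> h1 h2 h3 h4 hb.
apply: (runs_app (P := P4)) h4; apply: (runs_let3 h1 h2 h3) => u v w pu pv pw.
by apply: runs_lam => x px; apply: hb.
Qed.

Ltac rvar := first [exact: runs_num |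
  match goal with |- runs _ (Var _) _ => apply: runs_var; [reflexivity|first [eassumption|reflexivity]] end].

Definition tmap (body l : tm) : tm :=
  let2 (trec (Pair (App (Var 4) (Var 2)) (Var 0)) (Num 0) (Var 0)) (Lam body) l.

Lemma runs_map T T' (R : T -> val -> Prop) (R' : T' -> val -> Prop) e body l s (f : T -> T') :
  runs e l (Rseq R s) -> (forall x u, R x u -> runs (u :: e) body (R' (f x))) ->
  runs e (tmap body l) (Rseq R' (map f s)).
Proof.
move=> hl hb; apply: (runs_let2 (runs_clos e body) hl) => F v <-{F} hv.
apply: (runs_rec (R := R) (Q := fun s => Rseq R' (map f s))).
- by rvar.
- exact: runs_nil.
move=> x s' us u r xu _ hr; apply: runs_cons; last by rvar.
apply: (runs_app_clos (P := R x)); [apply: runs_var; reflexivity|by rvar|exact: hb].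
Qed.

Definition tfilter (body l : tm) : tm :=
  let2 (trec (Ifz (App (Var 4) (Var 2)) (Var 0) (Pair (Var 2) (Var 0))) (Num 0) (Var 0))
    (Lam body) l.

Lemma runs_filter T (R : T -> val -> Prop) e body l s (p : pred T) :
  runs e l (Rseq R s) -> (forall x u, R x u -> runs (u :: e) body (Rbool (p x))) ->
  runs e (tfilter body l) (Rseq R (filter p s)).
Proof.
move=> hl hb; apply: (runs_let2 (runs_clos e body) hl) => F v <-{F} hv.
apply: (runs_rec (R := R) (Q := fun s => Rseq R (filter p s))).
- by rvar.
- exact: runs_nil.
move=> x s' us u r xu _ hr.
apply: (runs_ifz (a := (p x)%:R)).
- by apply: (runs_app_clos (P := R x)); [apply: runs_var; reflexivity|rvar|exact: hb].
- rewrite /=; case: (p x) => // _; by rvar.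
- by rewrite /=; case: (p x) => // _; apply: runs_cons; rvar.
Qed.

Definition tcat (a b : tm) : tm :=
  let2 (trec (Pair (Var 2) (Var 0)) (Var 0) (Var 1)) a b.

Lemma runs_cat T (R : T -> val -> Prop) e a b s1 s2 :
  runs e a (Rseq R s1) -> runs e b (Rseq R s2) -> runs e (tcat a b) (Rseq R (s1 ++ s2)).
Proof.
move=> h1 h2; apply: (runs_let2 h1 h2) => u v hu hv.
apply: (runs_rec (R := R) (Q := fun s => Rseq R (s ++ s2))); [by rvar|by rvar|].
by move=> x s' us w r xu _ hr; apply: runs_cons; rvar.
Qed.

Definition tflatten (l : tm) : tm := trec (tcat (Var 2) (Var 0)) (Num 0) l.

Lemma runs_flatten T (R : T -> val -> Prop) e l ss :
  runs e l (Rseq (Rseq R) ss) -> runs e (tflatten l) (Rseq R (flatten ss)).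
Proof.
move=> hl; apply: (runs_rec (R := Rseq R) (Q := fun s => Rseq R (flatten s))) hl _ _.
  exact: runs_nil.
by move=> x s' us u r xu _ hr; apply: runs_cat; rvar.
Qed.

Definition tlength (l : tm) : tm := trec (Op OAdd (Var 0) (Num 1)) (Num 0) l.

Lemma runs_size T (R : T -> val -> Prop) e l s :
  runs e l (Rseq R s) -> runs e (tlength l) (Rnat (size s)).
Proof.
move=> hl; apply: (runs_rec (R := R) (Q := fun s => Rnat (size s))) hl _ _.
  exact: runs_num.
move=> x s' us u r _ _ hr; rewrite /Rnat /vnat -[size _]/((size s').+1) -natr1.
by apply: (runs_op OAdd (a := (size s')%:R) (b := 1)); rvar.
Qed.

Definition tiota (n : tm) : tm :=
  App (Lam (titer (Pair (Op OSub (Op OSub (Var 2) (Var 1)) (Num 1)) (Var 0)) (Num 0) (Var 0))) n.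

(** The list is built from its last entry down, so the invariant concerns final segments. Entries
    keep their bound, which bodies mapped over the list need for indexing. *)
Lemma runs_iota e t n : runs e t (Rnat n) ->
  runs e (tiota t) (Rseq (fun i v => (i < n)%N /\ Rnat i v) (iota 0 n)).
Proof.
move=> ht; apply: (runs_let ht) => v hv.
have -> : iota 0 n = iota (n - n) n by rewrite subnn.
apply: (runs_iter (Q := fun i => Rseq (fun i v => (i < n)%N /\ Rnat i v) (iota (n - i) i))).
- by rvar.
- exact: runs_nil.
move=> i r lt_in hr.
have -> : iota (n - i.+1) i.+1 = (n - i.+1)%N :: iota (n - i) i.
  by rewrite /= -subSn // subSS.
apply: runs_cons; last by rvar.
apply: (runs_sub (P := Rnat (n - i.+1))); last by move=> w hw; split=> //; lia.
have -> : Rnat (n - i.+1) = Rq ((n%:R - i%:R) - 1).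
  by rewrite /Rnat /vnat -addn1 natrB ?addn1 // -natr1 opprD addrA.
apply: (runs_op OSub); last exact: runs_num.
by apply: (runs_op OSub); rvar.
Qed.

Definition tsign (n : tm) : tm := titer (Op OSub (Num 0) (Var 0)) (Num 1) n.

Lemma runs_sign e t n : runs e t (Rnat n) -> runs e (tsign t) (Rq ((-1) ^+ n)).
Proof.
move=> ht; apply: (runs_iter (Q := fun i => Rq ((-1) ^+ i))) ht _ _.
  exact: runs_num.
move=> i r _ hr; rewrite exprS mulN1r -[- _]sub0r.
by apply: (runs_op OSub); rvar.
Qed.

Definition tget (d i l : tm) : tm :=
  let3 (App (Lam (Ifz (IsNum (Var 0)) (Fst (Var 0)) (Var 3)))
     (titer (Ifz (IsNum (Var 0)) (Snd (Var 0)) (Var 0)) (Var 0) (Var 1))) d i l.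

Lemma runs_ifnil T (R : T -> val -> Prop) e l s t1 t2 Q :
  runs e l (Rseq R s) ->
  (forall x s' u w, s = x :: s' -> R x u -> Rseq R s' w -> 
     runs e l (eq (VPair u w)) -> runs e t1 Q) ->
  (s = [::] -> runs e l (eq (VNum 0)) -> runs e t2 Q) -> runs e (Ifz (IsNum l) t1 t2) Q.
Proof.
move=> [v ev]; case: s => [|x s'] /=.
  move=> vE _ /(_ (erefl _)) h; rewrite vE in ev.
  have [|w ew qw] := h; first by exists (VNum 0).
  by exists w => //; apply: (EIfz (a := 1)) ew; apply: (EIsNum (v := VNum 0)).
move=> [u [w [vE xu sw]]] /(_ x s' u w (erefl _) xu sw) h _; rewrite vE in ev.
have [|r er qr] := h; first by exists (VPair u w).
by exists r => //; apply: (EIfz (a := 0)) er; apply: (EIsNum (v := VPair u w)).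
Qed.

(** The tail is taken [n] times, the empty list being its own tail; an index out of range thus ends
    at the empty list, where the default is returned. *)
Lemma runs_nth T (R : T -> val -> Prop) (P : val -> Prop) e d i l n s x0 :
  runs e d P -> runs e i (Rnat n) -> runs e l (Rseq R s) ->
  runs e (tget d i l) (fun v => if (n < size s)%N then R (nth x0 s n) v else P v).
Proof.
move=> hd hi hl; apply: (runs_let3 hd hi hl) => u v w pu pv pw.
apply: (@runs_let _ _ _ (Rseq R (drop n s))).
  apply: (runs_iter (Q := fun i => Rseq R (drop i s))); [by rvar|by rewrite drop0; rvar|].
  move=> j r _ hr; have : drop j.+1 s = drop 1 (drop j s) by rewrite drop_drop.
  move=> ->; apply: (runs_ifnil (R := R) (s := drop j s)); first by rvar.
    move=> x s' a b -> _ hb hab; rewrite /= drop0; apply: runs_snd.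
    by apply: runs_sub hab _ => _ <-; exists a, b.
  by move=> sE _; rewrite sE /= in hr *; rvar.
move=> r hr; apply: (runs_ifnil (R := R) (s := drop n s)); first by rvar.
  move=> x s' a b sE ha _ hab; have ns : (n < size s)%N.
    by rewrite ltnNge; apply/negP => /drop_oversize; rewrite sE.
  apply: runs_fst; apply: runs_sub hab _ => _ <-; exists a, b; split => //.
  by rewrite ns -[n]addn0 -nth_drop sE.
move=> sE _; have -> : (n < size s)%N = false.
  by apply/negP => ns; have := size_drop n s; rewrite sE /=; lia.
by rvar.
Qed.

Lemma runs_nth_dflt T (R : T -> val -> Prop) e d i l n s x0 :
  runs e d (R x0) -> runs e i (Rnat n) -> runs e l (Rseq R s) ->
  runs e (tget d i l) (R (nth x0 s n)).
Proof.
move=> hd hi hl; apply: runs_sub (runs_nth x0 hd hi hl) _ => v; case: ltnP => // ns.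
by rewrite nth_default.
Qed.

Lemma runs_nth_in T (R : T -> val -> Prop) e i l n s x0 : (n < size s)%N ->
  runs e i (Rnat n) -> runs e l (Rseq R s) -> runs e (tget (Num 0) i l) (R (nth x0 s n)).
Proof.
move=> ns hi hl; apply: runs_sub (runs_nth x0 (runs_num e 0) hi hl) _ => v.
by rewrite ns.
Qed.

Definition tnseq0 (n : tm) : tm := titer (Pair (Num 0) (Var 0)) (Num 0) n.

Lemma runs_nseq0 e t n : runs e t (Rnat n) -> runs e (tnseq0 t) (Rseq Rq (nseq n 0)).
Proof.
move=> ht; apply: (runs_iter (Q := fun i => Rseq Rq (nseq i 0))) ht _ _.
  exact: runs_nil.
by move=> i r _ hr; apply: runs_cons; rvar.
Qed.

Definition teqn (s t : tm) : tm := Ifz (Op OSub s t) (Num 1) (Num 0).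

Lemma runs_eqn e s t m n : runs e s (Rnat m) -> runs e t (Rnat n) ->
  runs e (teqn s t) (Rbool (m == n)).
Proof.
move=> hs ht; apply: (runs_ifz (runs_op OSub hs ht)) => /= /eqP.
  by rewrite subr_eq0 eqr_nat => ->; apply: runs_num.
by rewrite subr_eq0 eqr_nat => /negPf ->; apply: runs_num.
Qed.

Lemma runs_addn e s t m n : runs e s (Rnat m) -> runs e t (Rnat n) ->
  runs e (Op OAdd s t) (Rnat (m + n)).
Proof. by move=> hs ht; rewrite /Rnat /vnat natrD; apply: (runs_op OAdd). Qed.

Lemma runs_muln e s t m n : runs e s (Rnat m) -> runs e t (Rnat n) ->
  runs e (Op OMul s t) (Rnat (m * n)).
Proof. by move=> hs ht; rewrite /Rnat /vnat natrM; apply: (runs_op OMul). Qed.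

Lemma runs_subn e s t m n : (n <= m)%N -> runs e s (Rnat m) -> runs e t (Rnat n) ->
  runs e (Op OSub s t) (Rnat (m - n)).
Proof. by move=> nm hs ht; rewrite /Rnat /vnat natrB //; apply: (runs_op OSub). Qed.

Lemma runs_leq e s t m n : runs e s (Rnat m) -> runs e t (Rnat n) ->
  runs e (Op OLeq s t) (Rbool (m <= n)%N).
Proof.
by move=> hs ht; rewrite /Rbool -(ler_nat rat); apply: (runs_op OLeq hs ht).
Qed.

Lemma runs_and e s t a b : runs e s (Rbool a) -> runs e t (Rbool b) ->
  runs e (Op OMul s t) (Rbool (a && b)).
Proof.
by move=> hs ht; rewrite /Rbool -mulnb natrM; apply: (runs_op OMul).
Qed.

Definition tall (body l : tm) : tm :=
  let2 (trec (Op OMul (App (Var 4) (Var 2)) (Var 0)) (Num 1) (Var 0)) (Lam body) l.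

Lemma runs_all T (R : T -> val -> Prop) e body l s (p : pred T) :
  runs e l (Rseq R s) -> (forall x u, R x u -> runs (u :: e) body (Rbool (p x))) ->
  runs e (tall body l) (Rbool (all p s)).
Proof.
move=> hl hb; apply: (runs_let2 (runs_clos e body) hl) => F v <-{F} hv.
apply: (runs_rec (R := R) (Q := fun s => Rbool (all p s))).
- by rvar.
- exact: runs_num.
move=> x s' us u r xu _ hr; apply: runs_and; last by rvar.
by apply: (runs_app_clos (P := R x)); [apply: runs_var; reflexivity|rvar|exact: hb].
Qed.

Definition thead (w : tm) : tm := tget (Num 0) (Num 0) w.
Definition tbehead (w : tm) : tm := App (Lam (Ifz (IsNum (Var 0)) (Snd (Var 0)) (Var 0))) w.

Lemma runs_head e t w : runs e t (Rseq Rq w) -> runs e (thead t) (Rq (head 0 w)).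
Proof. by move=> ht; rewrite -nth0; apply: (runs_nth_dflt (R := Rq)) ht; apply: runs_num. Qed.

Lemma runs_behead e t T (R : T -> val -> Prop) w :
  runs e t (Rseq R w) -> runs e (tbehead t) (Rseq R (behead w)).
Proof.
move=> ht; apply: (runs_let ht) => u hu.
apply: (runs_ifnil (R := R) (s := w)); first by rvar.
  move=> x s' a b -> _ hb hab; apply: runs_snd.
  by apply: runs_sub hab _ => _ <-; exists a, b.
by move=> sE _; rewrite sE /= in hu *; rvar.
Qed.

Definition teliminate (w v : tm) : tm :=
  let2 (tmap (Op OSub (tget (Num 0) (Op OAdd (Var 0) (Num 1)) (Var 1))
     (Op OMul (Op ODiv (thead (Var 1)) (thead (Var 2)))
        (tget (Num 0) (Op OAdd (Var 0) (Num 1)) (Var 2))))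
    (tiota (tlength (tbehead (Var 0))))) w v.

Lemma runs_eliminate e tw tv w v : runs e tw (Rseq Rq w) -> runs e tv (Rseq Rq v) ->
  runs e (teliminate tw tv) (Rseq Rq (eliminate w v)).
Proof.
move=> hw hv; apply: (runs_let2 hw hv) => uw uv pw pv.
rewrite /eliminate -size_behead; apply: (runs_map (runs_iota (runs_size (R := Rq) (runs_behead _)))).
  by rvar.
move=> i u [_ hi].
have hi1 : runs [:: u, uv, uw & e] (Op OAdd (Var 0) (Num 1)) (Rnat i.+1).
  by rewrite -addn1; apply: runs_addn; rvar.
apply: (runs_op OSub); first by apply: (runs_nth_dflt (R := Rq)) hi1 _; rvar.
apply: (runs_op OMul); last by apply: (runs_nth_dflt (R := Rq)) hi1 _; rvar.
by apply: (runs_op ODiv); apply: runs_head; rvar.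
Qed.

Definition tcut (l : tm) : tm :=
  trec (Ifz (thead (Var 2)) (Pair (tbehead (Var 2)) (Var 0))
    (tmap (teliminate (Var 3) (Var 0)) (Var 1))) (Num 0) l.

Lemma runs_cut e t R : runs e t (Rseq (Rseq Rq) R) -> runs e (tcut t) (Rseq (Rseq Rq) (cut R)).
Proof.
move=> ht; apply: (runs_rec (R := Rseq Rq) (Q := fun R => Rseq (Rseq Rq) (cut R))) ht _ _.
  exact: runs_nil.
move=> w R' us u r hw hR hr.
apply: (runs_ifz (a := head 0 w)); first by apply: runs_head; rvar.
  move=> w0; rewrite /= w0 eqxx; apply: runs_cons; last by rvar.
  by apply: runs_behead; rvar.
move=> /eqP/negPf w0; rewrite /= w0; apply: (runs_map (R := Rseq Rq)); first by rvar.
by move=> v vu hv; apply: runs_eliminate; rvar.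
Qed.

Definition tunit_row (q i : tm) : tm := let2 (tmap (teqn (Var 1) (Var 0)) (tiota (Var 1))) q i.

Lemma runs_unit_row e tq ti q i : runs e tq (Rnat q) -> runs e ti (Rnat i) ->
  runs e (tunit_row tq ti) (Rseq Rq (unit_row q i)).
Proof.
move=> hq hi; apply: (runs_let2 hq hi) => u v hu hv.
apply: (runs_map (runs_iota (n := q) _)); first by rvar.
by move=> j w [_ hj]; apply: runs_eqn; rvar.
Qed.

(** * Programs for words and polynomials *)

(** Degree, differential and image: the state of the algorithm, with an element of [A] where the
    program holds one of its names. *)
Definition gen (A : dga) : Type := (nat * seq (rat * word) * dga_alg A)%type.

Section Gens.

Variables (A : dga) (g : seq (gen A)).
Definition gen0 : gen A := (0%N, [::], 0).
Definition gdegs i : nat := (nth gen0 g i).1.1.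
Definition gdiffs i : seq (rat * word) := (nth gen0 g i).1.2.
Definition gimgs i : dga_alg A := (nth gen0 g i).2.

End Gens.

Definition Rpoly : seq (rat * word) -> val -> Prop := Rseq (Rpair Rq (Rseq Rnat)).

(** The layout is that of an entry of [venc_presentation], so the final state is already the output.
    Only the name [u] is not determined by [x]. *)
Definition Rgen (A : leff_dga) (x : gen A) (v : val) : Prop := exists vp u,
  [/\ v = VPair (vnat x.1.1) (VPair vp (VPair u (VNum 0))), Rpoly x.1.2 vp
    & ld_name A x.1.1 u x.2].

Definition Rlt k (i : nat) (v : val) : Prop := (i < k)%N /\ Rnat i v.

Lemma Rword_lt k w v : all (gtn k) w -> Rseq Rnat w v -> Rseq (Rlt k) w v.
Proof. by move=> wk; apply: Rseq_mem => i u /(allP wk) ik hi; split. Qed.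

Lemma Rword_nat k w v : Rseq (Rlt k) w v -> Rseq Rnat w v.
Proof. by apply: Rseq_mem => i u _ []. Qed.

Definition tdeg (g i : tm) : tm := Fst (tget (Num 0) i g).
Definition tdiff (g i : tm) : tm := Fst (Snd (tget (Num 0) i g)).
Definition timg (g i : tm) : tm := Fst (Snd (Snd (tget (Num 0) i g))).

Definition textract (g x t : tm) : tm :=
  let3 (trec (Ifz (Op OSub (Var 4) (Var 2)) (Pair (Num 1) (Var 1))
     (Pair (Op OMul (tsign (Op OMul (tdeg (Var 5) (Var 4)) (tdeg (Var 5) (Var 2)))) (Fst (Var 0)))
        (Pair (Var 2) (Snd (Var 0)))))
     (Pair (Num 0) (Num 0)) (Var 0)) g x t.

(** [coef] recurses on [u] while [t] changes along the way, so the recursion on [u] returns a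
    closure awaiting [t]; the base case [IsNum] tests that [t] is empty. *)
Definition tcoef (g u t : tm) : tm :=
  let3 (App (trec (Lam (App (Lam (Op OMul (Fst (Var 0)) (App (Var 2) (Snd (Var 0)))))
       (textract (Var 6) (Var 3) (Var 0))))
     (Lam (IsNum (Var 0))) (Var 1)) (Var 0)) g u t.

Definition tpcoef (g P t : tm) : tm :=
  let3 (trec (Op OAdd (Op OMul (Fst (Var 2)) (tcoef (Var 5) (Snd (Var 2)) (Var 3))) (Var 0))
     (Num 0) (Var 1)) g P t.

Definition tdword (g w : tm) : tm :=
  let2 (trec
     (tcat (tmap (Pair (Fst (Var 0)) (tcat (Snd (Var 0)) (Var 2))) (tdiff (Var 4) (Var 2)))
        (tmap (Pair (Op OMul (tsign (tdeg (Var 5) (Var 3))) (Fst (Var 0)))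
            (Pair (Var 3) (Snd (Var 0)))) (Var 0)))
     (Num 0) (Var 0)) g w.

Definition twdeg (g w : tm) : tm :=
  let2 (trec (Op OAdd (tdeg (Var 4) (Var 2)) (Var 0)) (Num 0) (Var 0)) g w.

(** Evenness of the degree [d] is computed as [((-1)^d + 1) / 2]. *)
Definition tletter_lt (g i j : tm) : tm :=
  let3 (Ifz (Op OLeq (Var 0) (Var 1)) (Num 1)
     (Ifz (Op OSub (Var 1) (Var 0))
        (Op ODiv (Op OAdd (tsign (tdeg (Var 2) (Var 1))) (Num 1)) (Num 2%:R))
        (Num 0))) g i j.

Definition tstd (g w : tm) : tm :=
  let2 (trec (Op OMul (tall (tletter_lt (Var 5) (Var 3) (Var 0)) (Var 1)) (Var 0))
     (Num 1) (Var 0)) g w.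

Definition tall_words (k p : tm) : tm :=
  let2 (titer (Pair (Num 0)
      (tflatten (tmap (tmap (Pair (Var 1) (Var 0)) (Var 1)) (tiota (Var 3)))))
    (Pair (Num 0) (Num 0)) (Var 0)) k p.

Definition twords (g p : tm) : tm :=
  let2 (tfilter (Op OMul (tstd (Var 2) (Var 0)) (teqn (twdeg (Var 2) (Var 0)) (Var 1)))
    (tall_words (tlength (Var 1)) (Var 0))) g p.

Section Words.

Variables (A : leff_dga) (g : seq (gen A)).
Local Notation k := (size g).
Local Notation deg := (gdegs g).
Local Notation dp := (gdiffs g).
Local Notation Rg := (Rseq (@Rgen A) g).

Section Env.
Variable e : seq val.

Lemma runs_nth_gen tg ti i : (i < k)%N -> runs e tg Rg -> runs e ti (Rnat i) ->
  runs e (tget (Num 0) ti tg) (Rgen (nth (gen0 A) g i)).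
Proof. by move=> ik hg hi; apply: runs_nth_in hi hg. Qed.

Lemma runs_deg tg ti i : (i < k)%N -> runs e tg Rg -> runs e ti (Rnat i) ->
  runs e (tdeg tg ti) (Rnat (deg i)).
Proof.
move=> ik hg hi; apply: runs_fst; apply: runs_sub (runs_nth_gen ik hg hi) _.
by move=> v [vp [u [-> _ _]]]; do 2 eexists.
Qed.

Lemma runs_diff tg ti i : (i < k)%N -> runs e tg Rg -> runs e ti (Rnat i) ->
  runs e (tdiff tg ti) (Rpoly (dp i)).
Proof.
move=> ik hg hi; apply: runs_fst; apply: runs_snd; apply: runs_sub (runs_nth_gen ik hg hi) _.
by move=> v [vp [u [-> ? _]]]; do 2 eexists; split => //; do 2 eexists.
Qed.

Lemma runs_img tg ti i : (i < k)%N -> runs e tg Rg -> runs e ti (Rnat i) ->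
  runs e (timg tg ti) (fun v => ld_name A (deg i) v (gimgs g i)).
Proof.
move=> ik hg hi; apply: runs_fst; do 2 apply: runs_snd.
apply: runs_sub (runs_nth_gen ik hg hi) _.
by move=> v [vp [u [-> _ ?]]]; do 2 eexists; split => //; do 2 eexists; split => //; do 2 eexists.
Qed.

End Env.

Lemma extract_lt i t : all (gtn k) t -> all (gtn k) (extract deg i t).2.
Proof.
elim: t => //= j t IH /andP[jk tk]; case: ifP => //= _.
by rewrite jk IH.
Qed.

Lemma runs_extract e tg ti tt i t : (i < k)%N -> all (gtn k) t ->
  runs e tg Rg -> runs e ti (Rnat i) -> runs e tt (Rseq Rnat t) ->
  runs e (textract tg ti tt) (Rpair Rq (Rseq Rnat) (extract deg i t)).
Proof.
move=> ik tk hg hi ht.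
apply: (runs_let3 hg hi (runs_sub ht (fun v => @Rword_lt k t v tk))) => ug ui ut pg pi pt.
apply: (runs_rec (R := Rlt k) (Q := fun t => Rpair Rq (Rseq Rnat) (extract deg i t))).
- by rvar.
- by apply: runs_Rpair; [apply: runs_num|apply: runs_nil].
move=> j t' us u r [jk hj] /Rword_nat ht' hr /=.
have hE : runs [:: r, u, us, ut, ui, ug & e] (Op OSub (Var 4) (Var 2)) (Rq (i%:R - j%:R)).
  by apply: (runs_op OSub); rvar.
apply: (runs_ifz hE) => /eqP; rewrite subr_eq0 eqr_nat.
  by move=> ->; apply: runs_Rpair; rvar.
move=> /negPf->; apply: runs_Rpair.
  apply: (runs_op OMul); last by apply: runs_Rfst; rvar.
  by apply: runs_sign; apply: runs_muln; apply: runs_deg => //; rvar.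
by apply: runs_cons; [rvar|apply: runs_Rsnd; rvar].
Qed.

Lemma runs_coef e tg tu tt u t : all (gtn k) u -> all (gtn k) t ->
  runs e tg Rg -> runs e tu (Rseq Rnat u) -> runs e tt (Rseq Rnat t) ->
  runs e (tcoef tg tu tt) (Rq (coef deg u t)).
Proof.
move=> uk tk hg hu ht.
apply: (runs_let3 hg (runs_sub hu (fun v => @Rword_lt k u v uk)) ht) => ug uu ut pg pu pt.
pose Rt t v := all (gtn k) t /\ Rseq Rnat t v.
pose QQ u f := forall t, arr (Rt t) (Rq (coef deg u t)) f.
apply: (runs_app (P := Rt t)); last by apply: runs_var => //; split.
apply: (runs_sub (P := QQ u)); last by move=> f; apply.
apply: (runs_rec (R := Rlt k)); first by rvar.
  apply: runs_lam_all => s v [_ hs].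
  have : runs (v :: [:: ut, uu, ug & e]) (Var 0) (Rseq Rnat s) by rvar.
  move/runs_isnum/runs_sub; apply=> w [x]; case: s {hs} => [|j s] /=; first by move=> -> ->.
  by move=> [a [b [-> _ _]]] ->.
move=> i u' us ui f [ik hi] _ hf; apply: runs_lam_all => s v [sk hs].
apply: (runs_let (runs_extract ik sk _ _ _)); [by rvar|by rvar|by rvar|].
move=> p hp; apply: (runs_op OMul); first by apply: runs_Rfst; rvar.
apply: (runs_app (P := Rt (extract deg i s).2)); first by apply: runs_var => //; apply: hf.
have : runs [:: p, v, f, ui, us, ut, uu, ug & e] (Snd (Var 0)) (Rseq Rnat (extract deg i s).2).
  by apply: runs_Rsnd; rvar.
by move/runs_sub; apply=> w hw; split => //; apply: extract_lt.
Qed.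

Lemma runs_pcoef e tg tP tt P t : all (fun m => all (gtn k) m.2) P -> all (gtn k) t ->
  runs e tg Rg -> runs e tP (Rpoly P) -> runs e tt (Rseq Rnat t) ->
  runs e (tpcoef tg tP tt) (Rq (pcoef deg P t)).
Proof.
move=> Pk tk hg hP ht; apply: (runs_let3 hg hP ht) => ug uP ut pg pP pt.
pose R (m : rat * word) v := all (gtn k) m.2 /\ Rpair Rq (Rseq Rnat) m v.
apply: (runs_rec (R := R) (Q := fun P => Rq (pcoef deg P t))).
- apply: runs_var => //; apply: Rseq_mem pP => m u mP hm; split=> //.
  exact: (allP Pk).
- exact: runs_num.
move=> m P' us u r [mk hm] _ hr /=; apply: (runs_op OAdd); last by rvar.
apply: (runs_op OMul); first by apply: runs_Rfst; rvar.
by apply: runs_coef => //; [rvar|apply: runs_Rsnd; rvar|rvar].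
Qed.

Lemma runs_dword e tg tw w : all (gtn k) w ->
  runs e tg Rg -> runs e tw (Rseq Rnat w) -> runs e (tdword tg tw) (Rpoly (dword deg dp w)).
Proof.
move=> wk hg hw.
apply: (runs_let2 hg (runs_sub hw (fun v => @Rword_lt k w v wk))) => ug uw pg pw.
apply: (runs_rec (R := Rlt k) (Q := fun w => Rpoly (dword deg dp w))).
- by rvar.
- exact: runs_nil.
move=> i w' us u r [ik hi] /Rword_nat hw' hr /=; apply: runs_cat.
  apply: (runs_map (R := Rpair Rq (Rseq Rnat))).
    by apply: runs_diff => //; rvar.
  move=> m v hm; apply: runs_Rpair; first by apply: runs_Rfst; rvar.
  by apply: runs_cat; [apply: runs_Rsnd; rvar|rvar].
apply: (runs_map (R := Rpair Rq (Rseq Rnat))); first by rvar.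
move=> m v hm; apply: runs_Rpair.
  apply: (runs_op OMul); last by apply: runs_Rfst; rvar.
  by apply: runs_sign; apply: runs_deg => //; rvar.
by apply: runs_cons; [rvar|apply: runs_Rsnd; rvar].
Qed.

Lemma runs_wdeg e tg tw w : all (gtn k) w ->
  runs e tg Rg -> runs e tw (Rseq Rnat w) -> runs e (twdeg tg tw) (Rnat (wdeg deg w)).
Proof.
move=> wk hg hw.
apply: (runs_let2 hg (runs_sub hw (fun v => @Rword_lt k w v wk))) => ug uw pg pw.
apply: (runs_rec (R := Rlt k) (Q := fun w => Rnat (wdeg deg w))).
- by rvar.
- exact: runs_num.
move=> i w' us u r [ik hi] _ hr; rewrite wdeg_cons; apply: runs_addn; last by rvar.
by apply: runs_deg => //; rvar.
Qed.

Lemma runs_letter_lt e tg ti tj i j : (i < k)%N ->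
  runs e tg Rg -> runs e ti (Rnat i) -> runs e tj (Rnat j) ->
  runs e (tletter_lt tg ti tj) (Rbool (letter_lt deg i j)).
Proof.
move=> ik hg hi hj; apply: (runs_let3 hg hi hj) => ug ui uj pg pi pj.
apply: (runs_ifz (a := (j <= i)%N%:R)).
- by apply: runs_leq; rvar.
- rewrite /letter_lt ltnNge; case: (j <= i)%N => //= _; exact: runs_num.
rewrite /letter_lt ltnNge; case: (j <= i)%N => //= _.
apply: (runs_ifz (a := i%:R - j%:R)).
- by apply: (runs_op OSub); rvar.
- move=> /eqP; rewrite subr_eq0 eqr_nat => /eqP <-; rewrite eqxx /=.
  have -> : Rbool (~~ odd (deg i)) = Rq (((-1) ^+ deg i + 1) / 2%:R).
    by rewrite sgn_odd /Rbool /Rq; case: odd; rewrite /= ?addNr ?mul0r // -mulr2n divff.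
  apply: (runs_op ODiv); last exact: runs_num.
  apply: (runs_op OAdd); last exact: runs_num.
  by apply: runs_sign; apply: runs_deg => //; rvar.
by move=> /eqP; rewrite subr_eq0 eqr_nat => /negPf->; apply: runs_num.
Qed.

Lemma runs_std e tg tw w : all (gtn k) w ->
  runs e tg Rg -> runs e tw (Rseq Rnat w) -> runs e (tstd tg tw) (Rbool (standard deg w)).
Proof.
move=> wk hg hw; rewrite standardE.
apply: (runs_let2 hg (runs_sub hw (fun v => @Rword_lt k w v wk))) => ug uw pg pw.
apply: (runs_rec (R := Rlt k) (Q := fun w => Rbool (pairwise (letter_lt deg) w))).
- by rvar.
- exact: runs_num.
move=> i w' us u r [ik hi] hw' hr /=; apply: runs_and; last by rvar.
apply: (runs_all (R := Rlt k)); first by rvar.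
by move=> j v [jk hj]; apply: runs_letter_lt => //; rvar.
Qed.

Lemma runs_all_words e tk tp n p : runs e tk (Rnat n) -> runs e tp (Rnat p) ->
  runs e (tall_words tk tp) (Rseq (Rseq Rnat) (all_words n p)).
Proof.
move=> hk hp; apply: (runs_let2 hk hp) => uk up pk pp.
apply: (runs_iter (Q := fun p => Rseq (Rseq Rnat) (all_words n p))).
- by rvar.
- by apply: runs_cons; [apply: runs_nil|apply: runs_nil].
move=> i r _ hr; apply: runs_cons; first exact: runs_nil.
apply: runs_flatten; apply: (runs_map (R' := Rseq (Rseq Rnat)) (runs_iota (n := n) _)); first by rvar.
move=> j v [_ hj]; apply: (runs_map (R := Rseq Rnat)); first by rvar.
by move=> w u hw; apply: runs_cons; rvar.
Qed.

(** Entries keep their membership, from which the bound on letters and the degree are recovered in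
    bodies mapped over the list. *)
Definition Rwords p := Rseq (fun w v => w \in words k deg p /\ Rseq Rnat w v) (words k deg p).

Lemma runs_words e tg tp p : runs e tg Rg -> runs e tp (Rnat p) ->
  runs e (twords tg tp) (Rwords p).
Proof.
move=> hg hp.
suff h : runs e (twords tg tp) (Rseq (Rseq Rnat) (words k deg p)).
  by apply: runs_sub h _ => v; apply: Rseq_mem.
apply: (runs_let2 hg hp) => ug up pg pp.
pose R (w : word) v := all (gtn k) w /\ Rseq Rnat w v.
suff h : runs [:: up, ug & e] (tfilter (Op OMul (tstd (Var 2) (Var 0)) (teqn (twdeg (Var 2) (Var 0)) (Var 1)))
    (tall_words (tlength (Var 1)) (Var 0))) (Rseq R (words k deg p)).
  by apply: runs_sub h _ => v; apply: Rseq_mem => w u _ [].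
apply: runs_filter.
  have h := @runs_all_words [:: up, ug & e] (tlength (Var 1)) (Var 0) k p.
  apply: (runs_sub (h _ _)); [by apply: (runs_size (R := @Rgen A)); rvar|by rvar|].
  move=> v; apply: Rseq_mem => w u; rewrite mem_all_words => /andP[wk _] hw.
  by split.
move=> w u [wk hw]; apply: runs_and; first by apply: runs_std => //; rvar.
by apply: runs_eqn; [apply: runs_wdeg => //; rvar|rvar].
Qed.

End Words.

(** * Programs using the input *)

Definition sel (i : nat) (t : tm) : tm := Fst (iter i Snd t).

Lemma runs_sel e t s i v : runs e t (eq (vseq s)) -> onth s i = Some v ->
  runs e (sel i t) (eq v).
Proof.
rewrite /sel => ht si; apply: runs_fst.
suff : runs e (iter i Snd t) (eq (vseq (drop i s))).
  move/runs_sub; apply=> w <-.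
  elim: i s si {ht} => [|i IH] [|x s] //=; first by move=> [->]; exists v, (vseq s).
  exact: IH.
have : (i < size s)%N by elim: i s si {ht} => [|i IH] [|x s] //= /IH.
elim: i {si} => [|i IH] is_; first by rewrite drop0.
apply: runs_snd; apply: runs_sub (IH (ltnW is_)) _ => w <-.
by rewrite (drop_nth (VNum 0)) ?(ltnW is_) //; do 2 eexists.
Qed.

Definition tmul (inp p q a b : tm) : tm :=
  App (sel 2 (sel 1 inp)) (Pair (Pair p q) (Pair a b)).
Definition tadd (inp p a b : tm) : tm :=
  App (sel 1 (sel 0 (sel 1 inp))) (Pair p (Pair a b)).
Definition tscale (inp p c a : tm) : tm :=
  App (sel 2 (sel 0 (sel 1 inp))) (Pair p (Pair c a)).
Definition tzero (inp p : tm) : tm := App (sel 0 (sel 0 (sel 1 inp))) p.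
Definition trank (inp p : tm) : tm := App (sel 0 (sel 2 inp)) p.
Definition tdrows (inp p : tm) : tm := App (sel 1 (sel 2 inp)) p.

(* The [j]-th map (f, g or h) of the reduction of the middle complex onto the
   DGA (i = 1) or onto the effective complex (i = 2). *)
Definition tred (i j : nat) (inp p a : tm) : tm :=
  App (sel j (sel i (sel 3 inp))) (Pair p a).

Definition tF (inp p a : tm) : tm := let3 (tred 2 0 (Var 2) (Var 1) (tred 1 1 (Var 2) (Var 1) (Var 0))) inp p a.
Definition tG (inp p c : tm) : tm := let3 (tred 1 0 (Var 2) (Var 1) (tred 2 1 (Var 2) (Var 1) (Var 0))) inp p c.
(** Here [p] is the degree of the result. The homotopy lowers degrees, so it and the map before it
    are called in degree [p + 1]. *)
Definition tH (inp p a : tm) : tm :=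
  let3 (tred 1 0 (Var 2) (Var 1)
    (tred 2 2 (Var 2) (Op OAdd (Var 1) (Num 1))
      (tred 1 1 (Var 2) (Op OAdd (Var 1) (Num 1)) (Var 0)))) inp p a.

(** The product program expects the degrees of both factors, so the degree is carried along with the
    name. *)
Definition tmonomial (inp g w : tm) : tm :=
  let3 (trec (Pair (Op OAdd (tdeg (Var 4) (Var 2)) (Fst (Var 0)))
      (tmul (Var 5) (tdeg (Var 4) (Var 2)) (Fst (Var 0)) (timg (Var 4) (Var 2)) (Snd (Var 0))))
    (Pair (Num 0) (sel 1 (sel 1 (Var 2)))) (Var 0)) inp g w.

Definition tpoly_img (inp g p P : tm) : tm :=
  let4 (trec (tadd (Var 6) (Var 4)
       (tscale (Var 6) (Var 4) (Fst (Var 2)) (Snd (tmonomial (Var 6) (Var 5) (Snd (Var 2)))))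
       (Var 0))
     (tzero (Var 3) (Var 1)) (Var 0)) inp g p P.

Definition tcrow (inp g p s : tm) : tm := let4 (tF (Var 3) (Var 1) (Snd (tmonomial (Var 3) (Var 2) (Var 0)))) inp g p s.

Definition tplus (t : tm) (n : nat) : tm := Op OAdd t (Num n%:R).

Lemma runs_plus e t m n : runs e t (Rnat m) -> runs e (tplus t n) (Rnat (m + n)).
Proof. by move=> h; apply: runs_addn => //; apply: runs_num. Qed.

Section Oracles.

Variables (n : nat) (A : leff_dga) (C : eff_cochain) (E : leff_equiv (ld_name A) (rat_name C)).
Local Notation Rinp := (eq (venc_input n E)).
Local Notation CQ := (rationalization C).
Local Notation F := (eqF (lr_red (le_left E)) (lr_red (le_right E))).
Local Notation G := (eqG (lr_red (le_left E)) (lr_red (le_right E))).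
Local Notation H := (eqH (lr_red (le_left E)) (lr_red (le_right E))).

Section Env.
Variable e : seq val.

Lemma runs_inp_ops ti : runs e ti Rinp -> runs e (sel 0 (sel 1 ti)) (eq (venc_ops (ld_ops A))).
Proof. by move=> h; apply: (runs_sel (runs_sel h _)). Qed.

Lemma runs_mul ti tp tq ta tb p q a b : runs e ti Rinp ->
  runs e tp (Rnat p) -> runs e tq (Rnat q) ->
  runs e ta (fun v => ld_name A p v a) -> runs e tb (fun v => ld_name A q v b) ->
  runs e (tmul ti tp tq ta tb)
    (fun v => ld_name A (p + q) v ((a : dga_alg A) * b)).
Proof.
move=> hi hp hq ha hb.
apply: (runs_call (w := ld_mul A) (runs_sel (runs_sel hi _) _)
  (runs_pair (runs_pair hp hq) (runs_pair ha hb))) => // v.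
move=> [u1 [u2 [-> [v1 [v2 [-> -> ->]]] [w1 [w2 [-> n1 n2]]]]]].
exact: ld_mulP.
Qed.

Lemma runs_add ti tp ta tb p a b : runs e ti Rinp -> runs e tp (Rnat p) ->
  runs e ta (fun v => ld_name A p v a) -> runs e tb (fun v => ld_name A p v b) ->
  runs e (tadd ti tp ta tb) (fun v => ld_name A p v (a + b)).
Proof.
move=> hi hp ha hb.
apply: (runs_call (w := op_add (ld_ops A)) (runs_sel (runs_inp_ops hi) _)
  (runs_pair hp (runs_pair ha hb))) => // v.
move=> [u1 [u2 [-> -> [w1 [w2 [-> n1 n2]]]]]].
exact: op_addP.
Qed.

Lemma runs_scale ti tp tc ta p c a : runs e ti Rinp -> runs e tp (Rnat p) ->
  runs e tc (Rq c) -> runs e ta (fun v => ld_name A p v a) ->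
  runs e (tscale ti tp tc ta) (fun v => ld_name A p v (c *: a)).
Proof.
move=> hi hp hc ha.
apply: (runs_call (w := op_scale (ld_ops A)) (runs_sel (runs_inp_ops hi) _)
  (runs_pair hp (runs_pair hc ha))) => // v.
move=> [u1 [u2 [-> -> [w1 [w2 [-> -> n2]]]]]].
exact: op_scaleP.
Qed.

Lemma runs_zero ti tp p : runs e ti Rinp -> runs e tp (Rnat p) ->
  runs e (tzero ti tp) (fun v => ld_name A p v 0).
Proof.
move=> hi hp.
apply: (runs_call (w := op_zero (ld_ops A)) (runs_sel (runs_inp_ops hi) _) hp) => // v ->.
exact: op_zeroP.
Qed.

Lemma runs_one ti : runs e ti Rinp -> runs e (sel 1 (sel 1 ti)) (fun v => ld_name A 0 v (1 : dga_alg A)).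
Proof.
move=> hi; apply: (runs_sub (P := eq (ld_one A))) => [|v <-]; last exact: ld_oneP.
by apply: (runs_sel (runs_sel hi _)).
Qed.

Lemma runs_rank ti tp p : runs e ti Rinp -> runs e tp (Rnat p) ->
  runs e (trank ti tp) (Rnat (rank C p)).
Proof.
move=> hi hp; apply: (runs_call (w := ec_rank C) (runs_sel (runs_sel hi _) _) hp) => // v ->.
by exists (vnat (rank C p)) => //; apply: ec_rankP.
Qed.

Lemma runs_drows ti tp p : runs e ti Rinp -> runs e tp (Rnat p) ->
  runs e (tdrows ti tp) (Rseq (Rseq Rq) (drows C p)).
Proof.
move=> hi hp; apply: (runs_call (w := ec_diff C) (runs_sel (runs_sel hi _) _) hp) => // v ->.
exists (vmatrix (ediff C p)); first exact: ec_diffP.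
apply/Rseq_map; rewrite /vmatrix.
elim: (enum 'I_(rank C p)) => //= i s IH; do 2 eexists; split; [by []| |exact: IH].
by apply/Rseq_map/Rseq_vseq.
Qed.

Lemma runs_red i j ti tp ta w X Y (NX : naming X) (NY : naming Y) p q (f : X -> Y) a sv :
  runs e ti Rinp -> runs e tp (Rnat p) ->
  onth [:: venc_ops (lc_ops (le_mid E)); venc_reduction (le_left E); venc_reduction (le_right E)] i
    = Some (vseq sv) ->
  onth sv j = Some w -> computes NX NY w p q f ->
  runs e ta (fun v => NX p v a) ->
  runs e (tred i j ti tp ta) (fun v => NY q v (f a)).
Proof.
move=> hi hp hsv hw cf ha.
have h3 : runs e (sel 3 ti) (eq (vseq [:: venc_ops (lc_ops (le_mid E)); venc_reduction (le_left E); venc_reduction (le_right E)])).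
  exact: runs_sel hi _.
apply: (runs_call (runs_sel (runs_sel h3 hsv) hw) (runs_pair hp ha)) => v.
by move=> [u1 [u2 [-> -> n2]]]; apply: cf.
Qed.


(** Unlike a name in [A], a name in [C] can be read: it is the list of coordinates on which the
    linear algebra operates. *)
Lemma rat_nameE p v (c : CQ) : rat_name C p v c <-> hom p c /\ Rseq Rq (ccoord p c) v.
Proof.
have RqE : forall s u, Rseq Rq s u <-> u = vseq (map VNum s) by move=> s u; apply: Rseq_vseq.
have rowE : vrow (fun i : 'I_(rank C p) => (c : ratspace C)@_(mkcell i)) = vseq (map VNum (ccoord p c)).
  by rewrite /ccoord -map_comp.
by split=> -[hc hv]; split=> //; [rewrite hv rowE; apply/RqE|rewrite rowE; apply/RqE].
Qed.

End Env.

Lemma runs_F e ti tp ta p a : runs e ti Rinp -> runs e tp (Rnat p) ->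
  runs e ta (fun v => ld_name A p v a) ->
  runs e (tF ti tp ta) (Rseq Rq (ccoord p (F a))).
Proof.
move=> hi hp ha; apply: (runs_let3 hi hp ha) => ui up ua pi pp pa.
suff h : runs [:: ua, up, ui & e] (tred 2 0 (Var 2) (Var 1) (tred 1 1 (Var 2) (Var 1) (Var 0)))
    (fun v => rat_name C p v (F a)).
  by apply: runs_sub h _ => v /rat_nameE [].
apply: (runs_red (i := 2) (j := 0) (p := p) (NX := lc_name (le_mid E)) (f := red_f (lr_red (le_right E)))).
- by apply: runs_var pi.
- by rvar.
- reflexivity.
- reflexivity.
- exact: lr_fP.
apply: (runs_red (i := 1) (j := 1) (p := p) (NX := ld_name A) (f := red_g (lr_red (le_left E)))).
- by apply: runs_var pi.
- by rvar.
- reflexivity.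
- reflexivity.
- exact: lr_gP.
by rvar.
Qed.

Lemma runs_G e ti tp tc p c : runs e ti Rinp -> runs e tp (Rnat p) -> hom p c ->
  runs e tc (Rseq Rq (ccoord p c)) ->
  runs e (tG ti tp tc) (fun v => ld_name A p v (G c)).
Proof.
move=> hi hp hc htc; apply: (runs_let3 hi hp htc) => ui up uc pi pp pc.
have nc : rat_name C p uc c by apply/rat_nameE.
apply: (runs_red (i := 1) (j := 0) (p := p) (NX := lc_name (le_mid E)) (f := red_f (lr_red (le_left E)))).
- by apply: runs_var pi.
- by rvar.
- reflexivity.
- reflexivity.
- exact: lr_fP.
apply: (runs_red (i := 2) (j := 1) (p := p) (NX := rat_name C) (f := red_g (lr_red (le_right E)))).
- by apply: runs_var pi.
- by rvar.
- reflexivity.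
- reflexivity.
- exact: lr_gP.
by rvar.
Qed.

Lemma runs_H e ti tp ta p a : runs e ti Rinp -> runs e tp (Rnat p) ->
  runs e ta (fun v => ld_name A p.+1 v a) ->
  runs e (tH ti tp ta) (fun v => ld_name A p v (H a)).
Proof.
move=> hi hp ha; apply: (runs_let3 hi hp ha) => ui up ua pi pp pa.
have hp1 : runs [:: ua, up, ui & e] (Op OAdd (Var 1) (Num 1)) (Rnat p.+1).
  by rewrite -(addn1 p); apply: runs_addn; rvar.
apply: (runs_red (i := 1) (j := 0) (p := p) (NX := lc_name (le_mid E)) (f := red_f (lr_red (le_left E)))).
- by apply: runs_var pi.
- by rvar.
- reflexivity.
- reflexivity.
- exact: lr_fP.
apply: (runs_red (i := 2) (j := 2) (p := p.+1) (NX := lc_name (le_mid E)) (f := red_h (lr_red (le_right E)))).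
- by apply: runs_var pi.
- exact: hp1.
- reflexivity.
- reflexivity.
- exact: lr_hP.
apply: (runs_red (i := 1) (j := 1) (p := p.+1) (NX := ld_name A) (f := red_g (lr_red (le_left E)))).
- by apply: runs_var pi.
- exact: hp1.
- reflexivity.
- reflexivity.
- exact: lr_gP.
by rvar.
Qed.

Section WithGens.

Variable g : seq (gen A).
Local Notation k := (size g).
Local Notation deg := (gdegs g).
Local Notation dp := (gdiffs g).
Local Notation img := (gimgs g).
Local Notation Rg := (Rseq (@Rgen A) g).

Definition Rmonomial (w : word) (v : val) : Prop := exists u,
  v = VPair (vnat (wdeg deg w)) u /\ ld_name A (wdeg deg w) u (monomial img w).

Lemma runs_monomial e ti tg tw w : all (gtn k) w -> runs e ti Rinp ->
  runs e tg Rg -> runs e tw (Rseq Rnat w) ->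
  runs e (tmonomial ti tg tw) (Rmonomial w).
Proof.
move=> wk hi hg hw.
apply: (runs_let3 hi hg (runs_sub hw (fun v => @Rword_lt k w v wk))) => ui ug uw pi pg pw.
apply: (runs_rec (R := Rlt k) (Q := Rmonomial)).
- by rvar.
- have h1 : runs [:: uw, ug, ui & e] (sel 1 (sel 1 (Var 2))) (fun v => ld_name A 0 v (1 : dga_alg A)).
    by apply: runs_one; apply: runs_var pi.
  apply: runs_sub (runs_pair (runs_num _ 0) h1) _ => v [u1 [u2 [-> -> h]]].
  by exists u2; split => //; rewrite monomial0.
move=> i w' u us r [ik hi'] _ [a [rE na]].
have hr : runs [:: r, us, u, uw, ug, ui & e] (Var 0) (Rmonomial w').
  by apply: runs_var => //; exists a.
have hd : runs [:: r, us, u, uw, ug, ui & e] (tdeg (Var 4) (Var 2)) (Rnat (deg i)).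
  by apply: runs_deg => //; rvar.
have h0 : runs [:: r, us, u, uw, ug, ui & e] (Fst (Var 0)) (Rnat (wdeg deg w')).
  by apply: runs_fst; apply: runs_sub hr _ => v [b [-> _]]; do 2 eexists.
have h1 : runs [:: r, us, u, uw, ug, ui & e] (Snd (Var 0))
    (fun v => ld_name A (wdeg deg w') v (monomial img w')).
  by apply: runs_snd; apply: runs_sub hr _ => v [b [-> nb]]; exists (vnat (wdeg deg w')), b.
have h2 : runs [:: r, us, u, uw, ug, ui & e] (timg (Var 4) (Var 2))
    (fun v => ld_name A (deg i) v (img i)).
  by apply: runs_img => //; rvar.
have hinp : runs [:: r, us, u, uw, ug, ui & e] (Var 5) Rinp by apply: runs_var pi.
apply: runs_sub (runs_pair (runs_addn hd h0) (runs_mul hinp hd h0 h2 h1)) _ => v.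
by move=> [u1 [u2 [-> -> hn]]]; exists u2; rewrite wdeg_cons monomial_cons.
Qed.

Lemma runs_monomial_snd e t w p : wdeg deg w = p -> runs e t (Rmonomial w) ->
  runs e (Snd t) (fun v => ld_name A p v (monomial img w)).
Proof. by move=> <- h; apply: runs_snd; apply: runs_sub h _ => v [b [-> nb]]; do 2 eexists. Qed.

Lemma runs_poly_img e ti tg tp tP p P : pwf k deg p P -> runs e ti Rinp ->
  runs e tg Rg -> runs e tp (Rnat p) -> runs e tP (Rpoly P) ->
  runs e (tpoly_img ti tg tp tP) (fun v => ld_name A p v (poly_eval img P)).
Proof.
move=> wP hi hg hp hP; apply: (runs_let4 hi hg hp hP) => ui ug up uP pi pg pp pP.
pose R (m : rat * word) v := (all (gtn k) m.2 /\ wdeg deg m.2 = p) /\ Rpair Rq (Rseq Rnat) m v.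
apply: (runs_rec (R := R) (Q := fun P v => ld_name A p v (poly_eval img P))).
- apply: runs_var => //; apply: Rseq_mem pP => m u mP hm; split=> //.
  by have /andP[? /eqP] := allP wP m mP.
- rewrite /poly_eval big_nil; apply: runs_zero; last by rvar.
  by apply: runs_var pi.
move=> m P' u us r [[mk mp] hm] _ hr; rewrite /poly_eval big_cons.
have hinp : runs [:: r, us, u, uP, up, ug, ui & e] (Var 6) Rinp by apply: runs_var pi.
apply: runs_add; [by []|by rvar| |by rvar].
apply: runs_scale; [by []|by rvar|by apply: runs_Rfst; rvar|].
apply: runs_monomial_snd mp _; apply: runs_monomial => //; first by rvar.
by apply: runs_Rsnd; rvar.
Qed.

Lemma runs_crow e ti tg tp ts p s : all (gtn k) s -> wdeg deg s = p ->
  runs e ti Rinp -> runs e tg Rg -> runs e tp (Rnat p) -> runs e ts (Rseq Rnat s) ->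
  runs e (tcrow ti tg tp ts) (Rseq Rq (crow F img p s)).
Proof.
move=> sk sp hi hg hp hs; apply: (runs_let4 hi hg hp hs) => ui ug up us pi pg pp ps.
have hinp : runs [:: us, up, ug, ui & e] (Var 3) Rinp by apply: runs_var pi.
apply: runs_F => //; first by rvar.
by apply: runs_monomial_snd sp _; apply: runs_monomial => //; rvar.
Qed.

End WithGens.

End Oracles.

(** * The program of the algorithm *)

Definition tword_vals (inp g m s : tm) : tm :=
  let4 (tcat (tmap (tpcoef (Var 3) (tdword (Var 3) (Var 1)) (Var 0)) (twords (Var 2) (tplus (Var 1) 3)))
    (tcat (tcrow (Var 3) (Var 2) (tplus (Var 1) 2) (Var 0))
      (tcat (tmap (tpcoef (Var 3) (tdword (Var 3) (Var 0)) (Var 1)) (twords (Var 2) (tplus (Var 1) 1)))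
        (tnseq0 (trank (Var 3) (Var 1)))))) inp g m s.

Definition tcell_vals (inp g m i : tm) : tm :=
  let4 (tcat (tnseq0 (tlength (twords (Var 2) (tplus (Var 1) 3))))
    (tcat (tmap (Op OSub (Num 0) (Var 0)) (tget (Num 0) (Var 0) (tdrows (Var 3) (tplus (Var 1) 1))))
      (tcat (tmap (tget (Num 0) (Var 1) (tcrow (Var 4) (Var 3) (tplus (Var 2) 1) (Var 0)))
          (twords (Var 2) (tplus (Var 1) 1)))
        (tmap (tget (Num 0) (Var 1) (Var 0)) (tdrows (Var 3) (Var 1)))))) inp g m i.

Definition tnwords (g m : tm) : tm := tlength (twords g (tplus m 2)).
Definition tncoords (inp g m : tm) : tm :=
  let3 (Op OAdd (tnwords (Var 1) (Var 0)) (trank (Var 2) (tplus (Var 0) 1))) inp g m.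
Definition tnconds (inp g m : tm) : tm :=
  let3 (Op OAdd (tlength (twords (Var 1) (tplus (Var 0) 3)))
    (Op OAdd (trank (Var 2) (tplus (Var 0) 2))
      (Op OAdd (tlength (twords (Var 1) (tplus (Var 0) 1))) (trank (Var 2) (Var 0))))) inp g m.

Definition tcone_vals (inp g m i : tm) : tm :=
  let4 (Ifz (Op OLeq (tnwords (Var 2) (Var 1)) (Var 0))
    (tword_vals (Var 3) (Var 2) (Var 1) (tget (Num 0) (Var 0) (twords (Var 2) (tplus (Var 1) 2))))
    (tcell_vals (Var 3) (Var 2) (Var 1) (Op OSub (Var 0) (tnwords (Var 2) (Var 1))))) inp g m i.

Definition tharmonic (inp g m : tm) : tm :=
  let3 (titer (tcut (Var 0))
    (tmap (tcat (tcone_vals (Var 3) (Var 2) (Var 1) (Var 0))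
        (tunit_row (tncoords (Var 3) (Var 2) (Var 1)) (Var 0)))
      (tiota (tncoords (Var 2) (Var 1) (Var 0))))
    (tnconds (Var 2) (Var 1) (Var 0))) inp g m.

Definition tzpoly (g m v : tm) : tm :=
  let3 (tmap (Pair (tget (Num 0) (Var 0) (Var 1)) (tget (Num 0) (Var 0) (twords (Var 3) (tplus (Var 2) 2))))
    (tiota (tnwords (Var 2) (Var 1)))) g m v.

Definition tcpart (inp g m v : tm) : tm :=
  let4 (tmap (tget (Num 0) (Op OAdd (tnwords (Var 3) (Var 2)) (Var 0)) (Var 1))
    (tiota (trank (Var 3) (tplus (Var 1) 1)))) inp g m v.

Definition tnew_gen (inp g m v : tm) : tm :=
  let4 (Pair (tplus (Var 1) 1) (Pair (tzpoly (Var 2) (Var 1) (Var 0))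
    (Pair (tadd (Var 3) (tplus (Var 1) 1)
        (tG (Var 3) (tplus (Var 1) 1) (tcpart (Var 3) (Var 2) (Var 1) (Var 0)))
        (tH (Var 3) (tplus (Var 1) 1)
          (tpoly_img (Var 3) (Var 2) (tplus (Var 1) 2) (tzpoly (Var 2) (Var 1) (Var 0)))))
      (Num 0)))) inp g m v.

Definition tstep (inp g m : tm) : tm :=
  let3 (tcat (Var 1) (tmap (tnew_gen (Var 3) (Var 2) (Var 1) (Var 0))
    (tharmonic (Var 2) (Var 1) (Var 0)))) inp g m.

(** The ground field is already 1-minimal, so [n - 1] steps remain. The case [n = 0] is separate
    because iterating [-1] times would diverge. *)
Definition minimal_model_tm : tm :=
  Ifz (sel 0 (Var 0)) (Num 0)
    (titer (tstep (Var 2) (Var 0) (tplus (Var 1) 1)) (Num 0)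
      (Op OSub (sel 0 (Var 0)) (Num 1))).

(** * The mathematical counterpart of the program *)

Section Gallina.

Variables (A : dga) (C : eff_cochain) (F : A -> rationalization C)
  (G : rationalization C -> A) (H : A -> A).

Definition new_gen (g : seq (gen A)) m (v : seq rat) : gen A :=
  (m.+1, zpoly (size g) (gdegs g) m v,
   G (cpart C (size g) (gdegs g) m v) +
   H (poly_eval (gimgs g) (zpoly (size g) (gdegs g) m v)) : dga_alg A).

Definition harm (g : seq (gen A)) m : seq (seq rat) :=
  harmonic F (size g) (gdegs g) (gdiffs g) (gimgs g) m.

Definition step (g : seq (gen A)) m : seq (gen A) := g ++ [seq new_gen g m v | v <- harm g m].

(** The generators of degree at most [i.+1]; the shift reflects that there are none in degree 1. *)
Fixpoint steps i : seq (gen A) := if i is i'.+1 then step (steps i') i'.+1 else [::].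

(** The part of the invariant that correctness of the program depends on, stated without a model. *)
Definition gens_wf (g : seq (gen A)) : Prop := forall i, (i < size g)%N ->
  (0 < gdegs g i)%N /\ pwf (size g) (gdegs g) (gdegs g i).+1 (gdiffs g i).

End Gallina.

Section GensWf.

Variables (A : dga) (g : seq (gen A)).
Hypothesis gwf : gens_wf g.
Local Notation k := (size g).
Local Notation deg := (gdegs g).

Let dpos i : (i < k)%N -> (0 < deg i)%N. Proof. by move=> /gwf []. Qed.

Lemma words_in p w : w \in words k deg p -> all (gtn k) w /\ wdeg deg w = p.
Proof. by rewrite mem_words // => /andP[/andP[? _] /eqP]. Qed.

Lemma zpoly_pwf m v : pwf k deg m.+2 (zpoly k deg m v).
Proof.
apply/allP => mw /mapP[i]; rewrite mem_iota add0n => /= ni -> /=.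
by have [-> ->] := words_in (mem_nth [::] ni); rewrite eqxx.
Qed.

End GensWf.

Section Step.

Variables (n : nat) (A : leff_dga) (C : eff_cochain) (E : leff_equiv (ld_name A) (rat_name C)).
Local Notation Rinp := (eq (venc_input n E)).
Local Notation CQ := (rationalization C).
Local Notation F := (eqF (lr_red (le_left E)) (lr_red (le_right E))).
Local Notation G := (eqG (lr_red (le_left E)) (lr_red (le_right E))).
Local Notation H := (eqH (lr_red (le_left E)) (lr_red (le_right E))).

Variable g : seq (gen A).
Hypothesis gwf : gens_wf g.
Local Notation k := (size g).
Local Notation deg := (gdegs g).
Local Notation dp := (gdiffs g).
Local Notation img := (gimgs g).
Local Notation Rg := (Rseq (@Rgen A) g).
Local Notation W := (words k deg).

Let dpos i : (i < k)%N -> (0 < deg i)%N. Proof. by move=> /gwf []. Qed.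
Let hdp i : (i < k)%N -> pwf k deg (deg i).+1 (dp i). Proof. by move=> /gwf []. Qed.

Lemma dword_in w : all (gtn k) w -> all (fun m => all (gtn k) m.2) (dword deg dp w).
Proof. by move=> wk; apply: sub_all (dword_pwf hdp wk) => m /andP[]. Qed.

Lemma runs_length_words e tg tp p : runs e tg Rg -> runs e tp (Rnat p) ->
  runs e (tlength (twords tg tp)) (Rnat (size (W p))).
Proof. by move=> hg hp; apply: runs_size (runs_words hg hp). Qed.

Lemma runs_nat_plus e t m j : runs e t (Rnat m) -> runs e (tplus t j) (Rnat (j + m)).
Proof. by rewrite addnC; apply: runs_plus. Qed.

Lemma runs_word_vals e ti tg tmm ts m s : s \in W m.+2 -> runs e ti Rinp ->
  runs e tg Rg -> runs e tmm (Rnat m) -> runs e ts (Rseq Rnat s) ->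
  runs e (tword_vals ti tg tmm ts) (Rseq Rq (word_vals F k deg dp img m s)).
Proof.
move=> /(words_in gwf) [sk sp] hi hg hm hs; apply: (runs_let4 hi hg hm hs) => ui ug um us pi pg pm ps.
have hinp : runs [:: us, um, ug, ui & e] (Var 3) Rinp by apply: runs_var pi.
apply: runs_cat; [|apply: runs_cat; [|apply: runs_cat]].
- apply: (runs_map (runs_words (p := m.+3) _ _)); first by rvar.
    by apply: (runs_nat_plus 3); rvar.
  move=> t u [/(words_in gwf) [tk _] ht].
  apply: runs_pcoef => //; [exact: dword_in|by rvar| |by rvar].
  by apply: runs_dword => //; rvar.
- apply: (runs_crow (n := n)) => //; [by rvar| |by rvar].
  by apply: (runs_nat_plus 2); rvar.
- apply: (runs_map (runs_words (p := m.+1) _ _)); first by rvar.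
    by apply: (runs_nat_plus 1); rvar.
  move=> y u [/(words_in gwf) [yk _] hy].
  apply: runs_pcoef => //; [exact: dword_in|by rvar| |by rvar].
  by apply: runs_dword => //; rvar.
by apply: runs_nseq0; apply: (runs_rank (n := n) (E := E)) => //; rvar.
Qed.

Lemma runs_cell_vals e ti tg tmm tj m i : runs e ti Rinp ->
  runs e tg Rg -> runs e tmm (Rnat m) -> runs e tj (Rnat i) ->
  runs e (tcell_vals ti tg tmm tj) (Rseq Rq (cell_vals F k deg img m i)).
Proof.
move=> hi hg hm hj; apply: (runs_let4 hi hg hm hj) => ui ug um uj pi pg pm pj.
have hinp : runs [:: uj, um, ug, ui & e] (Var 3) Rinp by apply: runs_var pi.
apply: runs_cat; [|apply: runs_cat; [|apply: runs_cat]].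
- apply: runs_nseq0; apply: runs_length_words; first by rvar.
  by apply: (runs_nat_plus 3); rvar.
- apply: (runs_map (R := Rq)).
    apply: (runs_nth_dflt (R := Rseq Rq)); [exact: runs_nil|by rvar|].
    by apply: (runs_drows (n := n) (E := E)) => //; apply: (runs_nat_plus 1); rvar.
  by move=> a u ha; rewrite -[- a]sub0r; apply: (runs_op OSub); rvar.
- apply: (runs_map (runs_words (p := m.+1) _ _)); first by rvar.
    by apply: (runs_nat_plus 1); rvar.
  move=> y u [/(words_in gwf) [yk yp] hy]; apply: (runs_nth_dflt (R := Rq)); [by rvar|by rvar|].
  apply: (runs_crow (E := E) (n := n)) => //; first by apply: runs_var pi.
  - by rvar.
  - by apply: (runs_nat_plus 1); rvar.
  - by rvar.
apply: (runs_map (R := Rseq Rq)); first by apply: (runs_drows (n := n) (E := E)) => //; rvar.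
by move=> r u hr; apply: (runs_nth_dflt (R := Rq)); rvar.
Qed.

Lemma runs_nwords e tg tmm m : runs e tg Rg -> runs e tmm (Rnat m) ->
  runs e (tnwords tg tmm) (Rnat (nwords k deg m)).
Proof. by move=> hg hm; apply: runs_length_words hg (runs_nat_plus 2 hm). Qed.

Lemma runs_ncoords e ti tg tmm m : runs e ti Rinp -> runs e tg Rg -> runs e tmm (Rnat m) ->
  runs e (tncoords ti tg tmm) (Rnat (ncoords C k deg m)).
Proof.
move=> hi hg hm; apply: (runs_let3 hi hg hm) => ui ug um pi pg pm.
apply: runs_addn; first by apply: runs_nwords; rvar.
apply: (runs_rank (E := E) (n := n)); first by apply: runs_var pi.
by apply: (runs_nat_plus 1); rvar.
Qed.

Lemma runs_nconds e ti tg tmm m : runs e ti Rinp -> runs e tg Rg -> runs e tmm (Rnat m) ->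
  runs e (tnconds ti tg tmm) (Rnat (nconds C k deg m)).
Proof.
move=> hi hg hm; apply: (runs_let3 hi hg hm) => ui ug um pi pg pm.
have hinp : runs [:: um, ug, ui & e] (Var 2) Rinp by apply: runs_var pi.
apply: runs_addn; first by apply: runs_length_words; [rvar|apply: (runs_nat_plus 3); rvar].
apply: runs_addn; first by apply: (runs_rank (n := n) (E := E)) => //; apply: (runs_nat_plus 2); rvar.
apply: runs_addn; first by apply: runs_length_words; [rvar|apply: (runs_nat_plus 1); rvar].
by apply: (runs_rank (n := n) (E := E)) => //; rvar.
Qed.

Lemma runs_cone_vals e ti tg tmm tj m i : runs e ti Rinp ->
  runs e tg Rg -> runs e tmm (Rnat m) -> runs e tj (Rnat i) ->
  runs e (tcone_vals ti tg tmm tj) (Rseq Rq (cone_vals F k deg dp img m i)).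
Proof.
move=> hi hg hm hj; apply: (runs_let4 hi hg hm hj) => ui ug um uj pi pg pm pj.
have hinp : runs [:: uj, um, ug, ui & e] (Var 3) Rinp by apply: runs_var pi.
have hn : runs [:: uj, um, ug, ui & e] (tnwords (Var 2) (Var 1)) (Rnat (nwords k deg m)).
  by apply: runs_nwords; rvar.
rewrite /cone_vals ltnNge.
apply: (runs_ifz (a := (nwords k deg m <= i)%N%:R)).
- by apply: runs_leq hn _; rvar.
- case: leqP => //= ni _; apply: runs_word_vals => //; [exact: mem_nth|by rvar|by rvar|].
  apply: runs_nth_in ni _ _; first by rvar.
  have h : runs [:: uj, um, ug, ui & e] (twords (Var 2) (tplus (Var 1) 2)) (Rwords g m.+2).
    by apply: runs_words; [rvar|apply: (runs_nat_plus 2); rvar].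
  by apply: runs_sub h _ => v; apply: Rseq_sub => w u _ [].
case: leqP => //= ni _; apply: runs_cell_vals => //; [by rvar|by rvar|].
by apply: runs_subn => //; rvar.
Qed.

Lemma runs_harmonic e ti tg tmm m : runs e ti Rinp -> runs e tg Rg -> runs e tmm (Rnat m) ->
  runs e (tharmonic ti tg tmm) (Rseq (Rseq Rq) (harm F g m)).
Proof.
move=> hi hg hm; apply: (runs_let3 hi hg hm) => ui ug um pi pg pm.
rewrite /harm /harmonic /kernel_basis; set rows := map _ _.
apply: (runs_iter (Q := fun i => Rseq (Rseq Rq) (iter i cut rows))).
- by apply: runs_nconds; [apply: runs_var pi|rvar|rvar].
- apply: (runs_map (runs_iota (n := ncoords C k deg m) _)).
    by apply: runs_ncoords; [apply: runs_var pi|rvar|rvar].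
  move=> i u [_ hu]; apply: runs_cat.
    by apply: runs_cone_vals; [apply: runs_var pi|rvar|rvar|rvar].
  apply: runs_unit_row; last by rvar.
  by apply: runs_ncoords; [apply: runs_var pi|rvar|rvar].
by move=> i r _ hr; rewrite iterS; apply: runs_cut; rvar.
Qed.

Lemma runs_zpoly e tg tmm tv m v : runs e tg Rg -> runs e tmm (Rnat m) ->
  runs e tv (Rseq Rq v) -> runs e (tzpoly tg tmm tv) (Rpoly (zpoly k deg m v)).
Proof.
move=> hg hm hv; apply: (runs_let3 hg hm hv) => ug um uv pg pm pv.
apply: (runs_map (runs_iota (n := nwords k deg m) _)).
  by apply: runs_nwords; rvar.
move=> i u [ni hi]; apply: runs_Rpair.
  by apply: (runs_nth_dflt (R := Rq)); rvar.
apply: runs_nth_in ni _ _; first by rvar.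
have h : runs [:: u, uv, um, ug & e] (twords (Var 3) (tplus (Var 2) 2)) (Rwords g m.+2).
  by apply: runs_words; [rvar|apply: (runs_nat_plus 2); rvar].
by apply: runs_sub h _ => w; apply: Rseq_sub => w' u' _ [].
Qed.

Lemma runs_cpart e ti tg tmm tv m v : runs e ti Rinp -> runs e tg Rg -> runs e tmm (Rnat m) ->
  runs e tv (Rseq Rq v) ->
  runs e (tcpart ti tg tmm tv) (Rseq Rq (ccoord m.+1 (cpart C k deg m v))).
Proof.
move=> hi hg hm hv; apply: (runs_let4 hi hg hm hv) => ui ug um uv pi pg pm pv.
have -> : ccoord m.+1 (cpart C k deg m v) =
    [seq nth 0 v (nwords k deg m + i) | i <- iota 0 (rank C m.+1)].
  apply: (@eq_from_nth _ 0); first by rewrite size_ccoord size_map size_iota.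
  move=> i; rewrite size_ccoord => ir; rewrite (nth_ccoord _ (Ordinal ir)) ccoordE.
  by rewrite (nth_map 0%N) ?size_iota // nth_iota.
apply: (runs_map (runs_iota (n := rank C m.+1) _)).
  apply: (runs_rank (E := E) (n := n)); first by apply: runs_var pi.
  by apply: (runs_nat_plus 1); rvar.
move=> i u [_ hu]; apply: (runs_nth_dflt (R := Rq)); [by rvar| |by rvar].
by apply: runs_addn; [apply: runs_nwords; rvar|rvar].
Qed.

Lemma runs_new_gen e ti tg tmm tv m v : runs e ti Rinp -> runs e tg Rg -> runs e tmm (Rnat m) ->
  runs e tv (Rseq Rq v) -> runs e (tnew_gen ti tg tmm tv) (Rgen (new_gen (C := C) G H g m v)).
Proof.
move=> hi hg hm hv; apply: (runs_let4 hi hg hm hv) => ui ug um uv pi pg pm pv.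
have hinp : runs [:: uv, um, ug, ui & e] (Var 3) Rinp by apply: runs_var pi.
have hm1 : runs [:: uv, um, ug, ui & e] (tplus (Var 1) 1) (Rnat m.+1).
  by apply: (runs_nat_plus 1); rvar.
have hz : runs [:: uv, um, ug, ui & e] (tzpoly (Var 2) (Var 1) (Var 0)) (Rpoly (zpoly k deg m v)).
  by apply: runs_zpoly; rvar.
have ha : runs [:: uv, um, ug, ui & e]
   (tadd (Var 3) (tplus (Var 1) 1)
        (tG (Var 3) (tplus (Var 1) 1) (tcpart (Var 3) (Var 2) (Var 1) (Var 0)))
        (tH (Var 3) (tplus (Var 1) 1)
          (tpoly_img (Var 3) (Var 2) (tplus (Var 1) 2) (tzpoly (Var 2) (Var 1) (Var 0)))))
   (fun u => ld_name A m.+1 u (new_gen (C := C) G H g m v).2).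
  apply: (runs_add (n := n) (E := E)) => //.
    apply: (runs_G (n := n)) => //; first exact: cvec_hom.
    by apply: runs_cpart => //; rvar.
  apply: (runs_H (n := n)) => //; apply: (runs_poly_img (n := n) (E := E)) => //; first exact: (zpoly_pwf gwf).
    by rvar.
  by apply: (runs_nat_plus 2); rvar.
apply: runs_sub (runs_pair hm1 (runs_pair hz (runs_pair ha (runs_num _ 0)))) _ => w.
by move=> [u1 [u2 [-> -> [u3 [u4 [-> h3 [u5 [u6 [-> h5 ->]]]]]]]]]; exists u3, u5.
Qed.

Lemma runs_step e ti tg tmm m : runs e ti Rinp -> runs e tg Rg -> runs e tmm (Rnat m) ->
  runs e (tstep ti tg tmm) (Rseq (@Rgen A) (step F G H g m)).
Proof.
move=> hi hg hm; apply: (runs_let3 hi hg hm) => ui ug um pi pg pm.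
apply: runs_cat; first by rvar.
apply: (runs_map (R := Rseq Rq)).
  by apply: runs_harmonic; [apply: runs_var pi|rvar|rvar].
by move=> v u hv; apply: runs_new_gen; [apply: runs_var pi|rvar|rvar|rvar].
Qed.

End Step.

Section Main.

Variables (n : nat) (A : leff_dga) (C : eff_cochain) (E : leff_equiv (ld_name A) (rat_name C)).
Local Notation F := (eqF (lr_red (le_left E)) (lr_red (le_right E))).
Local Notation G := (eqG (lr_red (le_left E)) (lr_red (le_right E))).
Local Notation H := (eqH (lr_red (le_left E)) (lr_red (le_right E))).

Lemma runs_minimal_model : (forall i, gens_wf (steps F G H i)) ->
  runs [:: venc_input n E] minimal_model_tm (Rseq (@Rgen A) (steps F G H n.-1)).
Proof.
move=> wf.
have hn : runs [:: venc_input n E] (sel 0 (Var 0)) (Rnat n).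
  apply: runs_sub (runs_sel (s := [:: vnat n;
           vseq [:: venc_ops (ld_ops A); ld_one A; ld_mul A];
           vseq [:: ec_rank C; ec_diff C];
           vseq [:: venc_ops (lc_ops (le_mid E));
                    venc_reduction (le_left E); venc_reduction (le_right E)]]) (v := vnat n) _ _) _ => //.
  exact: runs_var.
apply: (runs_ifz hn) => [/eqP|/eqP]; rewrite pnatr_eq0 => n0.
  by rewrite (eqP n0); apply: runs_nil.
apply: (runs_iter (Q := fun i => Rseq (@Rgen A) (steps F G H i))).
- by rewrite -subn1; apply: runs_subn; [rewrite lt0n|exact: hn|exact: runs_num].
- exact: runs_nil.
move=> i r _ hr; apply: (runs_step (n := n)); [exact: wf|by apply: runs_var|by rvar|].
by apply: (runs_nat_plus 1); rvar.
Qed.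

End Main.

(** * The minimal model *)

Section Unit.

Definition unit_homog (p : nat) (x : rat^o) : Prop := p != 0%N -> x = 0.

Fact unit_homog0 p : unit_homog p 0. Proof. by []. Qed.
Fact unit_homogD p x y : unit_homog p x -> unit_homog p y -> unit_homog p (x + y).
Proof. by move=> hx hy p0; rewrite hx // hy // addr0. Qed.
Fact unit_homogZ p (a : rat) (x : rat^o) : unit_homog p x -> unit_homog p (a *: x).
Proof. by move=> hx p0; rewrite hx // scaler0. Qed.
Fact unit_span (x : rat^o) : exists (N : nat) (w : nat -> rat^o),
  (forall p, unit_homog p (w p)) /\ x = \sum_(p < N) w p.
Proof.
exists 1%N, (fun p => if p == 0%N then x else 0); split; last by rewrite big_ord1.
by move=> p /negPf ->.
Qed.
Fact unit_direct (N : nat) (w : nat -> rat^o) :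
  (forall p, unit_homog p (w p)) -> \sum_(p < N) w p = 0 ->
  forall p, (p < N)%N -> w p = 0.
Proof.
move=> hw; case: N => // N; rewrite big_ord_recl big1 ?addr0 => [w0 [//|p _]|i _].
  exact: hw.
exact: hw.
Qed.

Definition unit_grading := Grading unit_homog0 unit_homogD unit_homogZ unit_span unit_direct.

(** Simple connectedness says that the unit map is bijective on [H^0] and that [H^1] of the target
    vanishes. This is what a 1-quasi-isomorphism from the ground field demands, whose cohomology is
    zero in positive degrees. *)
Lemma unit_dga : exists Q : dga, forall (A : dga), simply_connected A ->
  exists (phi : dga_mor Q A) (x : nat -> dga_alg Q),
  [/\ forall deg, wfree 0 deg x, forall i, x i = 0 & n_quasi_iso 1 (phi : Q -> A)].
Proof.
have [D DE] : exists D : {linear rat^o -> rat^o}, forall x, D x = 0.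
  by apply: linear_ex => k x y; rewrite scaler0 addr0.
have Ddeg p x : unit_homog p x -> unit_homog p.+1 (D x) by rewrite DE.
have Dsq x : D (D x) = 0 by rewrite DE.
have h1 : unit_homog 0 (1 : rat^o) by [].
have hM p q (a b : rat^o) : unit_homog p a -> unit_homog q b -> unit_homog (p + q) (a * b).
  move=> ha hb; rewrite /unit_homog addn_eq0 negb_and => /orP[/ha->|/hb->].
    by rewrite mul0r.
  by rewrite mulr0.
have hC p q (a b : rat^o) : unit_homog p a -> unit_homog q b ->
    a * b = (-1) ^+ (p * q) *: (b * a).
  move=> ha hb; case: p ha => [|p] ha; first by rewrite mul0n scale1r mulrC.
  by rewrite ha // mul0r mulr0 scaler0.
have hL p q (a b : rat^o) : unit_homog p a -> unit_homog q b ->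
    D (a * b) = D a * b + (-1) ^+ p *: (a * D b).
  by move=> _ _; rewrite !DE mul0r mulr0 scaler0 addr0.
pose Q := @Dga rat^o unit_grading D Ddeg Dsq h1 hM hC hL.
exists Q => A [one_nz h0 h1'].
pose f (x : rat^o) : dga_alg A := (x : rat) *: 1.
have fl : linear f.
  by move=> k x y; rewrite /f scalerDl scalerA.
have fm : monoid_morphism f.
  split; first exact: scale1r.
  by move=> x y; rewrite /f -scalerAl mul1r scalerA.
pose phi : {lrmorphism rat^o -> dga_alg A} := HB.pack_for {lrmorphism rat^o -> dga_alg A}
  f (GRing.isLinear.Build rat rat^o (dga_alg A) _ f fl)
  (GRing.isMonoidMorphism.Build rat^o (dga_alg A) f fm).
have phi_deg p (x : Q) : hom p x -> hom p (phi x : A).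
  move=> hx; case: p hx => [|p] hx; first by apply: homogZ; apply: dga_one_deg.
  by rewrite (hx isT) linear0; apply: homog0.
have phi_d (x : Q) : phi (codiff Q x) = codiff A (phi x).
  have [tau tauE] := dga_sign A.
  have -> : codiff Q x = 0 by apply: DE.
  by rewrite linear0 [phi x]/(_ *: 1) codiffZ [codiff A 1](d_one tauE) scaler0.
exists (@DgaMor Q A phi phi_deg phi_d), (fun=> 0); split => //.
- move=> deg; split => // [a|S c uS aS].
    exists [:: ((a : rat), [::])]; split => //.
    by rewrite /poly_eval big_seq1 monomial0 /=; apply/esym/mulr1.
  have all0 s : s \in S -> s = [::] by move=> /(allP aS) /andP[]; case: s.
  move=> S0 s sS; rewrite (all0 _ sS).
  move: S0; rewrite (bigD1_seq s) //= big1_seq ?addr0 => [|t /andP[ts /all0 t0]]; last first.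
    by rewrite t0 (all0 _ sS) eqxx in ts.
  by rewrite (all0 _ sS) monomial0 => /eqP; rewrite scaler_eq0 oner_eq0 orbF => /eqP.
- have zero (p : nat) (x : Q) : (0 < p)%N -> hom p x -> x = 0.
    by rewrite lt0n => p0 /(_ p0).
  have inj p : (0 < p)%N -> cohom_inj (phi : Q -> A) p.
    move=> p0 x [hx _] _; rewrite (zero p x p0 hx).
    by case: p {p0 hx} => //= p; exists 0; [apply: homog0|rewrite linear0].
  split=> [[|[|//]] _|]; last exact: inj.
    split=> [x _ /= x0|y hy].
      apply/eqP/negP => /negP nx; apply: one_nz => /=.
      have -> : (1 : dga_alg A) = x^-1 *: (x *: 1) by rewrite scalerA mulVf // scale1r.
      by rewrite [x *: 1]x0 scaler0.
    have [c cE] := h0 y hy; by exists (c : rat^o).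
  split; first exact: inj.
  move=> y hy; exists 0; first by split; [apply: homog0|apply: DE].
  by rewrite /= [f 0]scale0r subr0; apply: h1'.
Qed.

End Unit.

Lemma wfree_eq (M : dga) k deg (x y : nat -> dga_alg M) :
  (forall i, (i < k)%N -> x i = y i) -> wfree k deg x -> wfree k deg y.
Proof.
move=> xy [hx sp ind].
have mE w : wstd k deg w -> monomial x w = monomial y w.
  by move=> /andP[wk _]; apply: eq_monomial => i /(allP wk) /xy.
split.
- by move=> i ik; rewrite -xy //; apply: hx.
- move=> a; have [P [aP ->]] := sp a; exists P; split => //.
  by rewrite /poly_eval !big_seq; apply: eq_bigr => m /(allP aP) /mE ->.
- move=> S c uS aS S0; apply: ind => //; rewrite -[RHS]S0 !big_seq.
  by apply: eq_bigr => s /(allP aS) /mE ->.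
Qed.

Lemma eq_poly_eval (M : dga) k (x y : nat -> dga_alg M) (P : seq (rat * word)) :
  (forall i, (i < k)%N -> x i = y i) -> all (fun m => all (gtn k) m.2) P ->
  poly_eval x P = poly_eval y P.
Proof.
move=> xy aP; rewrite /poly_eval !big_seq; apply: eq_bigr => m /(allP aP) mk.
by congr (_ *: _); apply: eq_monomial => i /(allP mk) /xy.
Qed.

Lemma pwf_letters k deg p P : pwf k deg p P -> all (fun m => all (gtn k) m.2) P.
Proof. by apply: sub_all => m /andP[]. Qed.

Lemma pwf_widen k k' deg deg' p P : (k <= k')%N -> (forall i, (i < k)%N -> deg i = deg' i) ->
  pwf k deg p P -> pwf k' deg' p P.
Proof.
move=> kk e; apply: sub_all => m /andP[mk]; rewrite (eq_wdeg e mk) => ->; rewrite andbT.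
by apply: sub_all mk => i /= ik; apply: leq_trans kk.
Qed.

(* The generators [g] are those of an [m]-minimal model of [A]. *)
Definition model_gens (A : dga) (m : nat) (g : seq (gen A)) : Prop :=
  [/\ gens_wf g, forall i, (i < size g)%N -> (2 <= gdegs g i <= m)%N,
      forall i, (i < size g)%N -> all (fun t => 1 < size t.2)%N (gdiffs g i)
    & exists (M : dga) (phi : dga_mor M A) (x : nat -> dga_alg M),
      [/\ wfree (size g) (gdegs g) x,
          forall i, (i < size g)%N -> dga_diff M (x i) = poly_eval x (gdiffs g i),
          gimgs g = fun i => phi (x i) & n_quasi_iso m (phi : M -> A)]].

Section Step.

Variables (X : cochain) (A : dga) (C : eff_cochain).
Variables (r1 : reduction X A) (r2 : reduction X (rationalization C)).
Local Notation F := (eqF r1 r2).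
Local Notation G := (eqG r1 r2).
Local Notation H := (eqH r1 r2).

Lemma model_gens_step (g : seq (gen A)) m : (0 < m)%N ->
  model_gens m g -> model_gens m.+1 (step F G H g m).
Proof.
move=> m0 [wf deg2 sz2 [M [phi [x [fx dx imgE iso]]]]].
set g' := step F G H g m; set k := size g.
have dpos i : (i < k)%N -> (0 < gdegs g i)%N by move=> /wf [].
have hdp i : (i < k)%N -> pwf k (gdegs g) (gdegs g i).+1 (gdiffs g i) by move=> /wf [].
pose hb := harmonic F k (gdegs g) (gdiffs g) (fun i => phi (x i)) m; pose r := size hb.
have g'E : g' = g ++ [seq new_gen (C := C) G H g m v | v <- hb] by rewrite /g' /step /harm imgE.
have sg' : size g' = (k + r)%N by rewrite g'E size_cat size_map.
have nth_old i : (i < k)%N -> nth (gen0 A) g' i = nth (gen0 A) g i by move=> ik; rewrite g'E nth_cat ik.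
have nth_new j : (j < r)%N -> nth (gen0 A) g' (k + j) = new_gen (C := C) G H g m (nth [::] hb j).
  by move=> jr; rewrite g'E nth_cat ltnNge leq_addr addKn (nth_map [::]).
have degE i : (i < k)%N -> gdegs g i = gdegs g' i by move=> ik; rewrite /gdegs nth_old.
have degN j : (j < r)%N -> gdegs g' (k + j) = m.+1 by move=> jr; rewrite /gdegs nth_new.
have dpE i : (i < k)%N -> gdiffs g i = gdiffs g' i by move=> ik; rewrite /gdiffs nth_old.
have dpN j : (j < r)%N -> gdiffs g' (k + j) = zpoly k (gdegs g) m (nth [::] hb j).
  by move=> jr; rewrite /gdiffs nth_new.
have cases (P : nat -> Prop) : (forall i, (i < k)%N -> P i) ->
    (forall j, (j < r)%N -> P (k + j)%N) -> forall i, (i < size g')%N -> P i.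
  move=> h1 h2 i; rewrite sg'; have [ik|ki] := ltnP i k; first by move=> _; apply: h1.
  by rewrite -{1}(subnKC ki) ltn_add2l => /h2; rewrite subnKC.
have kk : (k <= size g')%N by rewrite sg' leq_addr.
have wf' : gens_wf g'.
  apply: cases => i ir.
    rewrite -degE // -dpE //; split; first exact: dpos.
    exact: pwf_widen kk degE (hdp i ir).
  rewrite degN // dpN //; split => //.
  exact: pwf_widen kk degE (zpoly_pwf wf m _).
split => //.
- apply: cases => i ir; last by rewrite degN // leqnn andbT ltnS.
  by rewrite -degE //; have /andP[-> /leqW->] := deg2 i ir.
- apply: cases => i ir; first by rewrite -dpE //; apply: sz2.
  (* The source of minimality: a differential of degree m+2 contains neither the empty word, of
     degree 0, nor a single letter, as old letters have degree at most m. *)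
  rewrite dpN //; apply/allP => t /mapP[l]; rewrite mem_iota add0n => /= ln -> /=.
  have [wk wd] := words_in wf (mem_nth [::] ln).
  move: wk wd; case: (nth _ _ _) => [|a [|b w]] //= /andP[ak _].
  by rewrite wdeg_cons /wdeg /= addn0 => e; have := deg2 _ ak; rewrite e; lia.
pose zj j := zval k (gdegs g) m x (nth 0 (nth [::] hb j)).
pose Lj j : dga_alg A := eqG r1 r2 (cval C k (gdegs g) m (nth 0 (nth [::] hb j))) + eqH r1 r2 (phi (zj j)).
have hz j : (j < r)%N -> [/\ cocycle m.+2 (zj j : M), hom m.+1 (Lj j : A) &
     codiff A (Lj j) = phi (zj j)].
  move=> jr; have [dz _] := v_closed fx deg2 hdp dx jr.
  split; [by split; first exact: (zval_hom fx deg2)|exact: aj_deg|exact: aj_d].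
have [M' [iota [phi' [x0 [fx0 pE iinj x0E x0N]]]]] := hirsch_seq fx degE degN hz.
(* Zero beyond the generators agrees with the default of [gimgs], so that the images are equal as
   functions on all naturals. *)
pose x' i := if (i < k + r)%N then x0 i else 0.
have x0x' i : (i < k + r)%N -> x0 i = x' i by rewrite /x' => ->.
have x'E i : (i < k)%N -> x' i = iota (x i).
  by move=> ik; rewrite -x0x' ?x0E // ltn_addr.
have fx' := wfree_eq x0x' fx0.
have x'N j : (j < r)%N -> dga_diff M' (x' (k + j)%N) = iota (zj j) /\ phi' (x' (k + j)%N) = Lj j.
  by move=> jr; rewrite -x0x' ?ltn_add2l //; apply: x0N.
have pol P : all (fun t : rat * word => all (gtn k) t.2) P -> poly_eval x' P = iota (poly_eval x P).
  by move=> aP; rewrite poly_eval_map; apply: eq_poly_eval aP => i /x'E.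
exists M', phi', x'; split.
- by rewrite sg'.
- apply: cases => i ir.
    rewrite x'E // -dpE // pol ?(pwf_letters (hdp i ir)) // -dx //.
    by have /= -> := dga_fun_d iota (x i).
  rewrite (x'N _ ir).1 dpN // pol; last exact: pwf_letters (zpoly_pwf wf m _).
  congr (iota _); rewrite /zj /zval /poly_eval big_map sum_iota.
  by [].
- apply: functional_extensionality => i.
  have [ik|ki] := ltnP i (k + r); last first.
    by rewrite /x' ltnNge ki linear0 /gimgs nth_default // sg'.
  move: i ik; rewrite -sg'; apply: cases => i ir.
    by rewrite x'E // pE /gimgs nth_old //; have := congr1 (fun f => f i) imgE.
  rewrite (x'N _ ir).2 /gimgs nth_new // /new_gen [RHS]/=.
  have e : poly_eval (gimgs g) (zpoly k (gdegs g) m (nth [::] hb i)) = phi (zj i).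
    by rewrite imgE -poly_eval_map; congr (phi _); rewrite /zj /zval /poly_eval big_map sum_iota.
  by rewrite e.
- exact: (step_quasi_iso fx deg2 hdp dx m0 iso degE degN fx' pE iinj x'E x'N).
Qed.

End Step.

(** * Minimality of the differential *)

Section Decomposable.

Variable M : dga.

Lemma decomposable0 : decomposable (0 : dga_alg M).
Proof. by exists [::]; split => //; rewrite big_nil. Qed.

Lemma decomposableD (a b : dga_alg M) : decomposable a -> decomposable b -> decomposable (a + b).
Proof.
move=> [s [hs ->]] [t [ht ->]]; exists (s ++ t); split; last by rewrite big_cat.
by move=> u; rewrite mem_cat => /orP[/hs|/ht].
Qed.

Lemma positive_hom p (a : dga_alg M) : hom p.+1 (a : M) -> positive a.
Proof.
move=> ha; exists [:: a]; split; last by rewrite big_seq1.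
by move=> u; rewrite inE => /eqP->; exists p.
Qed.

Lemma decomposable_mul p q (a b : dga_alg M) : hom p.+1 (a : M) -> hom q.+1 (b : M) ->
  decomposable (a * b).
Proof.
move=> ha hb; exists [:: (a, b)]; split; last by rewrite big_seq1.
by move=> u; rewrite inE => /eqP->; split; [apply: positive_hom ha|apply: positive_hom hb].
Qed.

Variables (k : nat) (deg : nat -> nat) (dp : nat -> seq (rat * word)) (x : nat -> dga_alg M).
Hypothesis fx : wfree k deg x.
Hypothesis dpos : forall i, (i < k)%N -> (0 < deg i)%N.
Hypothesis hdp : forall i, (i < k)%N -> pwf k deg (deg i).+1 (dp i).
Hypothesis dx : forall i, (i < k)%N -> dga_diff M (x i) = poly_eval x (dp i).
Hypothesis sz2 : forall i, (i < k)%N -> all (fun t => 1 < size t.2)%N (dp i).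

Let hx i : (i < k)%N -> hom (deg i) (x i : M). Proof. by case: fx => h _ _ ik; exact: h. Qed.

Lemma monomial_decomposable c w : all (gtn k) w -> (1 < size w)%N ->
  decomposable (c *: monomial x w).
Proof.
case: w => [|i [|j w]] //= /and3P[ik jk wk] _; rewrite monomial_cons scalerAl.
have hi : hom (deg i).-1.+1 (c *: x i : M).
  by rewrite prednK ?dpos //; apply: homogZ; apply: hx.
have hj : hom (wdeg deg (j :: w)).-1.+1 (monomial x (j :: w) : M).
  rewrite prednK; last by rewrite wdeg_cons addn_gt0 dpos.
  by apply: (monomial_hom hx); rewrite /= jk.
exact: decomposable_mul hi hj.
Qed.

Lemma poly_decomposable (P : seq (rat * word)) : all (fun m => all (gtn k) m.2) P ->
  all (fun t => 1 < size t.2)%N P -> decomposable (poly_eval x P).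
Proof.
elim: P => [|m P IH] /=; first by rewrite /poly_eval big_nil => _ _; apply: decomposable0.
move=> /andP[mk Pk] /andP[m2 P2]; rewrite /poly_eval big_cons; apply: decomposableD.
  exact: monomial_decomposable.
exact: IH.
Qed.

(** The Leibniz rule replaces one letter by words of at least two letters, so words never get
    shorter. *)
Lemma dword_size w : all (gtn k) w -> all (fun t => 1 < size t.2)%N (dword deg dp w).
Proof.
elim: w => //= i w IH /andP[ik wk]; rewrite all_cat !all_map; apply/andP; split.
  apply: sub_all (sz2 ik) => m /= m2; rewrite size_cat; exact: leq_trans m2 (leq_addr _ _).
by apply: sub_all (IH wk) => m /= m2; apply: ltnW.
Qed.

Lemma diff_decomposable a : positive a -> decomposable (dga_diff M a).
Proof.
move=> [s [hs ->]]; elim: s hs => [|u s IH] hs.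
  by rewrite big_nil linear0; apply: decomposable0.
rewrite big_cons linearD; apply: decomposableD; last first.
  by apply: IH => v vs; apply: hs; rewrite in_cons vs orbT.
have [p hu] := hs u (mem_head _ _); have [c ->] := wfree_hom fx dpos hu.
rewrite big_seq linear_sum; elim/big_ind: _ => [|v w|t tW].
- exact: decomposable0.
- exact: decomposableD.
move: tW; rewrite mem_words // => /andP[/andP[tk _] _].
rewrite linearZ /= (dword_eval hx dx tk) -poly_evalZ; apply: poly_decomposable.
  by rewrite all_map; apply: sub_all (dword_pwf hdp tk) => m /andP[].
by rewrite all_map; apply: sub_all (dword_size tk).
Qed.

End Decomposable.

(** * From bounded naturals to ordinals, as the presentation requires *)

Section Ordinals.

Variable k : nat.

Definition ord_word (w : word) : seq 'I_k := pmap insub w.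

Lemma ord_wordK w : all (gtn k) w -> map \val (ord_word w) = w.
Proof.
rewrite /ord_word; elim: w => //= i w IH /andP[ik wk].
by rewrite insubT /= IH.
Qed.

Lemma map_valK (w : seq 'I_k) : ord_word (map \val w) = w.
Proof. by rewrite /ord_word; elim: w => //= i w ->; rewrite valK. Qed.

Lemma val_letters (w : seq 'I_k) : all (gtn k) (map \val w).
Proof. by rewrite all_map; apply/allP => i _ /=. Qed.

Definition ord_poly (P : seq (rat * word)) : seq (rat * seq 'I_k) :=
  [seq (m.1, ord_word m.2) | m <- P].

Variables (M : dga) (deg : nat -> nat) (x : nat -> dga_alg M).

Lemma ord_monomial (w : seq 'I_k) : monomial (fun i : 'I_k => x i) w = monomial x (map \val w).
Proof. by rewrite /monomial big_map. Qed.

Lemma ord_poly_eval P : all (fun m => all (gtn k) m.2) P ->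
  poly_eval (fun i : 'I_k => x i) (ord_poly P) = poly_eval x P.
Proof.
move=> aP; rewrite /poly_eval big_map !big_seq; apply: eq_bigr => m /(allP aP) mk /=.
by rewrite ord_monomial ord_wordK.
Qed.

Lemma ord_standard (w : seq 'I_k) : standard (fun i : 'I_k => deg i) w = standard deg (map \val w).
Proof. by rewrite /standard sorted_map. Qed.

Lemma ord_free : wfree k deg x -> free_on (fun i : 'I_k => deg i) (fun i : 'I_k => x i).
Proof.
move=> [hx sp ind]; split.
- by move=> i; apply: hx.
- move=> a; have [P [aP ->]] := sp a; exists (ord_poly P); split.
    rewrite all_map; apply: sub_all aP => m /andP[mk ms] /=.
    by rewrite ord_standard ord_wordK.
  by rewrite ord_poly_eval //; apply: sub_all aP => m /andP[].
- move=> S c uS aS S0 s sS.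
  have vinj : injective (map \val : seq 'I_k -> seq nat) by apply: inj_map; apply: val_inj.
  have := ind (map (map \val) S) (fun w => c (ord_word w)).
  rewrite map_inj_uniq // => /(_ uS) h.
  have {}h := h _ _ (map \val s) (map_f _ sS); rewrite map_valK in h; apply: h.
    rewrite all_map; apply: sub_all aS => w ws /=.
    by rewrite /wstd val_letters -ord_standard.
  rewrite big_map -[RHS]S0; apply: eq_bigr => w _.
  by rewrite map_valK ord_monomial.
Qed.

End Ordinals.

Definition poly_val (P : seq (rat * word)) : val :=
  vseq [seq VPair (VNum m.1) (vseq [seq vnat i | i <- m.2]) | m <- P].

Lemma Rpoly_val P v : Rpoly P v -> v = poly_val P.
Proof.
elim: P v => //= m P IH v [u [w [-> [a [b [-> -> hb]]] /IH ->]]].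
by congr VPair; congr VPair; apply/(Rseq_vseq vnat).
Qed.

(** The names of the images are read off from the value returned; all the rest of it is determined
    by the generators. *)
Lemma Rgens_val (A : leff_dga) (g : seq (gen A)) v : Rseq (@Rgen A) g v ->
  exists im : nat -> val,
    v = vseq [seq vseq [:: vnat (gdegs g i); poly_val (gdiffs g i); im i] | i <- iota 0 (size g)] /\
    forall i, (i < size g)%N -> ld_name A (gdegs g i) (im i) (gimgs g i).
Proof.
elim: g v => [|x g IH] v /=; first by move=> ->; exists (fun=> VNum 0).
move=> [u [w [-> [vp [a [-> /Rpoly_val -> na]]] /IH [im [-> him]]]]].
exists (fun i => if i is i'.+1 then im i' else a); split; last by case.
congr VPair; rewrite -[1%N]/(1 + 0)%N iotaDl -map_comp; congr vseq.
Qed.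

Theorem theoremA :
  exists alg : tm,
    forall (n : nat) (A : leff_dga) (C : eff_cochain)
      (E : leff_equiv (ld_name A) (rat_name C)),
      simply_connected A ->
      fin_dim_cohomology (rationalization C) ->
      exists P : presentation,
        eval [:: venc_input n E] alg (venc_presentation P) /\
        exists (M : dga) (phi : dga_mor M A),
          n_minimal_model n phi /\ presents P phi.
Proof.
exists minimal_model_tm => n A C E simplyA _.
pose r1 := lr_red (le_left E); pose r2 := lr_red (le_right E).
pose g i := steps (eqF r1 r2) (eqG r1 r2) (eqH r1 r2) i.
(* The induction starts in degree 1, with no generators and the ground field as model. *)
have inv i : model_gens i.+1 (g i).
  elim: i => [|i IH]; last exact: model_gens_step.
  have [Q hQ] := unit_dga; have [phi [x [fx x0 iso]]] := hQ A simplyA.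
  split=> //; exists Q, phi, x; split => //.
  by apply: functional_extensionality => i; rewrite x0 linear0 /gimgs nth_nil.
have wfs i : gens_wf (g i) by have [] := inv i.
have [v ev /Rgens_val [im [vE him]]] := runs_minimal_model (E := E) n wfs.
have [wf deg2 sz2 [M [phi [x [fx dx imgE iso]]]]] := inv n.-1.
set gn := g n.-1 in wf deg2 sz2 fx dx imgE vE him; set k := size gn.
have hdp i : (i < k)%N -> pwf k (gdegs gn) (gdegs gn i).+1 (gdiffs gn i) by move=> /wf [].
have dpos i : (i < k)%N -> (0 < gdegs gn i)%N by move=> /wf [].
(* For [n = 0] the list of generators is empty; otherwise [n.-1.+1] is [n]. *)
have degn j : (j < k)%N -> (2 <= gdegs gn j <= n)%N.
  move=> jk; have := deg2 j jk; have [n0|npos] := posnP n; last by rewrite prednK.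
  by move: jk; rewrite /k /gn n0.
pose P := @Presentation k (fun i => gdegs gn i) (fun i => ord_poly k (gdiffs gn i)) (fun i => im i).
exists P; split.
  suff <- : v = venc_presentation P by [].
  rewrite vE /venc_presentation -val_enum_ord -map_comp; congr vseq.
  apply: eq_map => i /=; congr (VPair _ (VPair _ _)).
  rewrite /poly_val /venc_poly /ord_poly -map_comp; congr vseq.
  apply/eq_in_map => m mP /=; congr (VPair _ (vseq _)).
  have mk : all (gtn k) m.2 := allP (pwf_letters (hdp i (ltn_ord i))) m mP.
  by rewrite -[in LHS](ord_wordK mk) -map_comp.
have fo := ord_free fx.
exists M, phi; split; last first.
  exists (fun i : 'I_k => x i); split => // i.
    by rewrite dx // ord_poly_eval //; apply: pwf_letters (hdp i (ltn_ord i)).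
  by have := him i (ltn_ord i); rewrite imgE.
split; last first.
  (* For [n = 0] the map at hand is a 1-quasi-isomorphism, which covers degree 0 and injectivity in
     degree 1. *)
  have [n0|npos] := posnP n; last by move: iso; rewrite prednK.
  move: iso; rewrite n0 => -[h _]; split=> [j|]; last by have [] := h 1%N isT.
  by rewrite leqn0 => /eqP->; apply: h.
split; last exact: diff_decomposable fx dpos hdp dx sz2.
exists _, 'I_k, (fun i : 'I_k => gdegs gn i), (fun i : 'I_k => x i); split => // i.
exact: degn.
Qed.
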